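(* Let $n,m\ge 1$ be integers, $q>0$, and let $\overline{B_q}\subset\mathbb{R}^m$ be the closed ball of radius $q$ centered at the origin. Let $W:\overline{B_q}\to[0,\infty)$ satisfy: (H1) $W\ge 0$ and $W(0)=0$; (H2) $W$ is lower semicontinuous and bounded on $\overline{B_q}$; (H3) $W(u)=W_{\mathrm{rad}}(|u|)+W_0(u)$ for all $u\in\overline{B_q}$, where $W_{\mathrm{rad}}:[0,q]\to[0,\infty)$ is a nondecreasing, lower semicontinuous function and $W_0:\overline{B_q}\to[0,\infty)$ is a function such that $W_0(r\xi)\le W_0(s\xi)$ for all $0\le r\le s\le q$ and all unit vectors $\xi\in\mathbb{R}^m$. Let $\Omega\subset\mathbb{R}^n$ be open and let $u\in W^{1,2}_{\mathrm{loc}}(\Omega;\mathbb{R}^m)$ be such that $\|u\|_{L^\infty(\Omega;\mathbb{R}^m)}\le q$ and $u$ is a local minimizer of $E$ for perturbations bounded by $q$ (see context). Then, for every closed ball $\overline{B_R(x_0)}\subset\Omega$ ($R>0$), $$|u(x)|\le\overline{\Psi}_R(x-x_0)\quad\text{for all }x\in\overline{B_R(x_0)},$$ where $\overline{\Psi}_R$ is the greatest minimizer of $J_{B_R}$ in the class $A_R$, associated with $W_{\mathrm{rad}}$ (see context).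
   Context: For open $\omega\subset\mathbb{R}^n$ and $v\in W^{1,2}(\omega;\mathbb{R}^m)$ with $|v|\le q$ a.e., $E_\omega(v):=\int_\omega\big[\frac12|\nabla v|^2+W(v)\big]\,dx$. Local minimizer for perturbations bounded by $q$: for every bounded open set $\omega$ with Lipschitz boundary such that $\overline\omega\subset\Omega$, and every $v=u+\xi$ with $\xi\in W^{1,2}_0(\omega;\mathbb{R}^m)$ and $\|v\|_{L^\infty(\omega;\mathbb{R}^m)}\le q$, one has $E_\omega(u)\le E_\omega(v)$. Such a $u$ has a continuous representative in $\Omega$, with which it is identified. Comparison function: let $B_R\subset\mathbb{R}^n$ be the open ball of radius $R$ centered at the origin. Put $\tilde W_{\mathrm{rad}}(r)=W_{\mathrm{rad}}(|r|)$ for $|r|\le q$ and $\tilde W_{\mathrm{rad}}(r)=W_{\mathrm{rad}}(q)$ for $|r|\ge q$; $J_{B_R}(h):=\int_{B_R}\big[\frac12|\nabla h|^2+\tilde W_{\mathrm{rad}}(h)\big]dx$; $A_R:=\{h\in W^{1,2}(B_R;\mathbb{R}): h=q\text{ on }\partial B_R\}$ (boundary values in the trace sense). $\overline{\Psi}_R$ denotes the unique minimizer of $J_{B_R}$ in $A_R$ such that every minimizer $\psi$ of $J_{B_R}$ in $A_R$ satisfies $\psi\le\overline{\Psi}_R$ in $\overline{B_R}$; it exists, is radial, continuous on $\overline{B_R}$, and nondecreasing as a function of $|x|$. *)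

(* Defs.v *)
From HB Require Import structures.
From mathcomp Require Import all_boot all_order all_algebra.
From mathcomp Require Import all_classical all_reals all_analysis.

Set Implicit Arguments.
Unset Strict Implicit.
Unset Printing Implicit Defensive.
Import Order.TTheory GRing.Theory Num.Theory.
Import numFieldNormedType.Exports.
Local Open Scope classical_set_scope.
Local Open Scope ring_scope.

(** The library's norm on ['rV[R]_n] is the sup norm; it induces the usual
    topology, but lengths and balls below are Euclidean. *)

Definition dotv (R : realType) (n : nat) (x y : 'rV[R]_n) : R :=
  \sum_(i < n) x ord0 i * y ord0 i.

Definition enorm (R : realType) (n : nat) (x : 'rV[R]_n) : R :=
  Num.sqrt (\sum_(i < n) x ord0 i ^+ 2).

Definition eball (R : realType) (n : nat) (x : 'rV[R]_n) (r : R) :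
  set 'rV[R]_n := [set y | enorm (y - x) < r].

Definition ecball (R : realType) (n : nat) (x : 'rV[R]_n) (r : R) :
  set 'rV[R]_n := [set y | enorm (y - x) <= r].

(** The product sigma-algebra on R^n, i.e. its Borel sigma-algebra. *)

Definition rv_display : measure_display. Proof. exact: default_measure_display. Qed.

Definition rv_coord (R : realType) (n : nat) (i : 'I_n) (x : 'rV[R]_n) : R :=
  x ord0 i.

Section measurable_rv.
Context (R : realType) (n : nat).

Let rv0 : g_sigma_preimage (@rv_coord R n) set0.
Proof. exact: sigma_algebra0. Qed.

Let rvC A : g_sigma_preimage (@rv_coord R n) A ->
  g_sigma_preimage (@rv_coord R n) (~` A).
Proof. exact: sigma_algebraC. Qed.

Let rvU (F : _^nat) : (forall i, g_sigma_preimage (@rv_coord R n) (F i)) ->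
  g_sigma_preimage (@rv_coord R n) (\bigcup_i (F i)).
Proof. exact: sigma_algebra_bigcup. Qed.

HB.instance Definition _ := @isMeasurable.Build rv_display
  'rV[R]_n (g_sigma_preimage (@rv_coord R n)) rv0 rvC rvU.

End measurable_rv.

Lemma measurable_rv_coord (R : realType) (n : nat) (i : 'I_n) :
  measurable_fun [set: 'rV[R]_n] (rv_coord i).
Proof.
move=> _ B mB; rewrite setTI; apply: sub_sigma_algebra => /=.
rewrite -bigcup_seq/=; exists i => /=; first by rewrite mem_index_enum.
by exists B => //; rewrite setTI.
Qed.

Lemma measurable_fun_rvP d (T : measurableType d) (R : realType) (n : nat)
    (f : T -> 'rV[R]_n) :
  measurable_fun setT f <-> forall i, measurable_fun setT (rv_coord i \o f).
Proof.
split=> [mf i|mf].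
  by apply: (measurableT_comp (measurable_rv_coord i)).
apply: measurability; first by [].
move=> _ [A + <-]; rewrite -bigcup_seq/= => -[i _ [B mB <-]].
by rewrite !setTI -comp_preimage -[X in measurable X]setTI; exact: mf.
Qed.

Definition rv_cons (R : realType) (n : nat) (p : R * 'rV[R]_n) : 'rV[R]_n.+1 :=
  row_mx (p.1)%:M p.2.

(** Lebesgue measure on R^n, as an iterated product. *)

Fixpoint leb (R : realType) (n : nat) : set 'rV[R]_n -> \bar R :=
  match n with
  | 0 => \d_(0 : 'rV[R]_0)
  | k.+1 => pushforward (@lebesgue_measure R \x^ @leb R k)%E (@rv_cons R k)
  end.
Arguments leb {R} n.

Lemma measurable_rv_cons (R : realType) (n : nat) :
  measurable_fun setT (@rv_cons R n).
Proof.
apply/measurable_fun_rvP => i.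
case: (@split_ordP 1 n i) => j ->.
  rewrite (_ : _ \o _ = fst) //; apply/funext => p.
  apply: etrans (row_mxEl (p.1)%:M p.2 ord0 j) _.
  by rewrite mxE (ord1 j) eqxx.
rewrite (_ : _ \o _ = rv_coord j \o snd).
  by apply: (measurableT_comp (measurable_rv_coord j)).
by apply/funext => p; exact: (row_mxEr (p.1)%:M p.2 ord0 j).
Qed.

Lemma leb_is_measure (R : realType) (n : nat) :
  exists mu : {measure set 'rV[R]_n -> \bar R}, @leb R n = mu :> (_ -> _).
Proof.
elim: n => [|n [mu muE]]; first by exists \d_(0 : 'rV[R]_0).
exists (measure_function_pushforward__canonical__measure_function_Measure
  (@lebesgue_measure R \x^ mu)%E (@measurable_rv_cons R n)).
by rewrite /= muE.
Qed.

Section leb_measure.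
Context (R : realType) (n : nat).

Let leb0 : @leb R n set0 = 0%E.
Proof. by have [mu ->] := leb_is_measure R n; exact: measure0. Qed.

Let leb_ge0 A : (0 <= @leb R n A)%E.
Proof. by have [mu ->] := leb_is_measure R n; exact: measure_ge0. Qed.

Let leb_sigma_additive : semi_sigma_additive (@leb R n).
Proof.
have [mu ->] := leb_is_measure R n; exact: measure_semi_sigma_additive.
Qed.

HB.instance Definition _ :=
  isMeasure.Build _ _ _ (@leb R n) leb0 leb_ge0 leb_sigma_additive.

End leb_measure.

Definition unitv (R : realType) (n : nat) (i : 'I_n) : 'rV[R]_n :=
  delta_mx ord0 i.

(** Iterated classical partial derivatives, the head of [s] acting last. *)

Definition iter_partial (R : realType) (n : nat) (s : seq 'I_n)
    (f : 'rV[R]_n -> R) : 'rV[R]_n -> R :=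
  foldr (fun i g => fun x => 'D_(unitv R i) g x) f s.

(** [C^oo] on R^n: partial derivatives of all orders exist and are
    continuous. *)

Definition smooth (R : realType) (n : nat) (f : 'rV[R]_n -> R) : Prop :=
  forall s : seq 'I_n, continuous (iter_partial s f) /\
    forall (i : 'I_n) (x : 'rV[R]_n), derivable (iter_partial s f) x (unitv R i).

Definition test_function (R : realType) (n : nat) (omega : set 'rV[R]_n)
    (phi : 'rV[R]_n -> R) : Prop :=
  smooth phi /\ exists K : set 'rV[R]_n,
    [/\ compact K, K `<=` omega & forall x, ~ K x -> phi x = 0].

(** [locally_integrable] of the library, which is restricted to dimension one. *)

Definition L1loc (R : realType) (n : nat) (omega : set 'rV[R]_n)
    (f : 'rV[R]_n -> R) : Prop :=
  measurable_fun omega f /\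
  forall K : set 'rV[R]_n, K `<=` omega -> compact K ->
    (\int[leb n]_(x in K) `|f x|%:E < +oo)%E.

Definition weak_partial (R : realType) (n : nat) (omega : set 'rV[R]_n)
    (i : 'I_n) (f g : 'rV[R]_n -> R) : Prop :=
  [/\ L1loc omega f, L1loc omega g &
    forall phi, test_function omega phi ->
      \int[leb n]_(x in omega) (f x * 'D_(unitv R i) phi x) =
      - \int[leb n]_(x in omega) (g x * phi x)].

(** A representative of the weak partial derivative (unique up to a null subset
    of [omega] when it exists, and zero otherwise). *)

Definition wD (R : realType) (n : nat) (omega : set 'rV[R]_n) (i : 'I_n)
    (f : 'rV[R]_n -> R) : 'rV[R]_n -> R :=
  xget (cst 0) [set g | weak_partial omega i f g].

(** Elements of Sobolev spaces are represented by Borel functions defined on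
    the whole of R^n, of which only the values on [omega] matter. *)

Definition sqrL2 (R : realType) (n : nat) (omega : set 'rV[R]_n)
    (f : 'rV[R]_n -> R) : \bar R :=
  (\int[leb n]_(x in omega) (f x ^+ 2)%:E)%E.

Definition W12 (R : realType) (n : nat) (omega : set 'rV[R]_n)
    (f : 'rV[R]_n -> R) : Prop :=
  [/\ measurable_fun omega f, (sqrL2 omega f < +oo)%E &
    forall i : 'I_n, exists2 g,
      weak_partial omega i f g & (sqrL2 omega g < +oo)%E].

Definition sqrW12 (R : realType) (n : nat) (omega : set 'rV[R]_n)
    (f : 'rV[R]_n -> R) : \bar R :=
  (sqrL2 omega f + \sum_(i < n) sqrL2 omega (wD omega i f))%E.

Definition W12_0 (R : realType) (n : nat) (omega : set 'rV[R]_n)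
    (f : 'rV[R]_n -> R) : Prop :=
  W12 omega f /\ exists phi : nat -> 'rV[R]_n -> R,
    (forall k, test_function omega (phi k)) /\
    (fun k => sqrW12 omega (fun x => phi k x - f x)) @ \oo --> 0%E.

Definition vcomp (R : realType) (n m : nat) (v : 'rV[R]_n -> 'rV[R]_m)
    (j : 'I_m) : 'rV[R]_n -> R := fun x => v x ord0 j.

Definition W12v (R : realType) (n m : nat) (omega : set 'rV[R]_n)
    (v : 'rV[R]_n -> 'rV[R]_m) : Prop :=
  forall j : 'I_m, W12 omega (vcomp v j).

Definition W12v_0 (R : realType) (n m : nat) (omega : set 'rV[R]_n)
    (v : 'rV[R]_n -> 'rV[R]_m) : Prop :=
  forall j : 'I_m, W12_0 omega (vcomp v j).

Definition W12v_loc (R : realType) (n m : nat) (Omega : set 'rV[R]_n)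
    (v : 'rV[R]_n -> 'rV[R]_m) : Prop :=
  forall omega : set 'rV[R]_n, open omega -> compact (closure omega) ->
    closure omega `<=` Omega -> W12v omega v.

(** ||v||_{L^oo(omega; R^m)} <= q. *)

Definition Linfty_le (R : realType) (n m : nat) (omega : set 'rV[R]_n)
    (v : 'rV[R]_n -> 'rV[R]_m) (q : R) : Prop :=
  {ae leb n, forall x, omega x -> enorm (v x) <= q}.

Definition energy (R : realType) (n m : nat) (W : 'rV[R]_m -> R)
    (omega : set 'rV[R]_n) (v : 'rV[R]_n -> 'rV[R]_m) : \bar R :=
  (\int[leb n]_(x in omega)
    (2^-1 * (\sum_(j < m) \sum_(i < n) wD omega i (vcomp v j) x ^+ 2)
     + W (v x))%:E)%E.

(** Near each of its boundary points, the open set [omega] is the part lying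
    strictly above the graph of a Lipschitz function [gamma] over the
    hyperplane orthogonal to some unit vector [e]. *)

Definition lipschitz_boundary (R : realType) (n : nat) (omega : set 'rV[R]_n) :
    Prop :=
  forall x0 : 'rV[R]_n, closure omega x0 -> ~ omega x0 ->
  exists (r L : R) (e : 'rV[R]_n) (gamma : 'rV[R]_n -> R),
    [/\ 0 < r, enorm e = 1,
      forall y z, dotv y e = 0 -> dotv z e = 0 ->
        `|gamma y - gamma z| <= L * enorm (y - z) &
      forall x, enorm (x - x0) < r ->
        omega x <-> gamma (x - dotv x e *: e) < dotv x e].

Definition local_minimizer (R : realType) (n m : nat) (q : R)
    (W : 'rV[R]_m -> R) (Omega : set 'rV[R]_n) (u : 'rV[R]_n -> 'rV[R]_m) :
    Prop :=
  forall omega : set 'rV[R]_n, open omega -> bounded_set omega ->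
    lipschitz_boundary omega -> closure omega `<=` Omega ->
  forall xi : 'rV[R]_n -> 'rV[R]_m, W12v_0 omega xi ->
    Linfty_le omega (fun x => u x + xi x) q ->
    (energy W omega u <= energy W omega (fun x => (u x + xi x)%R))%E.

(** The integral of [f] over the sphere of radius [r] centered at the origin
    with respect to surface measure: in polar coordinates, the integral of
    [f (r x / |x|)] over the ball is [r / n] times the surface integral. *)

Definition sphere_integral (R : realType) (n : nat) (r : R)
    (f : 'rV[R]_n -> R) : \bar R :=
  ((n%:R / r)%:E *
   \int[leb n]_(x in eball (0%R : 'rV[R]_n) r) (f ((r / enorm x) *: x))%:E)%E.

(** The trace of [h] on the sphere of radius [r] is [g]: the trace operator is
    the extension by continuity, from W^{1,2} of the ball to L^2 of the sphere,
    of the restriction of smooth functions. *)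

Definition sphere_trace (R : realType) (n : nat) (r : R)
    (h g : 'rV[R]_n -> R) : Prop :=
  exists phi : nat -> 'rV[R]_n -> R,
    [/\ forall k, smooth (phi k),
      (fun k => sqrW12 (eball (0 : 'rV[R]_n) r) (fun x => phi k x - h x))
        @ \oo --> 0%E &
      (fun k => sphere_integral r (fun x => (phi k x - g x) ^+ 2))
        @ \oo --> 0%E].

Definition Wrad_ext (R : realType) (q : R) (Wrad : R -> R) (t : R) : R :=
  if `|t| <= q then Wrad `|t| else Wrad q.

Definition J_ball (R : realType) (n : nat) (q : R) (Wrad : R -> R) (r : R)
    (h : 'rV[R]_n -> R) : \bar R :=
  (\int[leb n]_(x in eball (0%R : 'rV[R]_n) r)
    (2^-1 * (\sum_(i < n) wD (eball (0%R : 'rV[R]_n) r) i h x ^+ 2)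
     + Wrad_ext q Wrad (h x))%:E)%E.

Definition A_ball (R : realType) (n : nat) (q r : R) (h : 'rV[R]_n -> R) :
    Prop :=
  W12 (eball (0 : 'rV[R]_n) r) h /\ sphere_trace r h (cst q).

Definition J_minimizer (R : realType) (n : nat) (q : R) (Wrad : R -> R) (r : R)
    (h : 'rV[R]_n -> R) : Prop :=
  A_ball q r h /\
  forall k : 'rV[R]_n -> R, A_ball q r k -> (J_ball q Wrad r h <= J_ball q Wrad r k)%E.

(** [Psi] is the representative continuous on the closed ball of the greatest
    minimizer. *)

Definition greatest_minimizer (R : realType) (n : nat) (q : R) (Wrad : R -> R)
    (r : R) (Psi : 'rV[R]_n -> R) : Prop :=
  [/\ J_minimizer q Wrad r Psi,
    {within ecball (0 : 'rV[R]_n) r, continuous Psi} &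
    forall psi, J_minimizer q Wrad r psi ->
      {ae leb n, forall x, eball (0 : 'rV[R]_n) r x -> psi x <= Psi x}].

(* Main.v *)
Require Import Defs.
From HB Require Import structures.
From mathcomp Require Import all_boot all_order all_algebra.
From mathcomp Require Import all_classical all_reals all_analysis measurable_realfun.
From mathcomp Require Import ring lra.
Import Order.TTheory GRing.Theory Num.Theory.
Import numFieldNormedType.Exports.
Local Open Scope classical_set_scope.
Local Open Scope ring_scope.
Set Implicit Arguments.
Unset Strict Implicit.
Unset Printing Implicit Defensive.

(** Shrink [u] radially to length at most [Psi]: with [rho = |u|] (in a ball
    translated to the origin), [v = (min rho Psi / rho) u] competes with [u] and
    [h = max rho Psi] competes with [Psi]. Where [rho > Psi], the radial part of
    the energy density of [u] becomes that of [h], the radial part of [v] is that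
    of [Psi], and the tangential part of [v] is that of [u] times
    [(Psi / rho)^2 <= 1]; the potentials are handled by monotonicity. Hence
    [E v + J h <= E u + J Psi], so [E u <= E v] gives [J h <= J Psi]: [h] is a
    minimizer, [h <= Psi] by maximality, and [rho <= Psi]. Truncating [Psi] at [0]
    in the same way first gives [Psi >= 0].

    Admissibility of [v] and [h] means that [(rho - Psi)^+] has zero trace. It is
    the limit of [(rho - Psi - e)^+], which has compact support because
    [Psi = q >= rho] on the sphere. That pointwise boundary value follows from
    the trace condition: on thin shells the L^1 distance between a smooth function
    and its radial projection is bounded by the width times the L^1 norm of its
    gradient. *)

(** * Euclidean norm and Borel sets of R^n *)

(** The perturbation of [u] is [-(rho - Psi)^+ u / rho], that of [Psi] is [(rho - Psi)^+]. Both must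
    be W^{1,2} limits of test functions, and the gradient of the first must make sense across the
    zeros of [u]. This dictates the class of functions used throughout: bounded continuous functions
    on a ball together with an explicit L^2 weak gradient. For these, mollifications converge
    pointwise, so the chain rule holds with any C^1 outer function, and [|u|], [u / |u|] and
    positive parts are reached through C^1 regularizations whose gradients are dominated in L^2. The
    sign of [Psi] matters because it gives [(rho - Psi)^+ <= rho], which controls the quotient by
    [rho]. The gradient [wD] in the energies is fixed only up to null sets, so energies are
    rewritten with the explicit gradients. Cancelling [E u] from the sum of energies requires [E u]
    to be finite, which follows from the bound on [W]. The comparison takes place in the ball
    centred at the origin, where [Psi] lives, after translating [u]. *)

Section enorm_theory.
Context {R : realType} {n : nat}.
Implicit Types x y z : 'rV[R]_n.

Lemma sqr_enorm x : enorm x ^+ 2 = \sum_(i < n) x ord0 i ^+ 2.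
Proof. by rewrite sqr_sqrtr// sumr_ge0// => i _; rewrite sqr_ge0. Qed.

Lemma enorm_ge0 x : 0 <= enorm x.
Proof. exact: sqrtr_ge0. Qed.

Lemma enorm0 : enorm (0 : 'rV[R]_n) = 0.
Proof. by rewrite /enorm big1 ?sqrtr0// => i _; rewrite mxE expr0n. Qed.

Lemma coord_le_enorm x i : `|x ord0 i| <= enorm x.
Proof.
rewrite -(@ler_pXn2r _ 2)// ?nnegrE ?enorm_ge0//.
rewrite sqr_enorm real_normK ?num_real// (bigD1 i)//= lerDl.
by rewrite sumr_ge0// => j _; rewrite sqr_ge0.
Qed.

Lemma enorm_eq0 x : enorm x = 0 -> x = 0.
Proof.
move=> x0; apply/rowP => i; rewrite mxE; apply/eqP.
by rewrite -normr_le0 -x0 coord_le_enorm.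
Qed.

Lemma enormZ (a : R) x : enorm (a *: x) = `|a| * enorm x.
Proof.
rewrite /enorm; under eq_bigr do rewrite mxE exprMn.
by rewrite -mulr_sumr sqrtrM ?sqr_ge0// sqrtr_sqr.
Qed.

Lemma enormN x : enorm (- x) = enorm x.
Proof. by rewrite -scaleN1r enormZ normrN1 mul1r. Qed.

Lemma enormB x y : enorm (x - y) = enorm (y - x).
Proof. by rewrite -enormN opprB. Qed.

(** Sum the inequalities [0 <= (|y| x_i - |x| y_i)^2] over [i] and divide by [2 |x| |y|]. *)
Lemma cauchy_schwarz x y : dotv x y <= enorm x * enorm y.
Proof.
have [x0|x0] := eqVneq (enorm x) 0.
  by rewrite x0 mul0r (enorm_eq0 x0) /dotv big1// => i _; rewrite mxE mul0r.
have [y0|y0] := eqVneq (enorm y) 0.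
  by rewrite y0 mulr0 (enorm_eq0 y0) /dotv big1// => i _; rewrite mxE mulr0.
have xy0 : 0 < enorm x * enorm y.
  by rewrite mulr_gt0// lt_neqAle eq_sym ?x0 ?y0 enorm_ge0.
rewrite -(ler_pM2l xy0) -(@ler_pM2l _ 2)//.
have -> : 2 * (enorm x * enorm y * (enorm x * enorm y)) =
    \sum_(i < n) (enorm y ^+ 2 * x ord0 i ^+ 2 + enorm x ^+ 2 * y ord0 i ^+ 2).
  by rewrite big_split/= -!mulr_sumr -!sqr_enorm; ring.
rewrite /dotv !mulr_sumr ler_sum// => i _.
rewrite -subr_ge0 [leRHS](_ : _ =
  (enorm y * x ord0 i - enorm x * y ord0 i) ^+ 2) ?sqr_ge0//=; ring.
Qed.

Lemma enorm_triangle x y : enorm (x + y) <= enorm x + enorm y.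
Proof.
rewrite -(@ler_pXn2r _ 2)// ?nnegrE ?addr_ge0 ?enorm_ge0//.
rewrite sqrrD !sqr_enorm.
have -> : \sum_(i < n) (x + y) ord0 i ^+ 2 = \sum_(i < n) x ord0 i ^+ 2 +
    dotv x y *+ 2 + \sum_(i < n) y ord0 i ^+ 2.
  rewrite /dotv -sumrMnl -!big_split; apply: eq_bigr => i _ /=.
  by rewrite mxE sqrrD.
by rewrite lerD2r lerD2l lerMn2r cauchy_schwarz.
Qed.

Lemma enorm_dist x y : `|enorm x - enorm y| <= enorm (x - y).
Proof.
rewrite ler_norml lerBlDr lerBrDr addrC lerBlDr; apply/andP; split.
  by rewrite enormB addrC -{1}(subrK x y) enorm_triangle.
by rewrite -{1}(subrK y x) enorm_triangle.
Qed.

Lemma coord_le_norm x i : `|x ord0 i| <= `|x|.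
Proof.
rewrite [leRHS]/Num.norm /= mx_normrE.
by apply/bigmax_geP; right => /=; exists (ord0, i).
Qed.

Lemma norm_le_enorm x : `|x| <= enorm x.
Proof.
rewrite [leLHS]/Num.norm /= mx_normrE; apply/bigmax_leP; split.
  exact: enorm_ge0.
by move=> [i j] _ /=; rewrite ord1 coord_le_enorm.
Qed.

Lemma enorm_le_norm x : enorm x <= n%:R * `|x|.
Proof.
rewrite -(@ler_pXn2r _ 2)// ?nnegrE ?enorm_ge0 ?mulr_ge0//.
rewrite sqr_enorm exprMn (@le_trans _ _ (n%:R * `|x| ^+ 2))//.
  rewrite mulr_natl -[X in _ *+ X](card_ord n) -sumr_const ler_sum// => i _.
  by rewrite -real_normK ?num_real// lerXn2r ?nnegrE// coord_le_norm.
rewrite ler_wpM2r ?sqr_ge0// -natrX ler_nat.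
by case: (n) => // k; rewrite -mulnn leq_pmulr.
Qed.

Lemma enorm_continuous : continuous (@enorm R n).
Proof.
move=> x; apply/(@cvgrPdist_le _ _ _ (nbhs x)) => e e0.
have k0 : 0 < n%:R + 1 :> R by rewrite ltr_wpDl.
near=> y.
rewrite (le_trans (enorm_dist _ _))// (le_trans (enorm_le_norm _))//.
have xy : `|x - y| <= e / (n%:R + 1).
  near: y; apply: (@cvgr_dist_le _ _ _ (nbhs x) _ id x); first exact: cvg_id.
  by rewrite divr_gt0.
have /le_trans : n%:R * `|x - y| <= (n%:R + 1) * `|x - y|.
  by rewrite ler_wpM2r// lerDl.
by apply; rewrite mulrC -ler_pdivlMr.
Unshelve. all: by end_near. Qed.

Lemma eball_open x (r : R) : open (eball x r).
Proof.
have -> : eball x r = (fun y => enorm (y - x)) @^-1` `]-oo, r[.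
  by apply/seteqP; split => y; rewrite /eball/= in_itv/=.
apply: open_comp; last exact: interval_open.
move=> y _; apply: (@continuous_comp _ _ _ (fun y => y - x) (@enorm R n)).
  by apply: (@cvgB _ _ _ (nbhs y)) => //; exact: cvg_cst.
exact: enorm_continuous.
Qed.

Lemma ecball_closed x (r : R) : closed (ecball x r).
Proof.
have -> : ecball x r = (fun y => enorm (y - x)) @^-1` `]-oo, r].
  by apply/seteqP; split => y; rewrite /ecball/= in_itv/=.
apply: preimage_closed; last exact: interval_closed.
move=> y _; apply: (@continuous_comp _ _ _ (fun y => y - x) (@enorm R n)).
  by apply: (@cvgB _ _ _ (nbhs y)) => //; exact: cvg_cst.
exact: enorm_continuous.
Qed.

Lemma eball_sub_ecball x (r : R) : eball x r `<=` ecball x r.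
Proof. by move=> y /ltW. Qed.

Lemma closure_eball x (r : R) : closure (eball x r) `<=` ecball x r.
Proof.
rewrite [ecball _ _](closure_id _).1; last exact: ecball_closed.
exact/closure_subset/eball_sub_ecball.
Qed.

Lemma ecball_bounded x (r : R) : bounded_set (ecball x r).
Proof.
exists (r + `|x|); split; first by rewrite num_real.
move=> M rM y /= xy; rewrite (le_trans _ (ltW rM))//.
rewrite -{1}(subrK x y) (le_trans (ler_normD _ _))// lerD2r.
exact: le_trans (norm_le_enorm _) xy.
Qed.

Lemma ecball_compact x (r : R) : compact (ecball x r).
Proof.
apply: bounded_closed_compact; [exact: ecball_bounded|exact: ecball_closed].
Qed.

Lemma eball_bounded x (r : R) : bounded_set (eball x r).
Proof.
have [M [Mr HM]] := @ecball_bounded x r.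
by exists M; split => // N /HM H y /eball_sub_ecball /H.
Qed.

Lemma closure_eball_compact x (r : R) : compact (closure (eball x r)).
Proof.
apply: (subclosed_compact _ (@ecball_compact x r)).
  exact: closed_closure.
exact: closure_eball.
Qed.

End enorm_theory.

Section rv_measurability.
Context {R : realType} {n : nat}.

(** The sigma-algebra is generated by the coordinates, so cubes are measurable; an open set is the
    countable union of the cubes it contains with rational centre and half-side [1/(k+1)]. *)
Lemma open_rv_measurable (U : set 'rV[R]_n) : open U -> measurable U.
Proof.
move=> oU.
pose bx (c : 'rV[rat]_n) (k : nat) : set 'rV[R]_n :=
  [set y | forall i, `|y ord0 i - ratr (c ord0 i)| < k.+1%:R^-1].
have mbx c k : measurable (bx c k).
  rewrite [bx c k](_ : _ = \big[setI/setT]_(i < n)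
     (rv_coord i @^-1` ball (ratr (c ord0 i) : R) k.+1%:R^-1)).
    apply: bigsetI_measurable => i _; rewrite -[X in measurable X]setTI.
    by apply: measurable_rv_coord => //; exact: measurable_realfun.measurable_ball.
  apply/seteqP; split => y; rewrite -bigcap_seq/=; last first.
    by move=> H i; have := H i (mem_index_enum _); rewrite /= /ball/= distrC.
  by move=> H i _ /=; rewrite /ball/= distrC; exact: H.
rewrite [U](_ : _ = \bigcup_c \bigcup_k
    (if pselect (bx c k `<=` U) then bx c k else set0)).
  apply: countable_bigcupT_measurable; first exact: countableP.
  move=> c; apply: bigcupT_measurable => k.
  by case: pselect => ?; [exact: mbx|exact: measurable0].
apply/seteqP; split => [x Ux|x [c _ [k _]]]; last by case: pselect => // H /H.
have /nbhs_normP[e /= e0 xeU] : nbhs x U by apply: open_nbhs_nbhs.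
have [k ke] : exists k, k.+1%:R^-1 < e / 2.
  have e20 : 0 < e / 2 by rewrite divr_gt0.
  have [k _ /(_ k (leqnn k))] := near_infty_natSinv_lt (PosNum e20).
  by exists k.
have hc i : exists c : rat, `|x ord0 i - ratr c| < k.+1%:R^-1.
  have : (x ord0 i - k.+1%:R^-1) < x ord0 i + k.+1%:R^-1.
    by rewrite ltrBlDr -addrA ltrDl addr_gt0.
  move/rat_in_itvoo => [c]; rewrite in_itv/= => /andP[c1 c2]; exists c.
  by rewrite ltr_distlC c1 c2.
pose c : 'rV[rat]_n := \row_i xget 0 [set c : rat | `|x ord0 i - ratr c| < k.+1%:R^-1].
have xc : bx c k x.
  by move=> i; rewrite mxE; exact: (xgetPex 0 (hc i)).
exists c => //; exists k => //; case: pselect => // -[] y yc; apply: xeU => /=.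
rewrite [ltLHS]/Num.norm/= mx_normrE (_ : e = e / 2 + e / 2); last lra.
apply/bigmax_ltP; split => /=; first by rewrite addr_gt0// divr_gt0.
move=> [i j] _ /=; rewrite ord1 !mxE {i}.
rewrite -(subrKA (ratr (c ord0 j))) (le_lt_trans (ler_normD _ _))// ltrD//.
  exact: lt_trans (xc j) ke.
by rewrite distrC; exact: lt_trans (yc j) ke.
Qed.

Lemma closed_rv_measurable (U : set 'rV[R]_n) : closed U -> measurable U.
Proof.
by move=> cU; rewrite -(setCK U); apply: measurableC; apply: open_rv_measurable; exact: closed_openC.
Qed.

Lemma compact_rv_measurable (U : set 'rV[R]_n) : compact U -> measurable U.
Proof. move=> cU; apply: closed_rv_measurable; apply: compact_closed => //. Qed.

Lemma measurable_eball (x : 'rV[R]_n) r : measurable (eball x r).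
Proof. apply: open_rv_measurable; exact: eball_open. Qed.

Lemma open_continuous_measurable_rv (D : set 'rV[R]_n) (f : 'rV[R]_n -> R) :
  open D -> (forall x, D x -> {for x, continuous f}) -> measurable_fun D f.
Proof.
move=> oD cf; apply: (measurability _ (measurable_realfun.RGenOInfty.measurableE R)) => //.
move=> _ [_ [a ->] <-]; apply: open_rv_measurable.
rewrite openE => x /= [Dx fx]; apply: filterI; first exact: open_nbhs_nbhs.
by apply: cf => //; apply: open_nbhs_nbhs; split => //; exact: interval_open.
Qed.

Lemma continuous_measurable_rv (f : 'rV[R]_n -> R) :
  continuous f -> measurable_fun setT f.
Proof.
move=> cf; apply: open_continuous_measurable_rv => //.
  exact: openT.
by move=> x _; exact: cf.
Qed.

Lemma measurable_scale_rv :
  measurable_fun setT (fun p : R * 'rV[R]_n => p.1 *: p.2).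
Proof.
apply/measurable_fun_rvP => i.
rewrite (_ : _ \o _ = (fun p : R * 'rV[R]_n => p.1 * rv_coord i p.2)); last first.
  by apply/funext => p; rewrite /rv_coord/= mxE.
apply: measurable_funM; first exact: measurable_fst.
exact: (measurableT_comp (measurable_rv_coord i) measurable_snd).
Qed.

Lemma measurable_affine_rv (c : R) (a : 'rV[R]_n) :
  measurable_fun setT (fun x : 'rV[R]_n => c *: x + a).
Proof.
apply/measurable_fun_rvP => i.
rewrite (_ : _ \o _ = (fun x => c * rv_coord i x + a ord0 i)); last first.
  by apply/funext => p; rewrite /rv_coord/= !mxE.
by apply: measurable_funD => //; apply: measurable_funM => //; exact: measurable_rv_coord.
Qed.

Lemma measurable_sub_rv :
  measurable_fun setT (fun p : 'rV[R]_n * 'rV[R]_n => p.1 - p.2).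
Proof.
apply/measurable_fun_rvP => i.
rewrite (_ : _ \o _ = (fun p : 'rV[R]_n * 'rV[R]_n =>
   rv_coord i p.1 - rv_coord i p.2)); last first.
  by apply/funext => p; rewrite /rv_coord/= !mxE.
apply: measurable_funB => //.
  exact: (measurableT_comp (measurable_rv_coord i) measurable_fst).
exact: (measurableT_comp (measurable_rv_coord i) measurable_snd).
Qed.

End rv_measurability.

(** * Lebesgue measure on R^n *)

Section leb_cubes.
Context {R : realType}.

Definition cube n (a : 'rV[R]_n) (d : R) : set 'rV[R]_n :=
  [set x | forall i, a ord0 i < x ord0 i < a ord0 i + d].

Lemma measurable_cube n (a : 'rV[R]_n) d : measurable (cube a d).
Proof.
rewrite [cube a d](_ : _ = \big[setI/setT]_(i < n)
   (rv_coord i @^-1` `]a ord0 i, a ord0 i + d[)).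
  apply: bigsetI_measurable => i _; rewrite -[X in measurable X]setTI.
  exact: measurable_rv_coord.
apply/seteqP; split => y; rewrite -bigcap_seq/=.
  by move=> H i _ /=; rewrite in_itv/=; exact: H.
by move=> H i; have := H i (mem_index_enum _); rewrite /= in_itv.
Qed.

Lemma rv_cons0 n (x : R) (y : 'rV[R]_n) :
  rv_cons (x, y) ord0 (lshift n (ord0 : 'I_1)) = x.
Proof. by apply: etrans (row_mxEl x%:M y ord0 ord0) _; rewrite mxE eqxx. Qed.

Lemma rv_consS n (x : R) (y : 'rV[R]_n) i :
  rv_cons (x, y) ord0 (rshift 1 i) = y ord0 i.
Proof. exact: (row_mxEr x%:M y ord0 i). Qed.

Lemma leb_cube n (a : 'rV[R]_n) d : 0 < d -> leb n (cube a d) = (d ^+ n)%:E.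
Proof.
move=> d0; elim: n a => [|n ih] a.
  rewrite expr0 /= diracE mem_set//.
  by move=> [].
rewrite /= /pushforward.
have -> : @rv_cons R n @^-1` cube a d =
    `]a ord0 (lshift n (ord0 : 'I_1)), a ord0 (lshift n (ord0 : 'I_1)) + d[ `*`
    cube (\row_i a ord0 (rshift 1 i)) d.
  apply/seteqP; split => [[x y]|[x y] [/=]].
    move=> /= H; split => /=.
      have := H (lshift n (ord0 : 'I_1)).
      by rewrite rv_cons0 in_itv.
    by move=> i; have := H (rshift 1 i); rewrite rv_consS mxE.
  rewrite in_itv/= => xa H i; case: (@split_ordP 1 n i) => j ->.
    by rewrite (ord1 j) rv_cons0.
  by rewrite rv_consS; have := H j; rewrite mxE.
set I := (X in X `*` _).
transitivity (@lebesgue_measure R I *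
    @leb R n (cube (\row_i a ord0 (rshift 1 i)) d))%E.
  apply: (@product_measure2E _ _ _ _ R (@lebesgue_measure R) (@leb R n) I).
    exact: measurable_itv.
  exact: measurable_cube.
rewrite ih /I lebesgue_measure_itv/= lte_fin ltrDl d0 exprS EFinM.
by rewrite -EFinB addrAC subrr add0r.
Qed.

(** Sigma-finiteness is what Tonelli's theorem and the uniqueness of product measures require of
    [leb]. *)
Lemma leb_sigma_finite n : sigma_finite setT (@leb R n).
Proof.
exists (fun k => cube (const_mx (- k.+1%:R)) (k.+1%:R *+ 2)).
  apply/esym/seteqP; split => // x _.
  have [k xk] : exists k, `|x| < k.+1%:R.
    exists (Num.bound `|x|); rewrite (lt_le_trans (archi_boundP _))//.
    by rewrite ler_nat.
  exists k => // i; rewrite mxE mulr2n addrA addNr add0r.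
  by rewrite -ltr_norml (le_lt_trans (coord_le_norm _ _)).
move=> k; split; first exact: measurable_cube.
by rewrite leb_cube ?ltry// pmulrn_lgt0.
Qed.

HB.instance Definition _ n :=
  Measure_isSigmaFinite.Build _ _ _ (@leb R n) (leb_sigma_finite n).

Lemma leb_bounded_lty n (A : set 'rV[R]_n) :
  measurable A -> bounded_set A -> (leb n A < +oo)%E.
Proof.
move=> mA [M [_ HM]].
pose d := `|M| + 2.
have d0 : 0 < d by rewrite ltr_wpDl.
have AC : A `<=` cube (const_mx (- d)) (d *+ 2).
  move=> x Ax i; rewrite mxE mulr2n addrA addNr add0r.
  rewrite -ltr_norml (le_lt_trans (coord_le_norm _ _))//.
  have /le_lt_trans : `|x| <= `|M| + 1.
    by apply: (HM _ _ x Ax); rewrite (le_lt_trans (ler_norm _))// ltrDl.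
  by apply; rewrite ltrD2l ltr1n.
rewrite (@le_lt_trans _ _ (leb n (cube (const_mx (- d)) (d *+ 2))))//.
  by apply: le_measure; rewrite ?inE//; exact: measurable_cube.
by rewrite leb_cube ?ltry// pmulrn_lgt0.
Qed.

Lemma leb_open_gt0 n (U : set 'rV[R]_n) x : open U -> U x -> (0 < leb n U)%E.
Proof.
move=> oU Ux.
have mU := open_rv_measurable oU.
have : \forall y \near x, U y by exact: open_nbhs_nbhs.
move=> /nbhs_ballP[e /= e0 xeU].
rewrite (@lt_le_trans _ _ (leb n (cube x e)))//.
  by rewrite leb_cube// lte_fin exprn_gt0.
apply: le_measure; rewrite ?inE//; first exact: measurable_cube.
move=> y xy; apply: xeU; split => // i j; rewrite ord1.
have /andP[xy1 xy2] := xy j.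
by rewrite /ball/= ltr_distlC; apply/andP; split => //; rewrite ltrBlDr (lt_trans xy1)// ltrDl.
Qed.

Lemma leb_eball_lty n (x : 'rV[R]_n) r : (leb n (eball x r) < +oo)%E.
Proof.
apply: leb_bounded_lty; [exact: measurable_eball|exact: eball_bounded].
Qed.

End leb_cubes.

Section leb_integral.
Context {R : realType}.
Local Open Scope ereal_scope.

(** Tonelli along the recursion that defines [leb]; every change of variables below is an induction
    through this identity. *)
Lemma ge0_integral_lebS n (f : 'rV[R]_n.+1 -> \bar R) :
  measurable_fun setT f -> (forall x, 0 <= f x) ->
  \int[leb n.+1]_x f x =
  \int[leb n]_y \int[lebesgue_measure]_x f (rv_cons (x, y)).
Proof.
move=> mf f0.
have mr := @measurable_rv_cons R n.
pose m2 : {measure set 'rV[R]_n -> \bar R} := @leb R n.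
change (\int[pushforward (@lebesgue_measure R \x^ m2) (@rv_cons R n)]_x f x =
  \int[leb n]_y \int[lebesgue_measure]_x f (rv_cons (x, y))).
pose mm : {measure set (measurableTypeR R * 'rV[R]_n)%type -> \bar R} :=
  (@lebesgue_measure R \x^ m2)%E.
have mr' : measurable_fun setT (@rv_cons R n : measurableTypeR R * 'rV[R]_n -> _).
  exact: mr.
have := ge0_integral_pushforward mr' mm measurableT mf (fun y _ => f0 y).
move=> H; rewrite [LHS]H.
rewrite preimage_setT.
have mfr : measurable_fun setT (f \o @rv_cons R n) by exact: measurableT_comp.
(* The recursion uses the product [\x^], Tonelli is stated for [\x]; the two agree on rectangles,
   hence everywhere. *)
rewrite (_ : \int[_]_x _ =
    \int[@lebesgue_measure R \x @leb R n]_x (f \o @rv_cons R n) x); last first.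
  apply: eq_measure_integral => A mA _; apply/esym.
  by apply: product_measure_unique => // B C mB mC;
  exact: (@product_measure2E _ _ _ _ R (@lebesgue_measure R) (@leb R n)).
by rewrite fubini_tonelli2// => x; exact: f0.
Qed.

(** The right-hand side is a measure in [A]; it agrees with Lebesgue measure on half-open intervals,
    which determine it. For [c < 0] the preimage of an interval closed on the right is closed on the
    left. *)
Lemma lebesgue_affine (c a : R) (A : set R) : c != 0%R -> measurable A ->
  lebesgue_measure A = `|c|%:E *
  lebesgue_measure ((fun x => (c * x + a)%R) @^-1` A).
Proof.
move=> c0 mA.
have mphi : measurable_fun setT ((fun x => c * x + a)%R : measurableTypeR R -> measurableTypeR R).
  by apply: measurable_funD => //; exact: measurable_funM.
pose mu := measure_function_mscale__canonical__measure_function_Measure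
  (NngNum (normr_ge0 c)) (measure_function_pushforward__canonical__measure_function_Measure
    (@lebesgue_measure R) mphi).
rewrite (@lebesgue_measure_unique R mu)// => _ [[x y] _ <-] /=.
rewrite /mscale/= /pushforward lebesgue_measure_itv/= lte_fin.
have [c_gt0|c_lt0|/eqP] := ltgtP c 0%R; last by rewrite (negPf c0).
- have -> : (fun x => (c * x + a)%R) @^-1` `]x, y] =
    `[((y - a) / c)%R, ((x - a) / c)%R[%classic.
    apply/seteqP; split => z /=; rewrite !in_itv/= => /andP[h1 h2].
      by rewrite ler_ndivrMr// ltr_ndivlMr// mulrC lerBrDr ltrBlDr h1 h2.
    move: h1 h2.
    by rewrite ler_ndivrMr// ltr_ndivlMr// mulrC lerBrDr ltrBlDr => -> ->.
  rewrite lebesgue_measure_itv/= lte_fin ltr_nM2r ?invr_lt0// ltrD2r.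
  case: ifPn => xy; last by rewrite mule0.
  rewrite -!EFinB -EFinM ltr0_norm//; congr EFin.
  by field.
- have -> : (fun x => (c * x + a)%R) @^-1` `]x, y] =
    `]((x - a) / c)%R, ((y - a) / c)%R]%classic.
    apply/seteqP; split => z /=; rewrite !in_itv/= => /andP[h1 h2].
      by rewrite ler_pdivlMr// ltr_pdivrMr// mulrC ltrBlDr lerBrDr h1 h2.
    move: h1 h2.
    by rewrite ler_pdivlMr// ltr_pdivrMr// mulrC ltrBlDr lerBrDr => -> ->.
  rewrite lebesgue_measure_itv/= lte_fin ltr_pM2r ?invr_gt0// ltrD2r.
  case: ifPn => xy; last by rewrite mule0.
  rewrite -!EFinB -EFinM gtr0_norm//; congr EFin.
  by field.
Qed.

Lemma ge0_integral_lebesgue_affine (c a : R) (f : R -> \bar R) : c != 0%R ->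
  measurable_fun setT f -> (forall x, 0 <= f x) ->
  \int[lebesgue_measure]_x f x =
  `|c|%:E * \int[lebesgue_measure]_x f (c * x + a)%R.
Proof.
move=> c0 mf f0.
have mphi : measurable_fun setT ((fun x => c * x + a)%R : measurableTypeR R -> measurableTypeR R).
  by apply: measurable_funD => //; exact: measurable_funM.
pose nu := measure_function_pushforward__canonical__measure_function_Measure
    (@lebesgue_measure R) mphi.
pose mu := measure_function_mscale__canonical__measure_function_Measure
  (NngNum (normr_ge0 c)) nu.
transitivity (\int[mu]_x f x).
  by apply: eq_measure_integral => A mA _; exact: (lebesgue_affine a c0 mA).
rewrite ge0_integral_mscale//=; congr (_ * _).
by rewrite (ge0_integral_pushforward mphi)// preimage_setT.
Qed.

(** Each coordinate contributes one factor [|c|]. *)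
Lemma ge0_integral_affine n (c : R) (a : 'rV[R]_n) (f : 'rV[R]_n -> \bar R) :
  c != 0%R -> measurable_fun setT f -> (forall x, 0 <= f x) ->
  \int[leb n]_x f x = (`|c| ^+ n)%:E * \int[leb n]_x f (c *: x + a)%R.
Proof.
move=> c0; elim: n a f => [|n ih] a f mf f0.
  rewrite expr0 mul1e; apply: eq_integral => x _; congr f.
  by apply/rowP => -[].
pose a0 := a ord0 (lshift n (ord0 : 'I_1)); pose a' := (\row_i a ord0 (rshift 1 i))%R.
have rE x y : (c *: rv_cons (x, y) + a)%R = rv_cons (c * x + a0, c *: y + a')%R.
  apply/rowP => i; case: (@split_ordP 1 n i) => j ->.
    by rewrite (ord1 j) mxE mxE !rv_cons0.
  by rewrite mxE mxE !rv_consS !mxE.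
have mfr : measurable_fun setT (f \o @rv_cons R n).
  by apply: measurableT_comp => //; exact: measurable_rv_cons.
have mfa : measurable_fun setT (fun x : 'rV[R]_n.+1 => f (c *: x + a)%R).
  apply: (measurableT_comp mf); exact: measurable_affine_rv.
rewrite ge0_integral_lebS// ge0_integral_lebS//.
have mg : measurable_fun setT (fun y => \int[lebesgue_measure]_x f (rv_cons (x, y))).
  apply: (@measurable_fun_fubini_tonelli_G _ _ _ _ R (@lebesgue_measure R) (f \o @rv_cons R n)) => //.
  by move=> x; exact: f0.
rewrite (ih a' _ mg); last by move=> y; exact: integral_ge0.
rewrite exprSr EFinM -muleA; congr (_ * _).
have mpair (y : 'rV[R]_n) : measurable_fun setT
    (fun x : measurableTypeR R => f (rv_cons (x, y))).
  by apply: (measurableT_comp mfr); exact: measurable_pair2.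
rewrite -ge0_integralZl//; last first.
- by move=> y _; exact: integral_ge0.
- apply: (@measurable_fun_fubini_tonelli_G _ _ _ _ R (@lebesgue_measure R) (f \o (fun x => (c *: x + a)%R) \o @rv_cons R n)) => //; last by move=> x; exact: f0.
  by apply: measurableT_comp => //; exact: measurable_rv_cons.
apply: eq_integral => y _; rewrite (ge0_integral_lebesgue_affine a0 c0)//; last exact: mpair.
by congr (_ * _); apply: eq_integral => x _; rewrite rE.
Qed.

Lemma leb_affine n (c : R) (a : 'rV[R]_n) (A : set 'rV[R]_n) : c != 0%R ->
  measurable A ->
  leb n A = (`|c| ^+ n)%:E * leb n ((fun x => (c *: x + a)%R) @^-1` A).
Proof.
move=> c0 mA.
have mpA : measurable ((fun x => (c *: x + a)%R) @^-1` A).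
  rewrite -[X in measurable X]setTI.
  by apply: measurable_affine_rv.
transitivity (\int[leb n]_x (\1_A x)%:E); first by rewrite integral_indic// setIT.
rewrite (ge0_integral_affine a c0)//.
  by congr (_ * _); rewrite -[X in leb n X]setIT -integral_indic.
by apply/measurable_EFinP; exact: measurable_indic.
Qed.

Lemma ge0_integral_affineD n (c : R) (a : 'rV[R]_n) (D : set 'rV[R]_n)
    (f : 'rV[R]_n -> \bar R) : c != 0%R -> measurable D ->
  measurable_fun D f -> (forall x, D x -> 0 <= f x) ->
  \int[leb n]_(x in D) f x = (`|c| ^+ n)%:E *
  \int[leb n]_(x in (fun x => c *: x + a)%R @^-1` D) f (c *: x + a)%R.
Proof.
move=> c0 mD mf f0.
have mphi := measurable_affine_rv c a.
have cn0 : (0 <= `|c| ^+ n)%R by rewrite exprn_ge0.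
pose nu := measure_function_pushforward__canonical__measure_function_Measure
    (@leb R n) mphi.
pose mu := measure_function_mscale__canonical__measure_function_Measure
  (NngNum cn0) nu.
transitivity (\int[mu]_(x in D) f x).
  apply: eq_measure_integral => A mA _.
  exact: (leb_affine a c0 mA).
rewrite ge0_integral_mscale//=; congr (_ * _).
by rewrite (ge0_integral_pushforward mphi)// => y /set_mem; exact: f0.
Qed.

Lemma integral_reflect n (x : 'rV[R]_n) (f : 'rV[R]_n -> \bar R) :
  measurable_fun setT f -> (leb n).-integrable setT f ->
  \int[leb n]_y f (x - y)%R = \int[leb n]_y f y.
Proof.
move=> mf intf.
have mphi := measurable_affine_rv (-1)%R x.
pose nu := measure_function_pushforward__canonical__measure_function_Measure
    (@leb R n) mphi.
have E A : measurable A -> leb n A = nu A.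
  move=> mA; rewrite (@leb_affine n (-1)%R x)//.
  by rewrite normrN1 expr1n mul1e.
have H y : (x - y = -1 *: y + x)%R by rewrite scaleN1r addrC.
transitivity (\int[leb n]_y (f \o (fun y => -1 *: y + x)%R) y).
  by apply: eq_integral => y _; rewrite H.
rewrite [RHS](_ : _ = \int[nu]_y f y); last first.
  apply: eq_measure_integral => A mA _.
  exact: E.
rewrite (integral_pushforward mphi)// ?preimage_setT//.
apply/integrableP; split; first exact: measurableT_comp.
have /integrableP[_] := intf.
rewrite (@ge0_integral_affine n (-1)%R x)//=; last exact: measurableT_comp.
by rewrite normrN1 expr1n mul1e.
Qed.

End leb_integral.

(** * Differentiation along lines and smooth bumps *)

Section lines.
Context {R : realType}.

(** Turns directional derivatives into derivatives on the real line, where the mean value theorem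
    and the chain rule apply. *)
Lemma is_derive_line n (F : 'rV[R]_n -> R) (x v : 'rV[R]_n) (t : R) df :
  is_derive (t *: v + x) v F df -> is_derive t (1 : R) (fun s => F (s *: v + x)) df.
Proof.
have E : (fun h : R => h^-1 *: (F ((h *: 1 + t) *: v + x) - F (t *: v + x))) =
    (fun h : R => h^-1 *: (F (h *: v + (t *: v + x)) - F (t *: v + x))).
  by apply/funext => h; rewrite [h *: 1]mulr1 scalerDl addrA.
move=> [dF <-]; split; first by rewrite /derivable/= E; exact: dF.
by rewrite /derive/= E.
Qed.

Lemma line_is_derive n (F : 'rV[R]_n -> R) (x v : 'rV[R]_n) df :
  is_derive (0 : R) (1 : R) (fun s => F (s *: v + x)) df -> is_derive x v F df.
Proof.
have E : (fun h : R => h^-1 *: (F ((h *: 1 + 0) *: v + x) - F (0 *: v + x))) =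
    (fun h : R => h^-1 *: (F (h *: v + x) - F x)).
  by apply/funext => h; rewrite [h *: 1]mulr1 addr0 scale0r add0r.
move=> [dF <-]; split; first by rewrite /derivable/= -E; exact: dF.
by rewrite /derive/= -E.
Qed.

Lemma derivable_continuous1 (f df : R -> R) :
  (forall t : R, is_derive t 1 f (df t)) -> continuous f.
Proof.
move=> fdf t; apply: differentiable_continuous; apply/derivable1_diffP.
by have [] := fdf t.
Qed.

Lemma MVT_total (f df : R -> R) (a b : R) :
  (forall t : R, is_derive t 1 f (df t)) ->
  exists2 c, `|c - a| <= `|b - a| & f b - f a = df c * (b - a).
Proof.
move=> fdf; have cf := derivable_continuous1 fdf.
have [ab|ba] := leP a b.
  have [c] := MVT_segment ab (fun t _ => fdf t) (continuous_subspaceT cf).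
  rewrite in_itv/= => /andP[ac cb] E; exists c => //.
  by rewrite !ger0_norm ?subr_ge0// lerB.
have [c] := MVT_segment (ltW ba) (fun t _ => fdf t) (continuous_subspaceT cf).
rewrite in_itv/= => /andP[bc ca] E; exists c.
  by rewrite !ler0_norm ?subr_le0 ?(ltW ba)// !opprB lerB.
by rewrite -[LHS]opprB E -mulrN opprB.
Qed.

Lemma bounded_derive_lipschitz (f df : R -> R) (M : R) :
  (forall t : R, is_derive t 1 f (df t)) -> (forall t, `|df t| <= M) ->
  forall a b, `|f b - f a| <= M * `|b - a|.
Proof.
move=> fdf dfM a b; have [c _ ->] := MVT_total a b fdf.
by rewrite normrM ler_wpM2r.
Qed.

Lemma norm_unitv n (i : 'I_n) : `|unitv R i| = 1.
Proof.
apply/eqP; rewrite eq_le; apply/andP; split; last first.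
  by have := coord_le_norm (unitv R i) i; rewrite /unitv mxE !eqxx normr1.
rewrite [leLHS]/Num.norm/= mx_normrE; apply/bigmax_leP; split => //= -[j k] _ /=.
by rewrite mxE; case: (_ && _); rewrite ?normr0 ?normr1.
Qed.

Lemma norm_le_coord n (x : 'rV[R]_n) (M : R) : 0 <= M ->
  (forall i, `|x ord0 i| <= M) -> `|x| <= M.
Proof.
move=> M0 xM; rewrite [leLHS]/Num.norm/= mx_normrE.
by apply/bigmax_leP; split => //= -[j k] _ /=; rewrite ord1.
Qed.

(** Go from [x] to [y] by changing one coordinate at a time and apply the mean value theorem on each
    edge; every intermediate point stays within sup distance [|y - x|] of [x]. *)
Lemma MVT_rv n (F : 'rV[R]_n -> R) (x y : 'rV[R]_n) :
  (forall i z, derivable F z (unitv R i)) ->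
  exists2 z : 'I_n -> 'rV[R]_n, (forall i, `|z i - x| <= `|y - x|) &
    F y - F x = \sum_(i < n) 'D_(unitv R i) F (z i) * (y ord0 i - x ord0 i).
Proof.
move=> dF.
(* The [k]-th corner of the path: the first [k] coordinates are already those of [y]. *)
pose w k : 'rV[R]_n := \row_i (if (i < k)%N then y ord0 i else x ord0 i).
have H (i : 'I_n) : exists z : 'rV[R]_n, `|z - x| <= `|y - x| /\
    F (w i.+1) - F (w i) = 'D_(unitv R i) F z * (y ord0 i - x ord0 i).
  have [c c1 c2] := @MVT_total (fun s => F (s *: unitv R i + w i))
    (fun s => 'D_(unitv R i) F (s *: unitv R i + w i)) 0 (y ord0 i - x ord0 i)
    (fun t => is_derive_line (derivableP (dF _ _))).
  exists (c *: unitv R i + w i); split.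
    apply: norm_le_coord => // j; rewrite !mxE eqxx/=.
    have [->|ji] := eqVneq j i.
      rewrite ltnn mulr1 addrK (le_trans _ (coord_le_norm _ i))// !mxE.
      by move: c1; rewrite !subr0.
    rewrite mulr0 add0r; case: ifPn => _; last by rewrite subrr normr0.
    by rewrite (le_trans _ (coord_le_norm _ j))// !mxE.
  move: c2; rewrite scale0r add0r subr0 => <-; congr (F _ - _).
  apply/rowP => j; rewrite !mxE eqxx/= ltnS leq_eqVlt.
  have [->|ji] := eqVneq j i; first by rewrite eqxx ltnn mulr1 subrK.
  by rewrite -val_eqE/= in ji; rewrite (negPf ji)/= mulr0 add0r.
have [z Hz] := choice H; exists z; first by move=> i; have [] := Hz i.
under eq_bigr => i _ do rewrite -(proj2 (Hz i)).
rewrite -(big_mkord xpredT (fun i => F (w i.+1) - F (w i))) telescope_sumr//.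
by congr (F _ - F _); apply/rowP => i; rewrite mxE// ltn_ord.
Qed.

(** The intermediate points given by [MVT_rv] between [x] and [x + h v] tend to [x] with [h], so the
    partial derivatives there tend to those at [x] by continuity. *)
Lemma C1_is_derive n (F : 'rV[R]_n -> R) (x v : 'rV[R]_n) :
  (forall i z, derivable F z (unitv R i)) ->
  (forall i, continuous (fun z => 'D_(unitv R i) F z)) ->
  is_derive x v F (\sum_(i < n) 'D_(unitv R i) F x * v ord0 i).
Proof.
move=> dF cF.
suff H : (fun h : R => h^-1 *: (F (h *: v + x) - F x)) @ 0^' -->
    \sum_(i < n) 'D_(unitv R i) F x * v ord0 i.
  split; first by apply/cvg_ex; eexists; exact: H.
  exact: cvg_lim H.
apply/cvgrPdist_le => e e0.
pose K := \sum_(i < n) `|v ord0 i| + 1.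
have K0 : 0 < K by rewrite ltr_wpDl// sumr_ge0.
have near_cont : \forall z \near x, forall i : 'I_n,
    `|'D_(unitv R i) F x - 'D_(unitv R i) F z| <= e / K.
  apply: (@filter_forall _ _ _ (nbhs x)) => i.
  by apply: (@cvgr_dist_le _ _ _ (nbhs x) _ _ _ (cF i x)); rewrite divr_gt0.
have /nbhs_ballP[d /= d0 xd] := near_cont.
have : \forall h \near (0:R)^', `|h *: v| < d /\ h != 0.
  near=> h; split; last by near: h; exact: nbhs_dnbhs_neq.
  rewrite normrZ (@le_lt_trans _ _ (`|h| * (`|v| + 1)))//.
    by rewrite ler_wpM2l// lerDl.
  rewrite -ltr_pdivlMr ?ltr_wpDl//; near: h.
  by apply: dnbhs0_lt; rewrite divr_gt0// ltr_wpDl.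
apply: filterS => h [hd h0].
have [z z1 z2] := @MVT_rv _ F x (h *: v + x) dF.
rewrite z2 scaler_sumr -sumrB.
under eq_bigr => i _.
  rewrite !mxE addrK.
  rewrite [h^-1 *: _](_ : _ = 'D_(unitv R i) F (z i) * v ord0 i); last first.
    by rewrite /GRing.scale/= mulrCA mulKf.
  rewrite -mulrBl; over.
rewrite (le_trans (ler_norm_sum _ _ _))//.
rewrite (@le_trans _ _ (\sum_(i < n) e / K * `|v ord0 i|))//.
  apply: ler_sum => i _; rewrite normrM ler_wpM2r//.
  apply: xd; rewrite -ball_normE/= distrC (le_lt_trans (z1 i))//.
  by rewrite addrK.
by rewrite -mulr_sumr mulrAC ler_pdivrMr// ler_wpM2l ?(ltW e0)// lerDl.
Unshelve. all: by end_near. Qed.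

End lines.

(** * Smooth bump functions of one variable *)

Section smooth1.
Context {R : realType}.

(** Continuity of the derivatives is not recorded: it follows from derivability one order higher. *)
Fixpoint Cn (m : nat) (f : R -> R) : Prop :=
  if m is k.+1 then (forall x, derivable f x 1) /\ Cn k (derive1 f) else True.

Definition smooth1 (f : R -> R) := forall m, Cn m f.

Lemma CnW m f : Cn m.+1 f -> Cn m f.
Proof. by elim: m f => [//|m ih] f [df /ih]. Qed.

Lemma CnD m f g : Cn m f -> Cn m g -> Cn m (f \+ g).
Proof.
elim: m f g => [//|m ih] f g [df Cf] [dg Cg]; split.
  by move=> x; exact: derivableD.
rewrite (_ : derive1 _ = (derive1 f) \+ (derive1 g)); first exact: ih.
by apply/funext => x; rewrite /= !derive1E deriveD.
Qed.

Lemma CnZ m (c : R) f : Cn m f -> Cn m (fun x => c * f x).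
Proof.
elim: m f => [//|m ih] f [df Cf]; split.
  by move=> x; exact: derivableZ.
rewrite (_ : derive1 _ = fun x => c * (derive1 f) x); first exact: ih.
by apply/funext => x; rewrite /= !derive1E deriveZ.
Qed.

Lemma CnM m f g : Cn m f -> Cn m g -> Cn m (fun x => f x * g x).
Proof.
elim: m f g => [//|m ih] f g Cf Cg; split.
  by move=> x; apply: derivableM; [exact: Cf.1|exact: Cg.1].
rewrite (_ : derive1 _ = (fun x => f x * (derive1 g) x) \+ (fun x => g x * (derive1 f) x)).
  apply: CnD; apply: ih; [exact: CnW|exact: Cg.2|exact: CnW|exact: Cf.2].
apply/funext => x; rewrite /= !derive1E deriveM//; [exact: Cf.1|exact: Cg.1].
Qed.

Lemma Cn_affine m (a b : R) f : Cn m f -> Cn m (fun x => f (a * x + b)).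
Proof.
elim: m f => [//|m ih] f Cf.
have H x : is_derive (x : R) 1 (fun x => f (a * x + b)) (a * (derive1 f) (a * x + b)).
  have h1 : is_derive (x : R) 1 (fun x : R => a * x + b) a.
    have := is_deriveD (is_deriveZ a (is_derive_id x (1 : R))) (is_derive_cst b x 1).
    by move=> h; apply: (is_derive_eq h); rewrite addr0 [a *: 1]mulr1.
  have h2 : is_derive (a * x + b) 1 f ((derive1 f) (a * x + b)).
    by rewrite derive1E; apply: derivableP; exact: Cf.1.
  have := @is_derive1_comp _ f (fun x => a * x + b) x _ _ h2 h1.
  by rewrite mulrC.
split; first by move=> x; have [] := H x.
rewrite (_ : derive1 _ = fun x => a * (derive1 f) (a * x + b)).
  by apply: CnZ; apply: ih; exact: Cf.2.
by apply/funext => x; rewrite derive1E; have [_ ->] := H x.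
Qed.

Lemma smooth1_derive1n f m : smooth1 f -> smooth1 (derive1n (m) f).
Proof.
elim: m f => [//|m ih] f sf; rewrite derive1Sn; apply: ih => k.
exact: (sf k.+1).2.
Qed.

Lemma smooth1_derivable f m x : smooth1 f -> is_derive (x : R) 1 (derive1n (m) f) ((derive1n (m.+1) f) x).
Proof.
move=> sf; rewrite derive1nS derive1E; apply: derivableP.
exact: (smooth1_derive1n m sf 1%N).1.
Qed.

(** The factor [s^-d] makes the family stable under differentiation: the derivative of [flat d] is a
    combination of [flat (d+2)] and [flat (d+1)], so smoothness follows by induction. *)
Definition flat (d : nat) (s : R) : R :=
  if 0 < s then s^-1 ^+ d * expR (- s^-1) else 0.

Lemma flat_ge0 d s : 0 <= flat d s.
Proof.
rewrite /flat; case: ifPn => // s0.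
by rewrite mulr_ge0 ?expR_ge0// exprn_ge0// invr_ge0 ltW.
Qed.

Lemma flat_gt0 d s : 0 < s -> 0 < flat d s.
Proof. by move=> s0; rewrite /flat s0 mulr_gt0 ?expR_gt0 ?exprn_gt0 ?invr_gt0. Qed.

Lemma flat_eq0 d s : s <= 0 -> flat d s = 0.
Proof. by rewrite /flat leNgt => /negPf ->. Qed.

(** With [y = 1/s], raise [y/(d+2) <= exp (y/(d+2))] to the power [d+2]. The two powers beyond [d]
    produce [s^2], which makes the difference quotient at the origin tend to 0. *)
Lemma flat_le d (s : R) : 0 < s ->
  flat d s <= (d.+2%:R ^+ d.+2) * s ^+ 2.
Proof.
move=> s0; rewrite /flat s0.
have y0 : 0 < s^-1 by rewrite invr_gt0.
set y := s^-1 in y0 *.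
have E : y ^+ d.+2 <= d.+2%:R ^+ d.+2 * expR y.
  have -> : expR y = expR (y / d.+2%:R) ^+ d.+2.
    by rewrite -expRM_natl mulrCA divff ?mulr1// pnatr_eq0.
  rewrite -exprMn lerXn2r ?nnegrE ?mulr_ge0 ?expR_ge0 ?(ltW y0)//.
  rewrite -ler_pdivrMl// mulrC.
  by rewrite (le_trans _ (expR_ge1Dx _))// lerDr.
rewrite expRN ler_pdivrMr ?expR_gt0//.
rewrite mulrAC -[s]invrK -/y [y^-1 ^+ 2]exprVn.
by rewrite ler_pdivlMr ?exprn_gt0// -exprD addn2.
Qed.

Lemma flat_is_derive (d : nat) (s : R) :
  is_derive (s : R) (1 : R) (flat d) (flat d.+2 s - d%:R * flat d.+1 s).
Proof.
have [s0|s0|->] := ltgtP s 0.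
- rewrite !flat_eq0 ?(ltW s0)// mulr0 subr0.
  have H := is_derive_cst (0 : R) s (1 : R).
  apply: (near_eq_is_derive _ H).
  near=> t; rewrite /= flat_eq0// ltW//; near: t.
  by apply: lt_nbhsl.
- have : is_derive (s : R) 1 (fun t : R => t^-1 ^+ d * expR (- t^-1))
      (flat d.+2 s - d%:R * flat d.+1 s).
    have sn0 : s != 0 by rewrite gt_eqF.
    have hV : is_derive (s : R) 1 (fun t : R => t^-1) (- s ^- 2).
      have H := @is_deriveV R (fun t : R => t) s 1 1 sn0 (is_derive_id s (1 : R)).
      apply: (is_derive_eq H).
      by rewrite [LHS]mulr1.
    have hN : is_derive (s : R) 1 (fun t : R => - t^-1) (s ^- 2).
      by apply: (is_derive_eq (is_deriveN hV)); rewrite opprK.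
    have hE : is_derive (s : R) 1 (fun t : R => expR (- t^-1)) (expR (- s^-1) * s ^- 2).
      exact: (@is_derive1_comp _ expR (fun t => - t^-1) s _ _ (is_derive_expR _) hN).
    have hX : is_derive (s : R) 1 (fun t : R => t^-1 ^+ d)
        ((s^-1 ^+ d.-1 *+ d) * (- s ^- 2)).
      have h2 : is_derive (s^-1) 1 (fun t : R => t ^+ d) (s^-1 ^+ d.-1 *+ d).
        split; first exact: exprn_derivable.
        by rewrite exp_derive [_ *: 1]mulr1 [LHS]mulr_natl.
      exact: (@is_derive1_comp _ (fun t => t ^+ d) (fun t => t^-1) s _ _ h2 hV).
    apply: (is_derive_eq (is_deriveM hX hE)).
    rewrite /flat s0 /GRing.scale/=.
    clear hX; rewrite -!exprVn -mulr_natr.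
    by case: d => [|k] /=; rewrite !exprS ?expr0; ring.
  apply: near_eq_is_derive; near=> t.
  rewrite /flat ifT//; near: t.
  exact: lt_nbhsr.
- rewrite !flat_eq0// mulr0 subr0.
  suff H : (fun h : R => h^-1 *: (flat d (h *: 1 + 0) - flat d 0)) @ 0^' --> (0 : R).
    split; first by apply/cvg_ex; eexists; exact: H.
    exact: cvg_lim H.
  apply/cvgrPdist_le => e e0; near=> h.
  rewrite [h *: 1]mulr1 addr0 (flat_eq0 _ (lexx 0)) subr0 sub0r normrN.
  rewrite [_ *: _](_ : _ = h^-1 * flat d h)// normrM normfV.
  have h0 : h != 0 by near: h; exact: nbhs_dnbhs_neq.
  have [hn|hp] := leP h 0; first by rewrite flat_eq0// normr0 mulr0 ltW.
  rewrite (ger0_norm (flat_ge0 _ _)) gtr0_norm//.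
  rewrite mulrC ler_pdivrMr// (le_trans (flat_le _ hp))//.
  rewrite expr2 mulrA ler_wpM2r ?(ltW hp)//.
  rewrite -ler_pdivlMl ?exprn_gt0//.
  rewrite (le_trans (ler_norm _))//; near: h; apply: dnbhs0_le.
  by rewrite mulr_gt0// invr_gt0 exprn_gt0.
Unshelve. all: by end_near. Qed.

Lemma flat_smooth d : smooth1 (flat d).
Proof.
move=> m; elim: m d => [//|m ih] d; split.
  by move=> x; have [] := flat_is_derive d x.
rewrite (_ : derive1 _ = flat d.+2 \+ (fun x => (- d%:R) * flat d.+1 x)).
  by apply: CnD => //; exact: CnZ.
apply/funext => x; rewrite derive1E; have [_ ->] := flat_is_derive d x.
by rewrite /= mulNr.
Qed.

Definition cbump (t : R) : R := flat 0 (1 + t) * flat 0 (1 - t).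

Lemma cbump_smooth : smooth1 cbump.
Proof.
move=> m; apply: CnM.
  have := Cn_affine 1 1 (flat_smooth 0 m).
  by congr Cn; apply/funext => x; rewrite mul1r addrC.
have := Cn_affine (-1) 1 (flat_smooth 0 m).
by congr Cn; apply/funext => x; rewrite mulN1r addrC.
Qed.

Lemma cbump_ge0 t : 0 <= cbump t.
Proof. by rewrite mulr_ge0// flat_ge0. Qed.

Lemma cbump_gt0 t : `|t| < 1 -> 0 < cbump t.
Proof.
by rewrite ltr_norml => /andP[t1 t2]; rewrite mulr_gt0// flat_gt0//; lra.
Qed.

Lemma cbump_eq0 t : 1 <= `|t| -> cbump t = 0.
Proof.
rewrite ler_normr => /orP[t1|t1]; rewrite /cbump.
  by rewrite [X in _ * X]flat_eq0 ?mulr0//; lra.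
by rewrite flat_eq0 ?mul0r//; lra.
Qed.

End smooth1.

Section smooth_rv.
Context {R : realType} {n : nat}.
Implicit Types (f g : 'rV[R]_n -> R) (x y : 'rV[R]_n).

Lemma smooth_continuous f : smooth f -> continuous f.
Proof. by move=> sf; exact: (sf [::]).1. Qed.

Lemma smooth_derivable f i x : smooth f -> derivable f x (unitv R i).
Proof. by move=> sf; exact: (sf [::]).2. Qed.

Lemma is_derive_cmul f x v (c df : R) : is_derive x v f df ->
  is_derive x v (fun y => c * f y) (c * df).
Proof. exact: is_deriveZ. Qed.

Lemma smooth_derive f i : smooth f -> smooth (fun x => 'D_(unitv R i) f x).
Proof.
move=> sf s; have := sf (rcons s i); rewrite /iter_partial foldr_rcons.
by [].
Qed.

Lemma smooth_derive_continuous f i : smooth f ->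
  continuous (fun x => 'D_(unitv R i) f x).
Proof. by move=> /(smooth_derive i)/smooth_continuous. Qed.

Lemma smoothD f g : smooth f -> smooth g -> smooth (fun x => f x + g x).
Proof.
move=> sf sg s.
have -> : iter_partial s (fun x => f x + g x) =
    (fun x => iter_partial s f x + iter_partial s g x).
  elim: s => [//|i s ih] /=; rewrite ih; apply/funext => x.
  by rewrite deriveD//; [exact: (sf s).2|exact: (sg s).2].
split=> [x|i x].
  by apply: (@cvgD _ _ _ (nbhs x)); [exact: (sf s).1|exact: (sg s).1].
by apply: derivableD; [exact: (sf s).2|exact: (sg s).2].
Qed.

Lemma derive_affine f i (c : R) (a : 'rV[R]_n) x : smooth f ->
  is_derive x (unitv R i) (fun x => f (c *: x + a))
    (c * 'D_(unitv R i) f (c *: x + a)).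
Proof.
move=> sf; apply: line_is_derive.
have -> : (fun s : R => f (c *: (s *: unitv R i + x) + a)) =
    (fun s => f (s *: unitv R i + (c *: x + a))) \o (fun s : R => c * s).
  by apply/funext => s /=; rewrite scalerDr scalerA addrA.
rewrite mulrC; apply: is_derive1_comp.
  have := is_derive_line (derivableP (@smooth_derivable f i ((c * 0) *: unitv R i + (c *: x + a)) sf)).
  by rewrite mulr0 scale0r add0r.
have := is_deriveZ c (is_derive_id (0 : R) (1 : R)).
by move=> h; apply: (is_derive_eq h); rewrite [LHS]mulr1.
Qed.

Lemma affine_continuous (c : R) (a : 'rV[R]_n) :
  continuous (fun x : 'rV[R]_n => c *: x + a).
Proof.
move=> x; apply: (@cvgD _ _ _ (nbhs x)); last exact: cvg_cst.
by apply: (@cvgZr _ _ _ (nbhs x)); exact: cvg_id.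
Qed.

Lemma smooth_affine f (c : R) (a : 'rV[R]_n) :
  smooth f -> smooth (fun x => f (c *: x + a)).
Proof.
move=> sf s.
have -> : iter_partial s (fun x => f (c *: x + a)) =
    (fun x => c ^+ size s * iter_partial s f (c *: x + a)).
  elim: s => [|i s ih] /=; first by apply/funext => x; rewrite expr0 mul1r.
  rewrite ih; apply/funext => x.
  have sfs : smooth (iter_partial s f).
    by move=> t; have := sf (t ++ s); rewrite /iter_partial foldr_cat.
  have [dH vH] := derive_affine i c a x sfs.
  have [_ ->] := is_derive_cmul (c ^+ size s) (derivableP dH).
  by rewrite vH exprSr mulrA.
have sfs : smooth (iter_partial s f).
  by move=> t; have := sf (t ++ s); rewrite /iter_partial foldr_cat.
split=> [x|i x].
  apply: (@cvgMr _ _ (nbhs x)).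
  apply: (@continuous_comp _ _ _ (fun x => c *: x + a) (iter_partial s f)).
    exact: affine_continuous.
  exact: smooth_continuous.
have [dH _] := derive_affine i c a x sfs.
by have [] := is_derive_cmul (c ^+ size s) (derivableP dH).
Qed.

Lemma derive_support f (K : set 'rV[R]_n) i : closed K ->
  (forall x, ~ K x -> f x = 0) ->
  forall x, ~ K x -> 'D_(unitv R i) f x = 0.
Proof.
move=> cK fK x Kx.
have H := is_derive_cst (0 : R) x (unitv R i).
suff : is_derive x (unitv R i) f 0 by case.
apply: (near_eq_is_derive _ H).
have : \forall z \near x, ~ K z.
  by apply: open_nbhs_nbhs; split => //; exact: closed_openC.
by apply: filterS => z Kz; rewrite fK.
Qed.

Lemma test_function_derive (omega : set 'rV[R]_n) f i :
  test_function omega f ->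
  test_function omega (fun x => 'D_(unitv R i) f x).
Proof.
move=> [sf [K [cK Ko fK]]]; split; first exact: smooth_derive.
exists K; split => //; apply: derive_support => //.
exact: compact_closed.
Qed.

Lemma compact_support_bounded f (K : set 'rV[R]_n) : compact K ->
  continuous f -> (forall x, ~ K x -> f x = 0) ->
  exists2 M, 0 <= M & forall x, `|f x| <= M.
Proof.
move=> cK cf fK.
have [K0|/set0P/negP] := pselect (K !=set0); last first.
  rewrite negbK => /eqP K0; exists 0 => // x.
  by rewrite fK ?normr0// K0.
have cnf : {within K, continuous (fun x => `|f x|)}.
  apply: continuous_subspaceT => x.
  by apply: (@cvg_norm _ _ _ (nbhs x)); exact: cf.
have [c Kc fc] := EVT_max_rV K0 cK cnf.
exists `|f c| => // x; have [/mem_set Kx|Kx] := pselect (K x); first exact: fc.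
by rewrite fK ?normr0.
Qed.

Lemma test_function_bounded (omega : set 'rV[R]_n) f :
  test_function omega f -> exists2 M, 0 <= M & forall x, `|f x| <= M.
Proof.
move=> [sf [K [cK Ko fK]]]; apply: compact_support_bounded fK => //.
exact: smooth_continuous.
Qed.

Lemma test_function_measurable (omega : set 'rV[R]_n) f (D : set 'rV[R]_n) :
  test_function omega f -> measurable_fun D f.
Proof.
move=> [sf _]; apply: measurable_funTS; apply: continuous_measurable_rv.
exact: smooth_continuous.
Qed.

Lemma test_function_lipschitz (omega : set 'rV[R]_n) f :
  test_function omega f ->
  exists2 L, 0 <= L & forall x y, `|f x - f y| <= L * `|x - y|.
Proof.
move=> tf.
have H i : exists M, 0 <= M /\ forall x, `|'D_(unitv R i) f x| <= M.
  have [M M0 HM] := test_function_bounded (test_function_derive i tf).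
  by exists M.
have [M HM] := choice H.
exists (\sum_(i < n) M i); first by rewrite sumr_ge0// => i _; exact: (HM i).1.
move=> x y.
have [z _ ->] := @MVT_rv R n f y x (fun i z => @smooth_derivable f i z tf.1).
rewrite mulr_suml (le_trans (ler_norm_sum _ _ _))// ler_sum// => i _.
rewrite normrM ler_pM//; first exact: (HM i).2.
by rewrite (le_trans _ (coord_le_norm _ i))// !mxE.
Qed.

Lemma bounded_integrable f (K : set 'rV[R]_n) (M : R) :
  measurable_fun setT f -> measurable K -> bounded_set K ->
  (forall x, `|f x| <= M) -> (forall x, ~ K x -> f x = 0) ->
  (leb n).-integrable setT (EFin \o f).
Proof.
move=> mf mK bK fM fK.
apply: (eq_integrable measurableT ((EFin \o f) \_ K)).
  move=> x _; rewrite /= patchE; case: ifPn => // /negP; rewrite inE => /fK ->.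
  by [].
apply: (integrable_mkcond (EFin \o f) mK).1.
apply: measurable_bounded_integrable => //.
- exact: leb_bounded_lty.
- exact: measurable_funTS.
- exists M; split; first by rewrite num_real.
  by move=> N MN x _ /=; rewrite (le_trans (fM x))// ltW.
Qed.

Lemma test_function_integrable (omega : set 'rV[R]_n) f :
  test_function omega f -> (leb n).-integrable setT (EFin \o f).
Proof.
move=> tf; have [M _ fM] := test_function_bounded tf.
have [sf [K [cK Ko fK]]] := tf.
apply: (@bounded_integrable f K M) => //.
- exact: test_function_measurable tf.
- exact: compact_rv_measurable.
- exact: compact_bounded.
Qed.

End smooth_rv.

(** * Products of one-variable functions and mollifiers on R^n *)

Section tensor.
Context {R : realType} {n : nat}.

Lemma prod_continuous (I : Type) (r : seq I) (F : I -> 'rV[R]_n -> R) :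
  (forall i, continuous (F i)) -> continuous (fun x => \prod_(i <- r) F i x).
Proof.
move=> cF; elim: r => [|i r ih].
  under eq_fun do rewrite big_nil; exact: cst_continuous.
under eq_fun do rewrite big_cons.
by move=> x; apply: (@cvgM _ _ (nbhs x)); [exact: cF|exact: ih].
Qed.

Lemma tensor_is_derive (h dh : 'I_n -> R -> R) i (x : 'rV[R]_n) :
  is_derive (x ord0 i) (1 : R) (h i) (dh i (x ord0 i)) ->
  is_derive x (unitv R i) (fun x => \prod_(j < n) h j (x ord0 j))
   (\prod_(j < n) (if j == i then dh j (x ord0 j) else h j (x ord0 j))).
Proof.
move=> hi; apply: line_is_derive.
have -> : (fun s : R => \prod_(j < n) h j ((s *: unitv R i + x) ord0 j)) =
    (\prod_(j < n | j != i) h j (x ord0 j)) \*: (h i \o (fun s : R => s + x ord0 i)).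
  apply/funext => s; rewrite (bigD1 i)//= mulrC; congr (_ * h i _).
    apply: eq_bigr => j ji; rewrite !mxE eqxx/= (negPf ji) mulr0 add0r.
    by [].
  by rewrite !mxE !eqxx mulr1.
have h1 : is_derive (0 : R) (1 : R) (fun s : R => s + x ord0 i) 1.
  have := is_deriveD (is_derive_id (0 : R) (1 : R)) (is_derive_cst (x ord0 i) (0 : R) (1 : R)).
  by move=> h'; apply: (is_derive_eq h'); rewrite addr0.
have h2 : is_derive (0 + x ord0 i : R) (1 : R) (h i) (dh i (x ord0 i)).
  by rewrite add0r.
have h4 := @is_derive1_comp R (h i) (fun s => s + x ord0 i) 0 _ _ h2 h1.
have h5 := is_deriveZ (\prod_(j < n | j != i) h j (x ord0 j)) h4.
apply: (is_derive_eq h5).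
rewrite [RHS](bigD1 i)//= eqxx mulr1 [LHS]mulrC; congr (_ * _).
by apply: eq_bigr => j /negPf ->.
Qed.

Lemma tensor_smooth (h : 'I_n -> R -> R) : (forall i, smooth1 (h i)) ->
  smooth (fun x : 'rV[R]_n => \prod_(j < n) h j (x ord0 j)).
Proof.
move=> sh s.
have E : iter_partial s (fun x : 'rV[R]_n => \prod_(j < n) h j (x ord0 j)) =
    (fun x => \prod_(j < n) derive1n (count_mem j s) (h j) (x ord0 j)).
  elim: s => [//|i s ih] /=; rewrite ih; apply/funext => x.
  have [_ ->] := @tensor_is_derive (fun j => derive1n (count_mem j s) (h j))
    (fun j => derive1n (count_mem j s).+1 (h j)) i x
    (smooth1_derivable (count_mem i s) (x ord0 i) (sh i)).
  apply: eq_bigr => j _; have [->|ij] := eqVneq j i; first by rewrite add1n.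
  by rewrite add0n.
rewrite E; split=> [x|i x]; last first.
  by have [] := @tensor_is_derive (fun j => derive1n (count_mem j s) (h j))
    (fun j => derive1n (count_mem j s).+1 (h j)) i x
    (smooth1_derivable (count_mem i s) (x ord0 i) (sh i)).
apply: (@prod_continuous _ _ (fun j (y : 'rV[R]_n) => derive1n (count_mem j s) (h j) (y ord0 j))).
move=> j {}x.
apply: (@continuous_comp _ _ _ (fun y : 'rV[R]_n => y ord0 j)
  (derive1n (count_mem j s) (h j))); first exact: coord_continuous.
apply: derivable_continuous1 => t; exact: smooth1_derivable (sh j).
Qed.

End tensor.

Section mollifier.
Context {R : realType} {n : nat}.

(** The factor [n+1] compensates for [|x|_2 <= n |x|_oo]: a bump supported in the cube of half-side
    [1/((n+1)(k+1))] vanishes outside the Euclidean ball of radius [1/(k+1)]. *)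
Definition mscale_ (k : nat) : R := (n.+1 * k.+1)%:R.

Definition premoll (k : nat) (x : 'rV[R]_n) : R :=
  \prod_(j < n) cbump (mscale_ k * x ord0 j).

Definition moll (k : nat) (x : 'rV[R]_n) : R :=
  (\int[leb n]_y premoll k y)^-1 * premoll k x.

Lemma mscale_gt0 k : 0 < mscale_ k.
Proof. by rewrite ltr0n. Qed.

Lemma premoll_ge0 k x : 0 <= premoll k x.
Proof. by apply: prodr_ge0 => j _; exact: cbump_ge0. Qed.

Lemma premoll_eq0 k x : k.+1%:R^-1 <= enorm x -> premoll k x = 0.
Proof.
move=> xk.
suff [j xj] : exists j, 1 <= `|mscale_ k * x ord0 j|.
  by rewrite /premoll (bigD1 j)//= cbump_eq0// mul0r.
apply: contrapT => /forallNP H.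
have xn : `|x| <= (mscale_ k)^-1.
  apply: norm_le_coord; first by rewrite invr_ge0 ltW// mscale_gt0.
  move=> j; have /negP := H j; rewrite -ltNge normrM gtr0_norm ?mscale_gt0//.
  by move=> /ltW; rewrite mulrC -ler_pdivlMr ?mscale_gt0// div1r.
move: xk; apply/negP; rewrite -ltNge (le_lt_trans (enorm_le_norm x))//.
have : n%:R * `|x| <= n%:R * (mscale_ k)^-1 by rewrite ler_wpM2l.
move/le_lt_trans; apply.
rewrite /mscale_ natrM invfM mulrA gtr_pMl ?invr_gt0 ?ltr0n//.
by rewrite ltr_pdivrMr ?ltr0n// mul1r ltr_nat.
Qed.

Lemma premoll_smooth k : smooth (premoll k).
Proof.
apply: (@tensor_smooth _ _ (fun _ t => cbump (mscale_ k * t))) => i m.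
have := Cn_affine (mscale_ k) 0 (cbump_smooth m).
by congr Cn; apply/funext => x; rewrite addr0.
Qed.

Lemma premoll_test k : test_function (ecball 0 k.+1%:R^-1) (premoll k).
Proof.
split; first exact: premoll_smooth.
exists (ecball 0 k.+1%:R^-1); split => //; first exact: ecball_compact.
move=> x /negP; rewrite -ltNge subr0 => /ltW; exact: premoll_eq0.
Qed.

(** The function is positive on an open set containing 0; a zero integral would make that set null,
    whereas nonempty open sets have positive measure. *)
Lemma premoll_int_gt0 k : 0 < \int[leb n]_y premoll k y.
Proof.
have /integrableP[mp ip] := test_function_integrable (premoll_test k).
rewrite /Rintegral fine_gt0//; apply/andP; split; last first.
  move: ip; congr (_ < _)%E; apply: eq_integral => x _ /=.
  by rewrite ger0_norm// premoll_ge0.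
pose U := [set x | 0 < premoll k x].
have oU : open U.
  rewrite [U](_ : _ = premoll k @^-1` `]0, +oo[); last first.
    by apply/seteqP; split => x; rewrite /U/= in_itv/= andbT.
  apply: open_comp; last exact: interval_open.
  by move=> x _; exact/smooth_continuous/premoll_smooth.
have U0 : U 0.
  by apply: prodr_gt0 => j _; rewrite mxE mulr0 cbump_gt0// normr0.
have mU := open_rv_measurable oU.
have := leb_open_gt0 oU U0.
rewrite !lt0e => /andP[U_neq0 _]; apply/andP; split; last first.
  by apply: integral_ge0 => x _; rewrite lee_fin premoll_ge0.
apply: contra U_neq0 => /eqP p0; apply/eqP.
have : (\int[leb n]_(x in setT) `|(premoll k x)%:E| = 0)%E.
  rewrite -p0; apply: eq_integral => x _ /=.
  by rewrite ger0_norm// premoll_ge0.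
move/(ae_eq_integral_abs (leb n) measurableT mp).1 => [N [mN N0 NU]].
apply/eqP; rewrite eq_le measure_ge0 andbT -N0.
apply: le_measure; rewrite ?inE//.
apply: subset_trans NU => x Ux /= /(_ I)/eqP.
by rewrite eqe gt_eqF.
Qed.

Lemma moll_ge0 k x : 0 <= moll k x.
Proof. by rewrite mulr_ge0 ?premoll_ge0// invr_ge0 ltW// premoll_int_gt0. Qed.

Lemma moll_eq0 k x : k.+1%:R^-1 <= enorm x -> moll k x = 0.
Proof. by move=> xk; rewrite /moll premoll_eq0// mulr0. Qed.

Lemma moll_smooth k : smooth (moll k).
Proof.
move=> s; set c := (\int[leb n]_y premoll k y)^-1.
have -> : iter_partial s (moll k) = (fun x => c * iter_partial s (premoll k) x).
  elim: s => [//|i s ih] /=; rewrite ih; apply/funext => x.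
  by rewrite deriveZ//; exact: (premoll_smooth k s).2.
split=> [x|i x].
  by apply: (@cvgMr _ _ (nbhs x)); exact: (premoll_smooth k s).1.
by have [] := is_derive_cmul c (derivableP ((premoll_smooth k s).2 i x)).
Qed.

Lemma moll_test k : test_function (ecball 0 k.+1%:R^-1) (moll k).
Proof.
split; first exact: moll_smooth.
exists (ecball 0 k.+1%:R^-1); split => //; first exact: ecball_compact.
move=> x /negP; rewrite -ltNge subr0 => /ltW; exact: moll_eq0.
Qed.

Lemma moll_int k : (\int[leb n]_x (moll k x)%:E = 1)%E.
Proof.
have ip := test_function_integrable (premoll_test k).
have -> : (\int[leb n]_x (moll k x)%:E =
  ((\int[leb n]_y premoll k y)^-1)%:E * \int[leb n]_x (premoll k x)%:E)%E.
  by rewrite -integralZl//.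
have fi : (\int[leb n]_x (premoll k x)%:E)%E \is a fin_num.
  exact: integrable_fin_num.
rewrite -[X in (_ * X)%E]fineK// -EFinM mulVf//.
exact/lt0r_neq0/premoll_int_gt0.
Qed.

End mollifier.

(** * Convolution *)

Notation L1 D f := ((leb _).-integrable D (EFin \o f)) (only parsing).

Section bounded_kernels.
Context {R : realType} {n : nat}.
Implicit Types (f g k : 'rV[R]_n -> R) (D : set 'rV[R]_n).

(** Bounded measurable functions on [D], the multipliers that preserve [L1 D]. *)
Definition bm D k := measurable_fun D k /\ exists M, forall x, D x -> `|k x| <= M.

Lemma L1_bm D f k : measurable D -> L1 D f -> bm D k ->
  L1 D (fun x => f x * k x).
Proof.
move=> mD If [mk [M kM]].
have := integrableMl mD If mk; apply.
exists M; split; first by rewrite num_real.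
by move=> N MN x Dx /=; rewrite (le_trans (kM x Dx))// ltW.
Qed.

Lemma kintB D f k1 k2 : measurable D -> L1 D f -> bm D k1 -> bm D k2 ->
  \int[leb n]_(x in D) (f x * k1 x) - \int[leb n]_(x in D) (f x * k2 x) =
  \int[leb n]_(x in D) (f x * (k1 x - k2 x)).
Proof.
move=> mD If b1 b2; rewrite -RintegralB//; [|exact: L1_bm|exact: L1_bm].
by apply: eq_Rintegral => x _; rewrite mulrBr.
Qed.

Lemma kintZ D f k (c : R) : measurable D -> L1 D f -> bm D k ->
  c * \int[leb n]_(x in D) (f x * k x) =
  \int[leb n]_(x in D) (f x * (c * k x)).
Proof.
move=> mD If b; rewrite -RintegralZl//; last exact: L1_bm.
by apply: eq_Rintegral => x _; rewrite mulrCA.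
Qed.

Lemma L1_norm D f : measurable D -> L1 D f -> L1 D (fun x => `|f x|).
Proof. by move=> mD; exact: integrable_norm. Qed.

Lemma kint_le D f k (M : R) : measurable D -> L1 D f -> measurable_fun D k ->
  (forall x, D x -> `|k x| <= M) ->
  `|\int[leb n]_(x in D) (f x * k x)| <= M * \int[leb n]_(x in D) `|f x|.
Proof.
move=> mD If mk kM.
have bk : bm D k by split => //; exists M.
rewrite (le_trans (le_normr_Rintegral mD (L1_bm mD If bk)))//.
rewrite -RintegralZl//; last exact: L1_norm.
apply: le_Rintegral => //.
- by apply: L1_norm => //; exact: L1_bm.
- have := integrableZl mD M (L1_norm mD If).
  by apply: eq_integrable => // x _ /=; rewrite EFinM.
- by move=> x Dx; rewrite normrM mulrC ler_wpM2r// kM.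
Qed.

Lemma bmB D k1 k2 : bm D k1 -> bm D k2 -> bm D (fun x => k1 x - k2 x).
Proof.
move=> [m1 [M1 h1]] [m2 [M2 h2]]; split; first exact: measurable_funB.
exists (M1 + M2) => x Dx; rewrite (le_trans (ler_normB _ _))// lerD//; [exact: h1|exact: h2].
Qed.

Lemma bmZ D k (c : R) : bm D k -> bm D (fun x => c * k x).
Proof.
move=> [m [M h]]; split; first exact: measurable_funM.
by exists (`|c| * M) => x Dx; rewrite normrM ler_wpM2l// h.
Qed.

Lemma bm_test D omega f : test_function omega f -> bm D f.
Proof.
move=> tf; split; first exact: test_function_measurable tf.
by have [M _ fM] := test_function_bounded tf; exists M.
Qed.

Lemma bm_reflect omega f x : test_function omega f -> bm setT (fun y => f (x - y)).
Proof.
move=> tf; split; last first.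
  by have [M _ fM] := test_function_bounded tf; exists M.
have := measurableT_comp (test_function_measurable (D := setT) tf) (measurable_affine_rv (-1) x).
by congr (measurable_fun _ _); apply/funext => y /=; rewrite scaleN1r addrC.
Qed.

End bounded_kernels.

Section convolution.
Context {R : realType} {n : nat}.
Implicit Types (f g phi : 'rV[R]_n -> R) (k : nat) (x y : 'rV[R]_n)
  (D : set 'rV[R]_n).

Definition convol f phi (x : 'rV[R]_n) : R := \int[leb n]_y (f y * phi (x - y)).

Lemma conv_continuous f phi omega : L1 setT f -> test_function omega phi ->
  continuous (convol f phi).
Proof.
move=> If tphi x; apply/(@cvgrPdist_le _ _ _ (nbhs x)) => e e0.
have [L L0 HL] := test_function_lipschitz tphi.
pose I := \int[leb n]_y `|f y|.
have I0 : 0 <= I by apply: Rintegral_ge0 => y _.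
have LI : 0 < L * I + 1 by rewrite ltr_wpDl// mulr_ge0.
near=> z.
rewrite /convol kintB//; [|exact: bm_reflect tphi|exact: bm_reflect tphi].
rewrite (@le_trans _ _ ((L * `|x - z|) * I))//.
  apply: kint_le => //; first exact: (bmB (bm_reflect _ tphi) (bm_reflect _ tphi)).1.
  move=> y _; rewrite (le_trans (HL _ _))//.
  by rewrite opprB addrA subrK.
rewrite mulrAC (@le_trans _ _ ((L * I + 1) * `|x - z|))//.
  by rewrite ler_wpM2r// lerDl.
rewrite -ler_pdivlMl// mulrC; near: z.
apply: (@cvgr_dist_le _ _ _ (nbhs x) _ id x); first exact: cvg_id.
by rewrite divr_gt0.
Unshelve. all: by end_near. Qed.

(** The second derivative is bounded, so difference quotients converge to the derivative uniformly
    in [z] and at a linear rate. This allows differentiation under the integral sign with an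
    explicit error. *)
Lemma test_taylor phi omega i : test_function omega phi ->
  exists2 M, 0 <= M & forall (z : 'rV[R]_n) (h : R), h != 0 ->
    `|'D_(unitv R i) phi z - h^-1 * (phi (h *: unitv R i + z) - phi z)|
      <= M * `|h|.
Proof.
move=> tphi; have tdphi := test_function_derive i tphi.
have [M M0 HM] := test_function_bounded (test_function_derive i tdphi).
exists M => // z h h0.
have [c c1] := @MVT_total R (fun s => phi (s *: unitv R i + z))
  (fun s => 'D_(unitv R i) phi (s *: unitv R i + z)) 0 h
  (fun t => is_derive_line (derivableP (@smooth_derivable _ _ _ _ _ tphi.1))).
rewrite scale0r add0r !subr0 in c1 * => ->.
rewrite mulrCA mulVf// mulr1.
have := @bounded_derive_lipschitz R
  (fun s => 'D_(unitv R i) phi (s *: unitv R i + z))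
  (fun s => 'D_(unitv R i) (fun x => 'D_(unitv R i) phi x) (s *: unitv R i + z)) M
  (fun t => is_derive_line (derivableP (@smooth_derivable _ _ _ _ _ tdphi.1)))
  (fun t => HM _) c 0.
rewrite scale0r add0r sub0r normrN => /le_trans; apply.
by rewrite ler_wpM2l// -[leLHS]subr0.
Qed.

(** By [test_taylor] the error of the difference quotient is at most [M |h|] times the L^1 norm of
    [f]. *)
Lemma conv_is_derive f phi omega i x : L1 setT f -> test_function omega phi ->
  is_derive x (unitv R i) (convol f phi)
    (convol f (fun y => 'D_(unitv R i) phi y) x).
Proof.
move=> If tphi; have tdphi := test_function_derive i tphi.
suff H : (fun h : R => h^-1 *: (convol f phi (h *: unitv R i + x) - convol f phi x)) @ 0^' -->
    convol f (fun y => 'D_(unitv R i) phi y) x.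
  split; first by apply/cvg_ex; eexists; exact: H.
  exact: cvg_lim H.
apply/cvgrPdist_le => e e0.
pose I := \int[leb n]_y `|f y|.
have I0 : 0 <= I by apply: Rintegral_ge0 => y _.
have [M M0 HM] := test_taylor i tphi.
have MI : 0 < M * I + 1 by rewrite ltr_wpDl// mulr_ge0.
near=> h.
have h0 : h != 0 by near: h; exact: nbhs_dnbhs_neq.
have b1 y := bm_reflect y tphi.
have b2 y := bm_reflect y tdphi.
rewrite /convol kintB// [_ *: _](_ : _ = h^-1 * \int[leb n]_y (f y * (phi (h *: unitv R i + x - y) - phi (x - y))))//.
rewrite kintZ//; last exact: bmB.
have b3 : bm setT (fun y => h^-1 * (phi (h *: unitv R i + x - y) - phi (x - y))).
  by apply: bmZ; exact: bmB.
rewrite kintB//.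
rewrite (@le_trans _ _ ((M * `|h|) * I))//.
  apply: kint_le => //; first exact: (bmB (b2 x) b3).1.
  by move=> y _; rewrite -addrA HM.
rewrite mulrAC (@le_trans _ _ ((M * I + 1) * `|h|))//.
  by rewrite ler_wpM2r// lerDl.
rewrite -ler_pdivlMl// mulrC; near: h.
by apply: dnbhs0_le; rewrite divr_gt0.
Unshelve. all: by end_near. Qed.

Lemma test_function_iter_partial omega phi s : test_function omega phi ->
  test_function omega (iter_partial s phi).
Proof. by move=> tphi; elim: s => [//|i s ih] /=; exact: test_function_derive. Qed.

Lemma conv_smooth f phi omega : L1 setT f -> test_function omega phi ->
  smooth (convol f phi).
Proof.
move=> If tphi s.
have -> : iter_partial s (convol f phi) = convol f (iter_partial s phi).
  elim: s => [//|i s ih] /=; rewrite ih; apply/funext => x.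
  have ts := test_function_iter_partial s tphi.
  by have [_ ->] := conv_is_derive i x If ts.
have ts := test_function_iter_partial s tphi.
split=> [|i x]; first exact: conv_continuous ts.
by have [] := conv_is_derive i x If ts.
Qed.

Lemma moll_reflect_int k (x : 'rV[R]_n) :
  (\int[leb n]_y (moll k (x - y))%:E = 1)%E.
Proof.
have tm := @moll_test R n k.
rewrite (@integral_reflect R n x (EFin \o moll k)).
- exact: moll_int.
- by apply/measurable_EFinP; exact: test_function_measurable tm.
- exact: test_function_integrable tm.
Qed.

Lemma moll_translate_int k (y : 'rV[R]_n) :
  (\int[leb n]_x (moll k (x - y))%:E = 1)%E.
Proof.
have tm := @moll_test R n k.
have := @ge0_integral_affine R n 1 (- y) (EFin \o moll k) (oner_neq0 _).
rewrite normr1 expr1n mul1e moll_int => ->.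
- by apply: eq_integral => x _ /=; rewrite scale1r.
- by apply/measurable_EFinP; exact: test_function_measurable tm.
- by move=> x; rewrite lee_fin moll_ge0.
Qed.

Lemma moll_reflect_Rint k (x : 'rV[R]_n) : \int[leb n]_y (moll k (x - y)) = 1.
Proof. by rewrite /Rintegral moll_reflect_int. Qed.

Lemma moll_reflect_L1 k (x : 'rV[R]_n) : L1 setT (fun y => moll k (x - y)).
Proof.
have [m _] := bm_reflect x (@moll_test R n k).
apply/integrableP; split; first exact/measurable_EFinP.
rewrite (_ : \int[leb n]_y _ = 1)%E ?ltry// -(moll_reflect_int k x).
by apply: eq_integral => y _ /=; rewrite ger0_norm// moll_ge0.
Qed.

Lemma conv_moll_near f k x (e : R) : L1 setT f ->
  (forall y, enorm (x - y) < k.+1%:R^-1 -> `|f y - f x| <= e) ->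
  `|convol f (moll k) x - f x| <= e.
Proof.
move=> If H; have bx := bm_reflect x (@moll_test R n k).
have Im := moll_reflect_L1 k x.
have e0 : 0 <= e.
  have := H x; rewrite !subrr normr0 enorm0 invr_gt0 ltr0n.
  exact.
have Ifm : L1 setT (fun y => f y * moll k (x - y)) by exact: L1_bm.
have Ifxm : L1 setT (fun y => f x * moll k (x - y)).
  have := integrableZl measurableT (f x) Im.
  by apply: eq_integrable => // y _ /=; rewrite EFinM.
have Iem : L1 setT (fun y => e * moll k (x - y)).
  have := integrableZl measurableT e Im.
  by apply: eq_integrable => // y _ /=; rewrite EFinM.
have -> : convol f (moll k) x - f x =
    \int[leb n]_y (f y * moll k (x - y) - f x * moll k (x - y)).
  by rewrite RintegralB// RintegralZl// moll_reflect_Rint mulr1.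
have Id : L1 setT (fun y => f y * moll k (x - y) - f x * moll k (x - y)).
  have := integrableB measurableT Ifm Ifxm.
  by apply: eq_integrable => // y _ /=; rewrite EFinB.
rewrite (le_trans (le_normr_Rintegral measurableT Id))//.
have -> : e = \int[leb n]_y (e * moll k (x - y)).
  by rewrite RintegralZl// moll_reflect_Rint mulr1.
apply: le_Rintegral => //; first exact: L1_norm.
move=> y _; rewrite -mulrBl normrM (ger0_norm (moll_ge0 _ _)).
have [yx|yx] := ltP (enorm (x - y)) k.+1%:R^-1.
  by rewrite ler_wpM2r ?moll_ge0// H.
by rewrite moll_eq0// !mulr0.
Qed.

Lemma conv_moll_bounded f k x (M : R) : L1 setT f -> (forall y, `|f y| <= M) ->
  `|convol f (moll k) x| <= M.
Proof.
move=> If fM; have bx := bm_reflect x (@moll_test R n k).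
have Im := moll_reflect_L1 k x.
have Ifm : L1 setT (fun y => f y * moll k (x - y)) by exact: L1_bm.
have Iem : L1 setT (fun y => M * moll k (x - y)).
  have := integrableZl measurableT M Im.
  by apply: eq_integrable => // y _ /=; rewrite EFinM.
rewrite (le_trans (le_normr_Rintegral measurableT Ifm))//.
have -> : M = \int[leb n]_y (M * moll k (x - y)).
  by rewrite RintegralZl// moll_reflect_Rint mulr1.
apply: le_Rintegral => //; first exact: L1_norm.
by move=> y _; rewrite normrM (ger0_norm (moll_ge0 _ _)) ler_wpM2r ?moll_ge0.
Qed.

Lemma conv_eq0 f phi (x : 'rV[R]_n) : (forall y, f y * phi (x - y) = 0) ->
  convol f phi x = 0.
Proof.
move=> H; rewrite /convol; under eq_Rintegral do rewrite H.
by rewrite Rintegral_cst// mul0r.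
Qed.

Lemma moll_sub_measurable k :
  measurable_fun setT (fun p : 'rV[R]_n * 'rV[R]_n => moll k (p.1 - p.2)).
Proof.
exact: (measurableT_comp (test_function_measurable (D := setT) (@moll_test R n k))
  measurable_sub_rv).
Qed.

(** Exchange the integrals and use that every translate of the mollifier has mass one. Applied to
    [|f|] and [f^2], it makes mollification a contraction of L^1 and L^2. *)
Lemma tonelli_moll g k : measurable_fun setT g -> (forall x, 0 <= g x) ->
  (\int[leb n]_x \int[leb n]_y (g y * moll k (x - y))%:E =
   \int[leb n]_y (g y)%:E)%E.
Proof.
move=> mg g0.
pose F (p : 'rV[R]_n * 'rV[R]_n) : \bar R := (g p.2 * moll k (p.1 - p.2))%:E.
have mm := moll_sub_measurable k.
have mF : measurable_fun setT F.
  apply/measurable_EFinP; apply: measurable_funM => //.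
  exact: (measurableT_comp mg measurable_snd).
have F0 p : (0 <= F p)%E by rewrite lee_fin mulr_ge0// moll_ge0.
have := @fubini_tonelli _ _ _ _ R (@leb R n) (@leb R n) F mF F0.
move=> ->; apply: eq_integral => y _.
have : (\int[leb n]_x (g y * moll k (x - y))%:E =
    (g y)%:E * \int[leb n]_x (moll k (x - y))%:E)%E.
  rewrite -ge0_integralZl//.
  - have := measurable_affine_rv 1 (- y).
    move=> /(measurableT_comp (test_function_measurable (D := setT) (@moll_test R n k))).
    move=> H; apply/measurable_EFinP; move: H; congr measurable_fun.
    by apply/funext => x /=; rewrite scale1r.
  - by move=> x _; rewrite lee_fin moll_ge0.
  - by rewrite lee_fin.
by rewrite moll_translate_int mule1.
Qed.

Lemma conv_measurable f k D : L1 setT f -> measurable_fun D (convol f (moll k)).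
Proof.
move=> If; apply: measurable_funTS; apply: continuous_measurable_rv.
exact: conv_continuous (@moll_test R n k).
Qed.

Lemma conv_moll_L1_le f k : L1 setT f ->
  (\int[leb n]_x `|convol f (moll k) x|%:E <= \int[leb n]_y `|f y|%:E)%E.
Proof.
move=> If.
have mf : measurable_fun setT f by apply/measurable_EFinP; case/integrableP: If.
have mnf : measurable_fun setT (fun y => `|f y|) by exact: measurableT_comp.
rewrite -(tonelli_moll k mnf)//.
have mJ x : measurable_fun setT (fun y => (`|f y| * moll k (x - y))%:E).
  apply/measurable_EFinP; apply: measurable_funM => //.
  exact: (bm_reflect x (@moll_test R n k)).1.
apply: ge0_le_integral => //.
- by apply/measurable_EFinP; apply: measurableT_comp => //; exact: conv_measurable.
- pose F (p : 'rV[R]_n * 'rV[R]_n) : \bar R := (`|f p.2| * moll k (p.1 - p.2))%:E.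
  apply: (@measurable_fun_fubini_tonelli_F _ _ _ _ R (@leb R n) F).
    apply/measurable_EFinP; apply: measurable_funM.
      exact: (measurableT_comp mnf measurable_snd).
    exact: moll_sub_measurable.
  by move=> p; rewrite lee_fin mulr_ge0// moll_ge0.
- move=> x _.
  have Ifm : L1 setT (fun y => f y * moll k (x - y)).
    by apply: L1_bm => //; exact: bm_reflect (@moll_test R n k).
  rewrite /convol (EFin_normr_Rintegral measurableT)//.
  apply: (le_trans (le_abse_integral _ measurableT _)).
    by case/integrableP: Ifm.
  rewrite le_eqVlt; apply/orP; left; apply/eqP; apply: eq_integral => y _ /=.
  by rewrite normrM (ger0_norm (moll_ge0 _ _)).
Qed.

Lemma conv_moll_L2_le f k : L1 setT f ->
  (\int[leb n]_x (convol f (moll k) x ^+ 2)%:E <= \int[leb n]_y (f y ^+ 2)%:E)%E.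
Proof.
move=> If.
have mf : measurable_fun setT f by apply/measurable_EFinP; case/integrableP: If.
have mnf : measurable_fun setT (fun y => f y ^+ 2) by exact: measurable_funX.
rewrite -(tonelli_moll k mnf); last by move=> x; exact: sqr_ge0.
have mJ x : measurable_fun setT (fun y => (f y ^+ 2 * moll k (x - y))%:E).
  apply/measurable_EFinP; apply: measurable_funM => //.
  exact: (bm_reflect x (@moll_test R n k)).1.
apply: ge0_le_integral => //.
- by move=> x _; rewrite lee_fin sqr_ge0.
- by apply/measurable_EFinP; apply: measurable_funX; exact: conv_measurable.
- pose F (p : 'rV[R]_n * 'rV[R]_n) : \bar R := (f p.2 ^+ 2 * moll k (p.1 - p.2))%:E.
  apply: (@measurable_fun_fubini_tonelli_F _ _ _ _ R (@leb R n) F).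
    apply/measurable_EFinP; apply: measurable_funM.
      exact: (measurableT_comp mnf measurable_snd).
    exact: moll_sub_measurable.
  by move=> p; rewrite lee_fin mulr_ge0 ?sqr_ge0// moll_ge0.
move=> x _.
(* Jensen: [0 <= \int (f y - c)^2 moll (x - y) dy] for [c = (f * moll) x] *)
pose c := convol f (moll k) x.
have Im := moll_reflect_L1 k x.
have Ifm : L1 setT (fun y => f y * moll k (x - y)).
  by apply: L1_bm => //; exact: bm_reflect (@moll_test R n k).
have [Jfin|] := ltP (\int[leb n]_y (f y ^+ 2 * moll k (x - y))%:E)%E +oo%E; last first.
  by rewrite leye_eq => /eqP ->; rewrite leey.
have If2 : L1 setT (fun y => f y ^+ 2 * moll k (x - y)).
  apply/integrableP; split; [exact: mJ|apply: le_lt_trans Jfin].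
  rewrite le_eqVlt; apply/orP; left; apply/eqP; apply: eq_integral => y _ /=.
  by rewrite ger0_norm// mulr_ge0 ?sqr_ge0 ?moll_ge0.
have I1 : L1 setT (fun y => 2 * c * (f y * moll k (x - y))).
  have := integrableZl measurableT (2 * c) Ifm.
  by apply: eq_integrable => // y _ /=; rewrite EFinM.
have I2 : L1 setT (fun y => c ^+ 2 * moll k (x - y)).
  have := integrableZl measurableT (c ^+ 2) Im.
  by apply: eq_integrable => // y _ /=; rewrite EFinM.
have I3 : L1 setT (fun y => f y ^+ 2 * moll k (x - y) - 2 * c * (f y * moll k (x - y))).
  have := integrableB measurableT If2 I1.
  by apply: eq_integrable => // y _ /=; rewrite EFinB.
have : 0 <= \int[leb n]_y (f y ^+ 2 * moll k (x - y) -
     2 * c * (f y * moll k (x - y)) + c ^+ 2 * moll k (x - y)).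
  apply: Rintegral_ge0 => y _.
  rewrite [leRHS](_ : _ = (f y - c) ^+ 2 * moll k (x - y)); last by ring.
  by rewrite mulr_ge0 ?sqr_ge0 ?moll_ge0.
have J1 : \int[leb n]_y (2 * c * (f y * moll k (x - y))) = 2 * c * c.
  by rewrite RintegralZl.
have J2 : \int[leb n]_y (c ^+ 2 * moll k (x - y)) = c ^+ 2.
  by rewrite RintegralZl// moll_reflect_Rint mulr1.
rewrite RintegralD// RintegralB// J1 J2 => H.
rewrite -[leRHS]fineK; last exact: (integrable_fin_num measurableT If2).
rewrite lee_fin -subr_ge0 -/c; apply: (le_trans H).
by rewrite /Rintegral le_eqVlt; apply/orP; left; apply/eqP; ring.
Qed.

End convolution.

(** * Convergence of mollifications *)

Section integral_tools.
Context {d} {T : measurableType d} {R : realType} (mu : {measure set T -> \bar R}).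
Implicit Types (D : set T) (f g h : T -> R).

Lemma measurable_norm D f : measurable_fun D f -> measurable_fun D (fun x => `|f x|).
Proof. by move=> mf; exact: measurableT_comp. Qed.

Lemma ge0_integral_le_add D f g h : measurable D ->
  measurable_fun D f -> measurable_fun D g -> measurable_fun D h ->
  (forall x, D x -> 0 <= f x) -> (forall x, D x -> 0 <= g x) ->
  (forall x, D x -> 0 <= h x) -> (forall x, D x -> f x <= g x + h x) ->
  (\int[mu]_(x in D) (f x)%:E <=
   \int[mu]_(x in D) (g x)%:E + \int[mu]_(x in D) (h x)%:E)%E.
Proof.
move=> mD mf mg mh f0 g0 h0 fgh.
rewrite -ge0_integralD//; [|exact/measurable_EFinP|exact/measurable_EFinP].
apply: ge0_le_integral => //.
- exact/measurable_EFinP.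
- by apply: emeasurable_funD; exact/measurable_EFinP.
Qed.

(** Dominated convergence in epsilon form, so that limit arguments reduce to picking one large
    index. *)
Lemma dct_abs D (f_ : nat -> T -> R) f g : measurable D ->
  (forall k, measurable_fun D (f_ k)) ->
  (forall x, D x -> f_ ^~ x @ \oo --> f x) ->
  mu.-integrable D (EFin \o g) ->
  (forall k x, D x -> `|f_ k x| <= g x) ->
  measurable_fun D f /\
  forall e : R, 0 < e -> \forall k \near \oo,
    (\int[mu]_(x in D) (`|f_ k x - f x|)%:E <= e%:E)%E.
Proof.
move=> mD mf cf ig fg.
have mlim : measurable_fun D f by exact: (measurable_fun_cvg mf cf).
split => // e e0.
have h1 k : measurable_fun D (EFin \o f_ k) by exact/measurable_EFinP.
have h2 : measurable_fun D (EFin \o f) by exact/measurable_EFinP.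
have h3 : {ae mu, forall x, D x -> (fun k => (f_ k x)%:E) @ \oo --> (f x)%:E}.
  by apply: aeW => x Dx; apply: cvg_EFin; [exact: nearW|exact: cf].
have h4 : {ae mu, forall x k, D x -> (`|(f_ k x)%:E| <= (g x)%:E)%E}.
  by apply: aeW => x k Dx; rewrite lee_fin fg.
have [_ H2 _] := dominated_convergence mD h1 h2 h3 ig h4.
move: H2 => /fine_cvgP[H2 H3].
have := H2; have /cvgrPdist_le/(_ _ e0) := H3.
move=> c1 c2; near=> k.
have fk : (\int[mu]_(x in D) (`|f_ k x - f x|)%:E)%E \is a fin_num by near: k.
rewrite -(fineK fk) lee_fin -[leLHS]ger0_norm ?fine_ge0 ?integral_ge0//.
rewrite -normrN -[X in `|X|]add0r.
by near: k.
Unshelve. all: by end_near. Qed.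

Lemma ge0_integral_eq0_off D E f : measurable D -> measurable E -> E `<=` D ->
  (forall x, D x -> ~ E x -> f x = 0) ->
  (\int[mu]_(x in D) (f x)%:E = \int[mu]_(x in E) (f x)%:E)%E.
Proof.
move=> mD mE ED f0.
rewrite integral_mkcond [RHS]integral_mkcond; apply: eq_integral => x _.
rewrite !patchE; have [Ex|Ex] := pselect (E x).
  by rewrite (mem_set Ex) (mem_set (ED _ Ex)).
rewrite (memNset Ex); case: ifPn => //; rewrite inE => Dx.
by rewrite f0.
Qed.

End integral_tools.

(** * Density of bounded continuous functions in L^1 *)

Section density.
Context {R : realType} {n : nat} (X : set 'rV[R]_n).
Context (mX : measurable X) (fX : (leb n X < +oo)%E).
Implicit Types (g h c : 'rV[R]_n -> R) (A : set 'rV[R]_n).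

Let mnorm g := @measurable_norm _ _ R X g.

Definition approximable g := forall e : R, 0 < e -> exists c,
  [/\ continuous c, (exists M, forall x, `|c x| <= M) &
    (\int[leb n]_(x in X) `|g x - c x|%:E <= e%:E)%E].

Let mc c : continuous c -> measurable_fun X c.
Proof. by move=> cc; apply: measurable_funTS; exact: continuous_measurable_rv. Qed.

Lemma approximable_cst r : approximable (cst r).
Proof.
move=> e e0; exists (cst r); split; first exact: cst_continuous.
  by exists `|r|.
rewrite (eq_integral (cst 0%E)) ?integral0 ?lee_fin ?ltW// => x _.
by rewrite /= subrr normr0.
Qed.

Lemma approximable_le g : measurable_fun X g ->
  (forall e : R, 0 < e -> exists2 h, measurable_fun X h /\ approximable h &
     (\int[leb n]_(x in X) `|g x - h x|%:E <= e%:E)%E) -> approximable g.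
Proof.
move=> mg H e e0; have e2 : 0 < e / 2 by rewrite divr_gt0.
have [h [mh ah] gh] := H _ e2; have [c [cc bc hc]] := ah _ e2.
exists c; split => //; rewrite [e]splitr EFinD (le_trans _ (leeD gh hc))//.
have := mc cc => mcc.
apply: ge0_integral_le_add => //; try (by apply: mnorm; exact: measurable_funB).
by move=> x _; rewrite -[X in `|X|](subrKA (h x)) ler_normD.
Qed.

Lemma approximableD g h : measurable_fun X g -> measurable_fun X h ->
  approximable g -> approximable h -> approximable (fun x => g x + h x).
Proof.
move=> mg mh ag ah e e0; have e2 : 0 < e / 2 by rewrite divr_gt0.
have [c [cc [M bc] gc]] := ag _ e2; have [c' [cc' [M' bc'] hc]] := ah _ e2.
exists (fun x => c x + c' x); split.
- by move=> x; apply: (@cvgD _ _ _ (nbhs x)); [exact: cc|exact: cc'].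
- by exists (M + M') => x; rewrite (le_trans (ler_normD _ _))// lerD.
rewrite [e]splitr EFinD (le_trans _ (leeD gc hc))//.
have mcc := mc cc; have mcc' := mc cc'.
apply: ge0_integral_le_add => //.
- by apply: mnorm; apply: measurable_funB; exact: measurable_funD.
- by apply: mnorm; exact: measurable_funB.
- by apply: mnorm; exact: measurable_funB.
by move=> x _; rewrite opprD addrACA ler_normD.
Qed.

Lemma approximableZ g r : measurable_fun X g ->
  approximable g -> approximable (fun x => r * g x).
Proof.
move=> mg ag e e0; have r0 : 0 < `|r| + 1 by rewrite ltr_wpDl.
have [c [cc [M bc] gc]] := ag _ (divr_gt0 e0 r0).
exists (fun x => r * c x); split.
- by move=> x; apply: (@cvgMr _ _ (nbhs x)); exact: cc.
- by exists (`|r| * M) => x; rewrite normrM ler_wpM2l.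
have mcc := mc cc.
have mgc : measurable_fun X (fun x => `|g x - c x|).
  by apply: mnorm; exact: measurable_funB.
apply: (@le_trans _ _ (`|r|%:E * \int[leb n]_(x in X) `|g x - c x|%:E)%E).
  rewrite -ge0_integralZl//; last exact/measurable_EFinP.
  rewrite le_eqVlt; apply/orP; left; apply/eqP; apply: eq_integral => x _ /=.
  by rewrite -mulrBr normrM EFinM.
apply: (@le_trans _ _ (`|r|%:E * (e / (`|r| + 1))%:E)%E).
  by apply: lee_wpmul2l; rewrite ?lee_fin.
rewrite -EFinM lee_fin mulrCA ler_piMr ?(ltW e0)// ler_pdivrMr// mul1r lerDl.
by [].
Qed.

Lemma L1_cst (M : R) : (leb n).-integrable X (EFin \o cst M).
Proof.
apply: measurable_bounded_integrable => //.
by exists `|M|; split; [rewrite num_real|move=> N /ltW MN x _].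
Qed.

Lemma approximable_lim (g_ : nat -> 'rV[R]_n -> R) g (M : R) :
  (forall k, measurable_fun X (g_ k)) -> (forall k, approximable (g_ k)) ->
  (forall x, g_ ^~ x @ \oo --> g x) -> (forall k x, `|g_ k x| <= M) ->
  approximable g.
Proof.
move=> mg ag gg gM.
have [mlim H] := dct_abs mX mg (fun x _ => gg x) (L1_cst M) (fun k x _ => gM k x).
apply: approximable_le => // e e0.
have [k _ /(_ k (leqnn k)) Hk] := H e e0.
exists (g_ k) => //.
by under eq_integral do rewrite distrC.
Qed.

Lemma approximable_continuous c (M : R) :
  continuous c -> (forall x, `|c x| <= M) -> approximable c.
Proof.
move=> cc bc e e0; exists c; split => //; first by exists M.
rewrite (eq_integral (cst 0%E)) ?integral0 ?lee_fin ?ltW// => x _.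
by rewrite /= subrr normr0.
Qed.

(** A pi-system, since products of the approximants approximate intersections; it contains the
    coordinate half-spaces, hence generates the Borel sets. This is the input of the Dynkin argument
    for indicators. *)
Definition continuous_limit_set A := measurable A /\ exists g_ : nat -> 'rV[R]_n -> R,
  [/\ forall k, continuous (g_ k), forall k x, 0 <= g_ k x <= 1 &
      forall x, g_ ^~ x @ \oo --> (\1_A x : R)].

Lemma continuous_limit_setI : setI_closed continuous_limit_set.
Proof.
move=> A B [mA [g [g1 g2 g3]]] [mB [h [h1 h2 h3]]]; split; first exact: measurableI.
exists (fun k x => g k x * h k x); split.
- by move=> k x; apply: (@cvgM _ _ (nbhs x)); [exact: g1|exact: h1].
- move=> k x; have /andP[a1 a2] := g2 k x; have /andP[b1 b2] := h2 k x.
  by rewrite mulr_ge0//= mulr_ile1.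
- move=> x; rewrite (_ : \1_(A `&` B) x = \1_A x * \1_B x :> R).
    by apply: cvgM; [exact: g3|exact: h3].
  by rewrite indicI.
Qed.

Lemma continuous_limit_set_ray i (a : R) :
  continuous_limit_set (rv_coord i @^-1` `]a, +oo[).
Proof.
split; first by rewrite -[X in measurable X]setTI; exact: measurable_rv_coord.
exists (fun k x => Num.min 1 (Num.max 0 (k%:R * (x ord0 i - a)))); split.
- move=> k x; apply: (@continuous_min _ _ _ _ x); first exact: cst_continuous.
  apply: (@continuous_max _ _ _ _ x); first exact: cst_continuous.
  apply: (@cvgMr _ _ (nbhs x)); apply: (@cvgB _ _ _ (nbhs x)).
    exact: coord_continuous.
  exact: cvg_cst.
- move=> k x; rewrite ge_min lexx/= andbT le_min ler01/= le_max lexx//.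
move=> x; rewrite indicE; have [xa|xa] := leP (x ord0 i) a.
  rewrite memNset; last by rewrite /rv_coord/= in_itv/= andbT; apply/negP; rewrite -leNgt.
  apply: cvg_near_cst; apply: nearW => k.
  by rewrite max_l ?min_r// mulr_ge0_le0// subr_le0.
rewrite mem_set; last by rewrite /rv_coord/= in_itv/= andbT.
apply: cvg_near_cst; near=> k; rewrite min_l// le_max; apply/orP; right.
rewrite -ler_pdivrMr ?subr_gt0// mul1r.
near: k; exact: nbhs_infty_ger.
Unshelve. all: by end_near. Qed.

Lemma continuous_limit_set_generates :
  @measurable _ 'rV[R]_n = <<s continuous_limit_set >>.
Proof.
apply/seteqP; split; last first.
  apply: smallest_sub; last by move=> A [].
  exact: sigma_algebra_measurable.
apply: smallest_sub; first exact: smallest_sigma_algebra.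
move=> C; rewrite -bigcup_seq/= => -[i _ [B mB <-]].
have : measurable_fun [set: g_sigma_algebraType continuous_limit_set]
    (rv_coord i : g_sigma_algebraType continuous_limit_set -> R).
  apply: (measurability _ (measurable_realfun.RGenOInfty.measurableE R)) => //.
  move=> _ [_ [a ->] <-]; rewrite setTI.
  apply: sub_sigma_algebra; exact: continuous_limit_set_ray.
by move=> /(_ measurableT B mB).
Qed.

Lemma measurable_1 A : measurable A -> measurable_fun X (\1_A : 'rV[R]_n -> R).
Proof. by move=> mA; exact: measurable_indic. Qed.

(** Dynkin induction: on the generating pi-system by dominated convergence, then complements by
    [1 - 1_A], then disjoint unions by summing indicators and passing to the limit. *)
Lemma approximable_indic A : measurable A -> approximable (\1_A).
Proof.
rewrite continuous_limit_set_generates.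
move: A; apply: (dynkin_induction continuous_limit_set_generates
  continuous_limit_setI).
- by rewrite indicT; exact: approximable_cst.
- move=> A [mA [g [g1 g2 g3]]]; apply: (@approximable_lim g _ 1) => //.
  + by move=> k; exact: mc (g1 k).
  + move=> k; apply: (@approximable_continuous _ 1); first exact: g1.
    by move=> x; have /andP[a b] := g2 k x; rewrite ger0_norm.
  + by move=> k x; have /andP[a b] := g2 k x; rewrite ger0_norm.
- move=> A mA aA.
  have -> : \1_(~` A) = (fun x => cst 1 x + -1 * \1_A x) :> (_ -> R).
    apply/funext => x; rewrite !indicE in_setC.
    by case: (x \in A) => /=; lra.
  apply: approximableD.
  + exact: measurable_cst.
  + by apply: measurable_funM => //; exact: measurable_1.
  + exact: approximable_cst.
  + by apply: approximableZ => //; exact: measurable_1.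
- move=> F mF tF aF.
  pose U k := \big[setU/set0]_(i < k) F i.
  have mU k : measurable (U k) by apply: bigsetU_measurable.
  have aU k : approximable (\1_(U k)).
    elim: k => [|k ih]; first by rewrite /U big_ord0 indic0; exact: approximable_cst.
    have -> : \1_(U k.+1) = (fun x => \1_(U k) x + \1_(F k) x) :> (_ -> R).
      apply/funext => x; rewrite /U big_ord_recr/= -/(U k) !indicE in_setU.
      have [Ux|Ux] := pselect (U k x); have [Fx|Fx] := pselect (F k x).
      * move: Ux; rewrite /U -bigcup_mkord => -[j /= jk Fj].
        have := tF j k I I; move=> /(_ (ex_intro _ x (conj Fj Fx))) jk'.
        by rewrite jk' ltnn in jk.
      * by rewrite (mem_set Ux) (memNset Fx) /= addr0.
      * by rewrite (memNset Ux) (mem_set Fx) /= add0r.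
      * by rewrite (memNset Ux) (memNset Fx) /= addr0.
    by apply: approximableD => //; exact: measurable_1.
  apply: (@approximable_lim (fun k => \1_(U k)) _ 1) => //.
  + move=> x; have [[j _ Fjx]|nFx] := pselect ((\bigcup_k F k) x).
      apply: cvg_near_cst; near=> k; rewrite !indicE !mem_set//; first by exists j.
      rewrite /U -bigcup_mkord; exists j => //=; near: k.
      exact: nbhs_infty_gt.
    apply: cvg_near_cst; apply: nearW => k; rewrite !indicE !memNset//.
    by rewrite /U -bigcup_mkord => -[j _ Fj]; apply: nFx; exists j.
  + by move=> k x; rewrite indicE; case: (_ \in _) => /=; rewrite ?normr0 ?normr1.
Unshelve. all: by end_near. Qed.

Import HBSimple.

Lemma L1_approximable g : (leb n).-integrable X (EFin \o g) -> approximable g.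
Proof.
move=> ig; have mg : measurable_fun X g by apply/measurable_EFinP; case/integrableP: ig.
apply: approximable_le => // e e0.
have [s [is_ sg s0]] := approximation_sfun_integrable mX ig.
move/fine_cvgP : s0 => [s1 /cvgrPdist_le/(_ _ e0) s2].
have [k _ /(_ k (leqnn k)) [h1 h2]] := filterI s1 s2.
exists (s k); last first.
  rewrite -(fineK h1) lee_fin -[leLHS]ger0_norm ?fine_ge0 ?integral_ge0//.
  by rewrite -normrN -[X in `|X|]add0r.
split; first exact: measurable_funTS.
have -> : (s k : _ -> R) = (fun x => \sum_(y <- finmap.enum_fset (fset_set (range (s k))))
    (y * \1_(s k @^-1` [set y]) x)).
  by apply/funext => x; rewrite {1}fimfunE fsbig_finite.
have mS y : measurable (s k @^-1` [set y]) by exact: measurable_sfunP.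
elim: (finmap.enum_fset _) => [|y r ih].
  by under eq_fun do rewrite big_nil; exact: approximable_cst.
under eq_fun do rewrite big_cons; apply: approximableD => //.
- by apply: measurable_funM => //; exact: measurable_1.
- by apply: measurable_sum => i; apply: measurable_funM => //; exact: measurable_1.
- by apply: approximableZ; [exact: measurable_1|exact: approximable_indic].
Qed.

End density.

(** * Convergence of mollifications in L^1 *)

Section mollification_convergence.
Context {R : realType} {n : nat}.
Implicit Types (f g h c : 'rV[R]_n -> R) (x y : 'rV[R]_n) (k : nat).

Lemma conv_moll_cvg f x : L1 setT f -> {for x, continuous f} ->
  (fun k => convol f (moll k) x) @ \oo --> f x.
Proof.
move=> If cf; apply/cvgrPdist_le => e e0.
have /nbhs_ballP[d /= d0 xd] : \forall y \near x, `|f x - f y| <= e.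
  exact: (@cvgr_dist_le _ _ _ (nbhs x) _ _ _ cf).
near=> k; rewrite distrC; apply: conv_moll_near => // y xy.
rewrite distrC; apply: xd; rewrite -ball_normE/=.
rewrite (le_lt_trans (norm_le_enorm _))// (lt_trans xy)//.
near: k; exact: (near_infty_natSinv_lt (PosNum d0)).
Unshelve. all: by end_near. Qed.

Lemma L1_of_bounded f (rho M : R) : measurable_fun setT f ->
  (forall x, `|f x| <= M) -> (forall x, rho < enorm x -> f x = 0) -> L1 setT f.
Proof.
move=> mf fM f0; apply: (@bounded_integrable _ _ f (ecball 0 rho) M) => //.
- by apply: closed_rv_measurable; exact: ecball_closed.
- exact: ecball_bounded.
- by move=> x /negP; rewrite -ltNge subr0; exact: f0.
Qed.

Lemma moll_L1_bounded c (rho M : R) : continuous c ->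
  (forall x, `|c x| <= M) -> (forall x, rho < enorm x -> c x = 0) ->
  forall e : R, 0 < e -> \forall k \near \oo,
    (\int[leb n]_x `|convol c (moll k) x - c x|%:E <= e%:E)%E.
Proof.
move=> cc cM c0 e e0.
have mc : measurable_fun setT c by exact: continuous_measurable_rv.
have Ic : L1 setT c by exact: (L1_of_bounded mc cM c0).
(* Mollifiers have radius at most 1, so all mollifications of [c] vanish outside this ball, and a
   constant is an integrable dominating function on it. *)
pose K : set 'rV[R]_n := ecball 0 (rho + 1).
have mK : measurable K by apply: closed_rv_measurable; exact: ecball_closed.
have fK : (leb n K < +oo)%E by apply: leb_bounded_lty => //; exact: ecball_bounded.
have [||||_ H] := @dct_abs _ _ R (leb n) K (fun k => convol c (moll k)) c (cst M) mK.
- by move=> k; exact: conv_measurable.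
- by move=> x _; apply: conv_moll_cvg => //; exact: cc.
- exact: L1_cst.
- by move=> k x _; exact: conv_moll_bounded.
apply: filterS (H e e0) => k.
rewrite -(@ge0_integral_eq0_off _ _ _ (leb n) setT)// => x _ /negP.
rewrite -ltNge subr0 => xK.
rewrite c0; last by rewrite (lt_trans _ xK)// ltrDl.
rewrite subr0 conv_eq0 ?normr0// => y.
have [yr|yr] := ltP rho (enorm y); first by rewrite c0// mul0r.
rewrite moll_eq0 ?mulr0// (@le_trans _ _ 1)//.
  by rewrite invf_le1 ?ltr0n// ler1n.
have := enorm_dist x y; have := ler_norm (enorm x - enorm y).
lra.
Qed.

Lemma convB f g phi omega x : L1 setT f -> L1 setT g -> test_function omega phi ->
  convol f phi x - convol g phi x = convol (fun y => f y - g y) phi x.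
Proof.
move=> If Ig tphi; have bx := bm_reflect x tphi.
rewrite /convol -RintegralB//; [|exact: L1_bm|exact: L1_bm].
by apply: eq_Rintegral => y _; rewrite mulrBl.
Qed.

Lemma L1B (D : set 'rV[R]_n) f g : measurable D -> L1 D f -> L1 D g ->
  L1 D (fun x => f x - g x).
Proof.
move=> mD If Ig; have := integrableB mD If Ig.
by apply: eq_integrable => // y _ /=; rewrite EFinB.
Qed.

(** Approximate [f] in L^1 by a continuous function of compact support, for which pointwise
    convergence suffices; the error is not enlarged by mollification. *)
Lemma moll_L1 f (rho : R) : L1 setT f -> (forall x, rho < enorm x -> f x = 0) ->
  forall e : R, 0 < e -> \forall k \near \oo,
    (\int[leb n]_x `|convol f (moll k) x - f x|%:E <= e%:E)%E.
Proof.
move=> If f0 e e0.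
have mf : measurable_fun setT f by apply/measurable_EFinP; case/integrableP: If.
pose K : set 'rV[R]_n := ecball 0 (rho + 1).
have mK : measurable K by apply: closed_rv_measurable; exact: ecball_closed.
have fK : (leb n K < +oo)%E by apply: leb_bounded_lty => //; exact: ecball_bounded.
have IK : L1 K f by apply: integrableS If.
have e4 : 0 < e / 4 by rewrite divr_gt0.
have [c [cc [M cM] fc]] := L1_approximable mK fK IK e4.
(* The cut-off is 1 on the ball of radius [rho] and 0 outside radius [rho + 1]. As [f] vanishes
   beyond [rho], [f - c chi = (f - c) chi], so cutting [c] does not increase the error. *)
pose chi x : R := Num.min 1 (Num.max 0 (rho + 1 - enorm x)).
have chi_cont : continuous chi.
  move=> x; apply: (@continuous_min _ _ _ _ x); first exact: cst_continuous.
  apply: (@continuous_max _ _ _ _ x); first exact: cst_continuous.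
  apply: (@cvgB _ _ _ (nbhs x)); first exact: cvg_cst.
  exact: enorm_continuous.
have chi01 x : 0 <= chi x <= 1.
  by rewrite /chi ge_min lexx/= andbT le_min ler01/= le_max lexx.
pose h x := c x * chi x.
have hc : continuous h.
  by move=> x; apply: (@cvgM _ _ (nbhs x)); [exact: cc|exact: chi_cont].
have hM x : `|h x| <= M.
  have /andP[a b] := chi01 x.
  rewrite normrM (ger0_norm a) (le_trans _ (cM x))//.
  by rewrite ler_piMr.
have h0 x : rho + 1 < enorm x -> h x = 0.
  move=> hx; rewrite /h /chi max_l ?min_r ?mulr0// subr_le0 ltW//.
have mh : measurable_fun setT h by exact: continuous_measurable_rv.
have Ih : L1 setT h by exact: (L1_of_bounded mh hM h0).
have mc : measurable_fun setT c by exact: continuous_measurable_rv.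
have fh : (\int[leb n]_x `|f x - h x|%:E <= (e / 4)%:E)%E.
  apply: le_trans fc.
  rewrite (@ge0_integral_eq0_off _ _ _ (leb n) setT K)//; last first.
    move=> x _ /negP; rewrite -ltNge subr0 => xK.
    rewrite h0// f0 ?subrr ?normr0//.
    by rewrite (lt_trans _ xK)// ltrDl.
  apply: ge0_le_integral => //.
  - apply/measurable_EFinP/measurable_norm; apply: measurable_funTS.
    exact: measurable_funB.
  - apply/measurable_EFinP/measurable_norm; apply: measurable_funTS.
    exact: measurable_funB.
  - move=> x _; rewrite lee_fin.
    have -> : f x - h x = (f x - c x) * chi x.
      rewrite mulrBl; congr (_ - _); have [xr|xr] := ltP rho (enorm x).
        by rewrite f0// mul0r.
      by rewrite /chi min_l ?mulr1// le_max; apply/orP; right; lra.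
    have /andP[a b] := chi01 x.
    by rewrite normrM (ger0_norm a) ler_piMr.
have Ifh : L1 setT (fun x => f x - h x) by exact: L1B.
have := moll_L1_bounded hc hM h0 e4; apply: filterS => k hk.
have mcf := @conv_measurable R n f k setT If.
have mch := @conv_measurable R n h k setT Ih.
have e4E : e = e / 4 + e / 4 + (e / 4 + e / 4) by lra.
rewrite e4E !EFinD.
apply: (@le_trans _ _ (\int[leb n]_x (`|convol f (moll k) x - convol h (moll k) x| +
  `|convol h (moll k) x - h x|)%:E + \int[leb n]_x `|f x - h x|%:E)%E).
  apply: ge0_integral_le_add => //.
  - by apply: measurable_norm; exact: measurable_funB.
  - by apply: measurable_funD; apply: measurable_norm; exact: measurable_funB.
  - by apply: measurable_norm; exact: measurable_funB.
  - move=> x _; rewrite -[X in `|X|](subrKA (convol h (moll k) x)).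
    rewrite -[X in `|_ + X|](subrKA (h x)) addrA (distrC (f x)).
    by rewrite (le_trans (ler_normD _ _))// lerD2r ler_normD.
apply: leeD; last by rewrite (le_trans fh)// -EFinD lee_fin lerDl ltW.
apply: (@le_trans _ _ (\int[leb n]_x `|convol f (moll k) x - convol h (moll k) x|%:E +
   \int[leb n]_x `|convol h (moll k) x - h x|%:E)%E).
  apply: ge0_integral_le_add => //.
  - by apply: measurable_funD; apply: measurable_norm; exact: measurable_funB.
  - by apply: measurable_norm; exact: measurable_funB.
  - by apply: measurable_norm; exact: measurable_funB.
apply: leeD => //; apply: le_trans fh.
under eq_integral do rewrite (convB _ If Ih (@moll_test R n k)).
exact: conv_moll_L1_le.
Qed.

End mollification_convergence.

(** * Weak derivatives *)

Section L2_tools.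
Context {R : realType} {n : nat}.
Implicit Types (f g h : 'rV[R]_n -> R) (x y : 'rV[R]_n) (k : nat) (D : set 'rV[R]_n).

Lemma L1_measurable D f : L1 D f -> measurable_fun D f.
Proof. by case/integrableP => /measurable_EFinP. Qed.

Lemma L1_sqr D f : measurable_fun D f -> (sqrL2 D f < +oo)%E ->
  L1 D (fun x => f x ^+ 2).
Proof.
move=> mf f2; apply/integrableP; split.
  by apply/measurable_EFinP; exact: measurable_funX.
move: f2; rewrite /sqrL2; congr (_ < _)%E; apply: eq_integral => x _ /=.
by rewrite ger0_norm// sqr_ge0.
Qed.

Lemma L1_of_L2 D f : measurable D -> (leb n D < +oo)%E -> measurable_fun D f ->
  (sqrL2 D f < +oo)%E -> L1 D f.
Proof.
move=> mD fD mf f2.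
have I1 : L1 D (fun x => cst 1 x + f x ^+ 2).
  have := integrableD mD (L1_cst mD fD 1) (L1_sqr mf f2).
  by apply: eq_integrable => // x _ /=; rewrite EFinD.
apply: le_integrable I1 => //; first exact/measurable_EFinP.
move=> x Dx /=; rewrite lee_fin [leRHS]ger0_norm ?addr_ge0 ?sqr_ge0//.
rewrite -(real_normK (num_real (f x))).
have := sqr_ge0 (`|f x| - 1); nra.
Qed.

Lemma ge0_integralZ_fin D f (c : R) : measurable D -> measurable_fun D f ->
  0 <= c -> (forall x, D x -> 0 <= f x) ->
  (\int[leb n]_(x in D) (c * f x)%:E = c%:E * \int[leb n]_(x in D) (f x)%:E)%E.
Proof.
move=> mD mf c0 f0; rewrite -ge0_integralZl//; last exact/measurable_EFinP.
Qed.

Lemma ge0_integral_le D f g : measurable D -> measurable_fun D f ->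
  measurable_fun D g -> (forall x, D x -> 0 <= f x) ->
  (forall x, D x -> f x <= g x) ->
  (\int[leb n]_(x in D) (f x)%:E <= \int[leb n]_(x in D) (g x)%:E)%E.
Proof.
move=> mD mf mg f0 fg; apply: ge0_le_integral => //.
- exact/measurable_EFinP.
- exact/measurable_EFinP.
Qed.

(* Truncating [f] at a large height reduces the L^2 estimate to the L^1 one. *)
Lemma moll_L2 f (rho : R) : measurable_fun setT f -> (sqrL2 setT f < +oo)%E ->
  L1 setT f ->
  (forall x, rho < enorm x -> f x = 0) ->
  forall e : R, 0 < e -> \forall k \near \oo,
    (sqrL2 setT (fun x => (convol f (moll k) x - f x)%R) <= e%:E)%E.
Proof.
move=> mf f2 If f0 e e0.
pose t (N : nat) x : R := Num.max (- N%:R) (Num.min N%:R (f x)).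
pose r N x := f x - t N x.
have tN N x : `|t N x| <= N%:R.
  rewrite ler_norml le_max lexx/= ge_max ge_min lexx andbT/=.
  by rewrite -subr_ge0 opprK -natrD ler0n.
have t0 N x : f x = 0 -> t N x = 0.
  by move=> fx; rewrite /t fx min_r// max_r// oppr_le0.
have rf N x : `|r N x| <= `|f x|.
  rewrite /r /t; have N0 : 0 <= N%:R :> R by [].
  case: (lerP N%:R (f x)) => h1; [rewrite max_r ?(le_trans _ N0) ?oppr_le0//|case: (lerP (- N%:R) (f x)) => h2].
  - by rewrite !ger0_norm ?subr_ge0 ?(le_trans N0)// lerBlDr lerDl.
  - by rewrite subrr normr0.
  - have fx0 : f x < 0 by rewrite (lt_le_trans h2)// oppr_le0.
    rewrite opprK !ltr0_norm//; last by rewrite -ltrBrDr sub0r.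
    by rewrite opprD lerBlDr lerDl.
have mt N : measurable_fun setT (t N).
  apply: measurable_maxr; first exact: measurable_cst.
  by apply: measurable_minr; first exact: measurable_cst.
have mr N : measurable_fun setT (r N) by exact: measurable_funB.
(* The square of a sum of three terms is at most 3 times the sum of squares. Two of them are
   remainders of weight 3; the third is at most [2N] times its absolute value, giving weight [6N] on
   an L^1 error of size [e/(12(N+1))]. Altogether [(3 + 3 + 6) e/12]. *)
have e12 : 0 < e / 12 by rewrite divr_gt0.
have [||||_ H] := @dct_abs _ _ R (leb n) setT (fun N x => r N x ^+ 2) (cst 0)
    (fun x => f x ^+ 2) measurableT.
- by move=> N; exact: measurable_funX.
- move=> x _; apply: cvg_near_cst; near=> N; rewrite /r /t min_r; last first.
    by rewrite (le_trans (ler_norm _))//; near: N; exact: nbhs_infty_ger.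
  rewrite max_r ?subrr ?expr0n// lerNl (le_trans (ler_norm _))// normrN.
  by near: N; exact: nbhs_infty_ger.
- exact: L1_sqr.
- move=> N x _; rewrite ger0_norm ?sqr_ge0//.
  by rewrite -(real_normK (num_real (r N x))) -(real_normK (num_real (f x))) lerXn2r ?nnegrE.
have [N _ /(_ N (leqnn N))] := H _ e12.
under eq_integral do rewrite subr0 ger0_norm ?sqr_ge0//.
move=> rN.
have It : L1 setT (t N).
  apply: (@L1_of_bounded _ _ _ rho N%:R) => //.
  by move=> x /f0; exact: t0.
have Ir : L1 setT (r N) by exact: L1B.
have eN : 0 < e / 12 / (N%:R + 1) by rewrite divr_gt0// ltr_wpDl.
have := moll_L1 It (fun x hx => t0 N x (f0 x hx)) eN.
apply: filterS => k hk.
have m1 := @conv_measurable R n (r N) k setT Ir.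
have m2 := @conv_measurable R n (t N) k setT It.
have m3 := @conv_measurable R n f k setT If.
have m4 : measurable_fun setT (fun x => `|convol (t N) (moll k) x - t N x|).
  by apply: measurable_norm; exact: measurable_funB.
have N0 : 0 <= 6 * N%:R :> R by rewrite mulr_ge0.
apply: (@le_trans _ _ (\int[leb n]_x (3 * convol (r N) (moll k) x ^+ 2)%:E +
   \int[leb n]_x (3 * r N x ^+ 2 + 6 * N%:R * `|convol (t N) (moll k) x - t N x|)%:E)%E).
  apply: ge0_integral_le_add => //.
  - by apply: measurable_funX; exact: measurable_funB.
  - by apply: measurable_funM => //; exact: measurable_funX.
  - apply: measurable_funD; apply: measurable_funM => //; exact: measurable_funX.
  - by move=> x _; rewrite sqr_ge0.
  - by move=> x _; rewrite mulr_ge0// sqr_ge0.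
  - by move=> x _; rewrite addr_ge0// mulr_ge0// sqr_ge0.
  - move=> x _.
    have E : convol (r N) (moll k) x = convol f (moll k) x - convol (t N) (moll k) x.
      by rewrite (convB _ If It (@moll_test R n k)).
    set A := convol (r N) (moll k) x in E *.
    set C := convol (t N) (moll k) x in E *.
    have -> : convol f (moll k) x - f x = A + (C - t N x) - r N x.
      by rewrite E /r; ring.
    have C2 : (C - t N x) ^+ 2 <= 2 * N%:R * `|C - t N x|.
      rewrite -(real_normK (num_real (C - t N x))) expr2 ler_wpM2r//.
      rewrite (le_trans (ler_normB _ _))// mulr_natl mulr2n lerD//.
      exact: conv_moll_bounded.
    set u := C - t N x in C2 *; set w := r N x.
    have h1 := sqr_ge0 (A - u); have h2 := sqr_ge0 (A + w); have h3 := sqr_ge0 (u + w).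
    nra.
have -> : e%:E = ((3 * (e / 12))%:E + ((3 * (e / 12))%:E + (6 * (e / 12))%:E))%E.
  by rewrite -!EFinD; congr EFin; field.
apply: leeD.
  rewrite ge0_integralZ_fin//; last 2 first.
  - exact: measurable_funX.
  - by move=> x _; rewrite sqr_ge0.
  rewrite EFinM lee_wpmul2l ?lee_fin//.
  by apply: le_trans rN; exact: conv_moll_L2_le.
apply: (@le_trans _ _ (\int[leb n]_x (3 * r N x ^+ 2)%:E +
   \int[leb n]_x (6 * N%:R * `|convol (t N) (moll k) x - t N x|)%:E)%E).
  apply: ge0_integral_le_add => //.
  - apply: measurable_funD; apply: measurable_funM => //; exact: measurable_funX.
  - by apply: measurable_funM => //; exact: measurable_funX.
  - exact: measurable_funM.
  - by move=> x _; rewrite addr_ge0// mulr_ge0// sqr_ge0.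
  - by move=> x _; rewrite mulr_ge0// sqr_ge0.
apply: leeD.
  rewrite ge0_integralZ_fin//; last 2 first.
  - exact: measurable_funX.
  - by move=> x _; rewrite sqr_ge0.
  by rewrite EFinM lee_wpmul2l ?lee_fin.
rewrite ge0_integralZ_fin//.
apply: (@le_trans _ _ ((6 * N%:R)%:E * (e / 12 / (N%:R + 1))%:E)%E).
  by rewrite lee_wpmul2l ?lee_fin.
rewrite -EFinM lee_fin -mulrA ler_wpM2l//.
rewrite mulrCA ler_piMr ?(ltW e12)// ler_pdivrMr ?mul1r ?lerDl// ltr_wpDl//.
Unshelve. all: by end_near. Qed.

End L2_tools.

Section weak_derivatives.
Context {R : realType} {n : nat}.
Implicit Types (f g h phi : 'rV[R]_n -> R) (x y a : 'rV[R]_n) (k : nat)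
  (B D : set 'rV[R]_n) (i : 'I_n) (r : R).

Lemma L1_L1loc B f : measurable B -> L1 B f -> L1loc B f.
Proof.
move=> mB If; split; first exact: L1_measurable.
move=> K KB cK; have : L1 K f.
  by apply: integrableS If => //; exact: compact_rv_measurable.
by case/integrableP.
Qed.

Lemma L1loc_test B f phi : measurable B -> L1loc B f -> test_function B phi ->
  L1 B (fun x => f x * phi x).
Proof.
move=> mB [mf fK] tphi; have [sphi [K [cK KB phiK]]] := tphi.
have mK := compact_rv_measurable cK.
have IK : L1 K f.
  apply/integrableP; split; last exact: fK.
  by apply/measurable_EFinP; exact: measurable_funS mf.
have IfK : L1 K (fun x => f x * phi x) by apply: L1_bm => //; exact: bm_test tphi.
apply/integrableP; split.
  apply/measurable_EFinP; apply: measurable_funM => //.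
  exact: test_function_measurable tphi.
case/integrableP: IfK => _; congr (_ < _)%E => /=.
apply/esym/(@ge0_integral_eq0_off _ _ R (leb n) B K (fun x => `|f x * phi x|)) => //.
by move=> x _ /phiK ->; rewrite mulr0 normr0.
Qed.

Lemma moll_reflect_test k x B : ecball x k.+1%:R^-1 `<=` B ->
  test_function B (fun y => moll k (x - y)).
Proof.
move=> xB; split.
  have := smooth_affine (-1) x (@moll_smooth R n k).
  by congr smooth; apply/funext => y; rewrite scaleN1r addrC.
exists (ecball x k.+1%:R^-1); split => //; first exact: ecball_compact.
by move=> y /negP; rewrite -ltNge enormB => /ltW; exact: moll_eq0.
Qed.

Lemma moll_reflect_derive k x i y :
  'D_(unitv R i) (fun y => moll k (x - y)) y = - 'D_(unitv R i) (moll k) (x - y).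
Proof.
have -> : (fun y => moll k (x - y)) = (fun y => moll k (-1 *: y + x)).
  by apply/funext => z; rewrite scaleN1r addrC.
have [_ ->] := derive_affine i (-1) x y (@moll_smooth R n k).
by rewrite scaleN1r [- y + x]addrC mulN1r.
Qed.

Lemma ecball_sub_eball a r x d : enorm (x - a) + d < r ->
  ecball x d `<=` eball a r.
Proof.
move=> xr y yx; rewrite /eball/=; apply: le_lt_trans xr.
rewrite -[y - a](subrKA x) (le_trans (enorm_triangle _ _))// addrC.
by rewrite lerD2l.
Qed.

Lemma Rintegral_patch B D f : measurable B -> measurable D -> D `<=` B ->
  (forall x, B x -> ~ D x -> f x = 0) ->
  \int[leb n]_(x in B) f x = \int[leb n]_(x in D) f x.
Proof.
move=> mB mD DB f0; rewrite /Rintegral; congr fine.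
rewrite integral_mkcond [RHS]integral_mkcond; apply: eq_integral => x _.
rewrite !patchE; have [Ex|Ex] := pselect (D x).
  by rewrite (mem_set Ex) (mem_set (DB _ Ex)).
rewrite (memNset Ex); case: ifPn => //; rewrite inE => Bx.
by rewrite f0.
Qed.

Lemma L1_patch D f : measurable D -> L1 D f -> L1 setT (f \_ D).
Proof.
move=> mD; rewrite integrable_mkcond//.
apply: eq_integrable => // x _ /=; rewrite !patchE.
by case: ifPn.
Qed.

(** Mollifying at [x] is pairing with the test function [moll k (x - y)], so the mollifications of
    [h] vanish away from the boundary; they also converge to [h] in L^1 there. Since [h] is only
    locally integrable, it is first restricted to an intermediate closed ball. *)
Lemma du_Bois_Reymond a r h : L1loc (eball a r) h ->
  (forall phi, test_function (eball a r) phi ->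
    \int[leb n]_(x in eball a r) (h x * phi x) = 0) ->
  {ae leb n, forall x, eball a r x -> h x = 0}.
Proof.
move=> [mh hK] H.
have mB r' : measurable (eball a r') by exact: measurable_eball.
suff H0 rho : rho < r -> {ae leb n, forall x, eball a rho x -> h x = 0}.
  have : {ae leb n, forall x, forall j, eball a (r - j.+1%:R^-1) x -> h x = 0}.
    apply: ae_foralln => j; apply: H0.
    by rewrite ltrBlDr ltrDl invr_gt0 ltr0n.
  apply: filterS => x hx xB.
  have d0 : 0 < r - enorm (x - a) by rewrite subr_gt0.
  have [j _ /(_ j (leqnn j)) jd] := near_infty_natSinv_lt (PosNum d0).
  have {}jd : j.+1%:R^-1 < r - enorm (x - a) by exact: jd.
  by apply: (hx j); rewrite /eball/= ltrBrDr -ltrBrDl.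
(* For [1/(k+1) < rho' - rho] the mollifier centred in the ball of radius [rho] sees only the ball
   of radius [rho'], where [h] and its restriction agree. *)
move=> rhor; pose rho' := (rho + r) / 2.
pose K : set 'rV[R]_n := ecball a rho'.
have KB : K `<=` eball a r.
  by move=> y; rewrite /K /ecball /eball /rho'/= => h1; lra.
have cK : compact K by exact: ecball_compact.
have mK : measurable K by exact: compact_rv_measurable.
have IK : L1 K h.
  apply/integrableP; split; last exact: hK.
  by apply/measurable_EFinP; exact: measurable_funS mh.
pose h' := h \_ K.
have Ih' : L1 setT h' by exact: L1_patch.
have h'0 y : ~ K y -> h' y = 0 by move=> yK; rewrite /h' patchE memNset.
have h'1 y : K y -> h' y = h y by move=> yK; rewrite /h' patchE mem_set.
have rhoK : eball a rho `<=` K.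
  by move=> y; rewrite /K /ecball /eball /rho'/= => h1; lra.
have h'off x : rho' + enorm a < enorm x -> h' x = 0.
  move=> xr; apply: h'0; apply/negP; rewrite -ltNge.
  have := enorm_dist x a; have := ler_norm (enorm x - enorm a); lra.
have mh' : measurable_fun setT h' by exact: L1_measurable.
have small (e : R) : 0 < e -> (\int[leb n]_(x in eball a rho) `|h x|%:E <= e%:E)%E.
  move=> e0.
  have d0 : 0 < rho' - rho by rewrite /rho'; lra.
  have [k _ /(_ k (leqnn k)) [k1 k2]] :=
    filterI (moll_L1 Ih' h'off e0) (near_infty_natSinv_lt (PosNum d0)).
  have {}k2 : k.+1%:R^-1 < rho' - rho by exact: k2.
  apply: le_trans k1.
  rewrite (eq_integral (fun x => `|convol h' (moll k) x - h' x|%:E)); last first.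
    move=> x /set_mem xB.
    have tx : test_function (eball a r) (fun y => moll k (x - y)).
      apply: moll_reflect_test; apply: ecball_sub_eball.
      move: k2 xB; rewrite /eball/= /rho'; set dk := k.+1%:R^-1; lra.
    have -> : convol h' (moll k) x = 0.
      rewrite -(H _ tx) /convol (@Rintegral_patch setT K)//; last first.
        by move=> y _ yK; rewrite h'0// mul0r.
      rewrite (@Rintegral_patch (eball a r) K)//; last first.
        move=> y _ /negP; rewrite -ltNge => yK; rewrite moll_eq0 ?mulr0//.
        have : enorm (y - a) <= enorm (x - y) + enorm (x - a).
          rewrite -[y - a](subrKA x) (enormB x y); exact: enorm_triangle.
        move: k2 xB yK; rewrite /eball/=; set dk := k.+1%:R^-1; lra.
      by apply: eq_Rintegral => y /set_mem yK; rewrite h'1.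
    by rewrite sub0r normrN h'1//; exact: rhoK.
  apply: ge0_subset_integral => //.
  by apply/measurable_EFinP/measurable_norm; apply: measurable_funB => //; exact: conv_measurable.
have : (\int[leb n]_(x in eball a rho) `|(h x)%:E| = 0)%E.
  apply/eqP; rewrite eq_le integral_ge0// andbT; apply/lee_addgt0Pr => e e0.
  by rewrite add0e; exact: small.
have mhrho : measurable_fun (eball a rho) (EFin \o h).
  apply/measurable_EFinP; apply: measurable_funS mh => //.
  by move=> y /rhoK /KB.
move=> /(ae_eq_integral_abs (leb n) (mB rho) mhrho).1; apply: filterS => x hx xB.
by have [] := hx xB.
Qed.

Lemma weak_partial_unique a r i f g g' :
  weak_partial (eball a r) i f g -> weak_partial (eball a r) i f g' ->
  {ae leb n, forall x, eball a r x -> g x = g' x}.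
Proof.
set B := eball a r.
move=> [Lf Lg Hg] [_ Lg' Hg'].
have mB : measurable B by exact: measurable_eball.
have : {ae leb n, forall x, B x -> g x - g' x = 0}.
  apply: du_Bois_Reymond.
    have [mg gK] := Lg; have [mg' g'K] := Lg'; split; first exact: measurable_funB.
    move=> K KB cK; have mK := compact_rv_measurable cK.
    apply: (@le_lt_trans _ _ (\int[leb n]_(x in K) `|g x|%:E + \int[leb n]_(x in K) `|g' x|%:E)%E).
      apply: ge0_integral_le_add => //; try apply: measurable_norm.
      - by apply: measurable_funB; [exact: measurable_funS mg|exact: measurable_funS mg'].
      - exact: measurable_funS mg.
      - exact: measurable_funS mg'.
      - by move=> x _; exact: ler_normB.
    by apply: lte_add_pinfty; [exact: gK|exact: g'K].
  move=> phi tphi.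
  have E := Hg _ tphi; have E' := Hg' _ tphi.
  have -> : \int[leb n]_(x in B) ((g x - g' x) * phi x) =
     \int[leb n]_(x in B) (g x * phi x - g' x * phi x).
    by apply: eq_Rintegral => x _; rewrite mulrBl.
  rewrite RintegralB//; [|exact: L1loc_test|exact: L1loc_test].
  by apply/eqP; rewrite subr_eq0 -eqr_opp -E -E'.
by apply: filterS => x hx /hx/eqP; rewrite subr_eq0 => /eqP.
Qed.

Lemma wD_weak_partial B i f g : weak_partial B i f g -> weak_partial B i f (wD B i f).
Proof.
move=> wfg; rewrite /wD.
exact: (@xgetPex _ (cst 0) [set g | weak_partial B i f g] (ex_intro _ g wfg)).
Qed.

(** Lets any explicit weak derivative replace the chosen representative [wD] under an integral. *)
Lemma wD_ae a r i f g : weak_partial (eball a r) i f g ->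
  {ae leb n, forall x, eball a r x -> wD (eball a r) i f x = g x}.
Proof. by move=> wfg; exact: weak_partial_unique (wD_weak_partial wfg) wfg. Qed.

Lemma sqrL2_wD a r i f g : weak_partial (eball a r) i f g ->
  sqrL2 (eball a r) (wD (eball a r) i f) = sqrL2 (eball a r) g.
Proof.
move=> wfg; have mB := @measurable_eball R n a r.
have [_ [mg _] _] := wfg; have [_ [mg' _] _] := wD_weak_partial wfg.
apply: ae_eq_integral => //.
- by apply/measurable_EFinP; exact: measurable_funX.
- by apply/measurable_EFinP; exact: measurable_funX.
- by apply: filterS (wD_ae wfg) => x H Bx; rewrite H.
Qed.

End weak_derivatives.

(** * Integration by parts and derivatives of mollifications *)

Section integration_by_parts.
Context {R : realType} {n : nat}.
Implicit Types (f g h phi psi : 'rV[R]_n -> R) (x y a : 'rV[R]_n) (k : nat)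
  (B D K : set 'rV[R]_n) (i : 'I_n) (r : R).

Lemma Rintegral_dist_le D f g (e : R) : measurable D -> L1 D f -> L1 D g ->
  (\int[leb n]_(x in D) `|f x - g x|%:E <= e%:E)%E ->
  `|\int[leb n]_(x in D) f x - \int[leb n]_(x in D) g x| <= e.
Proof.
move=> mD If Ig fge; rewrite -RintegralB//.
rewrite (le_trans (le_normr_Rintegral mD (L1B mD If Ig)))//.
rewrite -lee_fin; apply: le_trans fge; rewrite /Rintegral fineK//.
exact: (integrable_fin_num mD (L1_norm mD (L1B mD If Ig))).
Qed.

Lemma integral_translate a (f : 'rV[R]_n -> \bar R) :
  measurable_fun setT f -> (leb n).-integrable setT f ->
  (\int[leb n]_y f (y + a)%R = \int[leb n]_y f y)%E.
Proof.
move=> mf If.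
have mN : measurable_fun setT (fun y : 'rV[R]_n => f (0 - y)).
  have := measurableT_comp mf (measurable_affine_rv (-1) (0 : 'rV[R]_n)).
  by congr measurable_fun; apply/funext => y /=; rewrite scaleN1r addrC.
have IN : (leb n).-integrable setT (fun y : 'rV[R]_n => f (0 - y)).
  apply/integrableP; split => //; have /integrableP[_] := If; congr (_ < _)%E.
  rewrite (@ge0_integral_affine R n (-1) 0 (fun y => `|f y|%E))//; last exact: measurableT_comp.
  rewrite normrN1 expr1n mul1e; apply: eq_integral => y _.
  by rewrite scaleN1r addrC.
rewrite -[RHS](integral_reflect 0 mf If).
rewrite -[RHS](integral_reflect (- a) mN IN).
by apply: eq_integral => y _; rewrite sub0r opprB opprK.
Qed.

Lemma compact_sub_ball K : compact K -> exists rho : R, K `<=` ecball 0 rho.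
Proof.
move=> /compact_bounded[M [_ HM]]; exists (n%:R * (M + 1)) => x Kx.
rewrite /ecball/= subr0 (le_trans (enorm_le_norm x))// ler_wpM2l//.
by apply: (HM (M + 1)) => //; rewrite ltrDl.
Qed.

(** Difference quotients have integral zero by translation invariance; they are bounded by the bound
    on the derivative, supported in a fixed ball, and converge to the derivative. *)
Lemma integral_derive_eq0 psi K i : compact K ->
  (forall x, ~ K x -> psi x = 0) -> continuous psi ->
  (forall x, derivable psi x (unitv R i)) ->
  (exists M, forall x, `|'D_(unitv R i) psi x| <= M) ->
  L1 setT (fun x => 'D_(unitv R i) psi x) /\
  \int[leb n]_x 'D_(unitv R i) psi x = 0.
Proof.
move=> cK psiK cpsi dpsi [M dM].
have [M' _ psiM'] := compact_support_bounded cK cpsi psiK.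
have mpsi : measurable_fun setT psi by exact: continuous_measurable_rv.
have [rho Krho] := compact_sub_ball cK.
have psi0 x : rho < enorm x -> psi x = 0.
  move=> xr; apply: psiK => /Krho; rewrite /ecball/= subr0; apply/negP.
  by rewrite -ltNge.
have Ipsi : L1 setT psi by exact: (L1_of_bounded mpsi psiM' psi0).
(* The shifts [unitv i / (k+1)] have Euclidean norm at most [n], by comparison with the sup norm;
   this ball contains the supports of all difference quotients. *)
pose X : set 'rV[R]_n := ecball 0 (rho + n%:R).
have mX : measurable X by apply: closed_rv_measurable; exact: ecball_closed.
have fX : (leb n X < +oo)%E by apply: leb_bounded_lty => //; exact: ecball_bounded.
pose q k x := k.+1%:R * (psi (x + k.+1%:R^-1 *: unitv R i) - psi x).
have mtr k : measurable_fun setT (fun x => psi (x + k.+1%:R^-1 *: unitv R i)).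
  have := measurableT_comp mpsi (measurable_affine_rv 1 (k.+1%:R^-1 *: unitv R i)).
  by congr measurable_fun; apply/funext => x /=; rewrite scale1r.
have psitr0 k x : rho + n%:R < enorm x -> psi (x + k.+1%:R^-1 *: unitv R i) = 0.
  move=> xr; apply: psi0.
  set v := k.+1%:R^-1 *: unitv R i.
  have : enorm v <= n%:R.
    rewrite (le_trans (enorm_le_norm v))// normrZ norm_unitv mulr1 ler_piMr//.
    by rewrite ger0_norm ?invr_ge0// invf_le1// ler1n.
  have := enorm_dist x (x + v); rewrite opprD addrA subrr sub0r enormN.
  have := ler_norm (enorm x - enorm (x + v)); lra.
have mq k : measurable_fun setT (q k).
  by apply: measurable_funM => //; exact: measurable_funB.
have qM k x : `|q k x| <= M.
  have := @bounded_derive_lipschitz R (fun s => psi (s *: unitv R i + x))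
    (fun s => 'D_(unitv R i) psi (s *: unitv R i + x)) M
    (fun t => is_derive_line (derivableP (dpsi _))) (fun t => dM _) 0 k.+1%:R^-1.
  rewrite scale0r add0r subr0 [X in psi X - _]addrC /q normrM => H.
  rewrite (ger0_norm (ler0n _ _)) -ler_pdivlMl// mulrC.
  by rewrite (le_trans H)// ger0_norm ?invr_ge0.
have qcvg x : q ^~ x @ \oo --> 'D_(unitv R i) psi x.
  have := dpsi x; rewrite /derivable => /cvg_ex[l Hl].
  have -> : 'D_(unitv R i) psi x = l by exact: cvg_lim Hl.
  have E : q ^~ x = (fun h : R => h^-1 *: (psi (h *: unitv R i + x) - psi x)) \o
    (fun k => k.+1%:R^-1).
    by apply/funext => k; rewrite /q /= invrK [_ + x]addrC.
  rewrite E; apply: cvg_comp Hl.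
  move=> A /nbhs_ballP[e /= e0 He].
  have [N _ HN] := near_infty_natSinv_lt (PosNum e0).
  exists N => // k Nk /=; apply: He; last by rewrite invr_eq0 pnatr_eq0.
  rewrite /ball/= sub0r normrN ger0_norm ?invr_ge0//; exact: (HN k Nk).
have [||||mD H] := @dct_abs _ _ R (leb n) X q (fun x => 'D_(unitv R i) psi x)
  (cst M) mX.
- by move=> k; exact: measurable_funTS.
- by move=> x _; exact: qcvg.
- exact: L1_cst.
- by move=> k x _; exact: qM.
have Dpsi0 x : ~ X x -> 'D_(unitv R i) psi x = 0.
  move=> /negP; rewrite -ltNge subr0 => xr.
  apply: (@derive_support _ _ psi (ecball 0 rho)).
  - exact: ecball_closed.
  - by move=> y /negP; rewrite -ltNge subr0; exact: psi0.
  - by apply/negP; rewrite -ltNge subr0 (le_lt_trans _ xr)// lerDl.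
have ID : L1 setT (fun x => 'D_(unitv R i) psi x).
  apply: (@bounded_integrable _ _ _ X M) => //; last exact: ecball_bounded.
  apply: (measurable_fun_cvg (h := q)) => //.
split => //.
have Iq k : L1 setT (q k).
  apply: (@L1_of_bounded _ _ _ (rho + n%:R) M) => // x xr.
  by rewrite /q psitr0// psi0 ?subrr ?mulr0// (le_lt_trans _ xr)// lerDl.
have Itr k : L1 setT (fun x => psi (x + k.+1%:R^-1 *: unitv R i)).
  by apply: (@L1_of_bounded _ _ _ (rho + n%:R) M') => //; exact: psitr0.
have q0 k : \int[leb n]_x q k x = 0.
  rewrite /q RintegralZl//; last exact: L1B.
  rewrite RintegralB// {1}/Rintegral.
  rewrite (@integral_translate _ (EFin \o psi))//; last exact/measurable_EFinP.
  by rewrite subrr mulr0.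
apply/eqP; rewrite -normr_le0; apply/ler_addgt0Pr => e e0; rewrite add0r.
have [k _ /(_ k (leqnn k)) Hk] := H e e0.
rewrite -[X in `|X|]subr0 -(q0 k) distrC; apply: Rintegral_dist_le => //.
rewrite (@ge0_integral_eq0_off _ _ _ (leb n) setT X)// => x _ xX.
have xX' : rho + n%:R < enorm x by move/negP: xX; rewrite -ltNge subr0.
rewrite Dpsi0// /q psitr0// psi0 ?subrr ?mulr0 ?subrr ?normr0//.
by rewrite (le_lt_trans _ xX')// lerDl.
Qed.

(** The product of [f] with a test function has compact support, so the integral of its derivative
    vanishes; expand by Leibniz. *)
Lemma weak_partial_C1 B i f : open B -> continuous f ->
  (forall x, derivable f x (unitv R i)) ->
  continuous (fun x => 'D_(unitv R i) f x) ->
  weak_partial B i f (fun x => 'D_(unitv R i) f x).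
Proof.
move=> oB cf df cdf; have mB := open_rv_measurable oB.
have Lc h : continuous h -> L1loc B h.
  move=> ch; have mh : measurable_fun setT h by exact: continuous_measurable_rv.
  split; first exact: measurable_funTS.
  move=> K KB cK.
  have cnh : {within K, continuous (fun x => `|h x|)}.
    apply: continuous_subspaceT => x.
    by apply: (@cvg_norm _ _ _ (nbhs x)); exact: ch.
  have [->|/set0P K0] := eqVneq K set0; first by rewrite integral_set0.
  have [c Kc hc] := EVT_max_rV K0 cK cnh.
  have mK := compact_rv_measurable cK.
  have fK : (leb n K < +oo)%E.
    by apply: leb_bounded_lty => //; exact: compact_bounded.
  have : L1 K h.
    apply: measurable_bounded_integrable => //; first exact: measurable_funTS.
    exists `|h c|; split; first by rewrite num_real.
    by move=> N hN x Kx /=; rewrite (le_trans _ (ltW hN))// hc// inE.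
  by case/integrableP.
split; [exact: Lc|exact: Lc|].
move=> phi tphi; have [sphi [K [cK KB phiK]]] := tphi.
have dphi x : derivable phi x (unitv R i) by exact: smooth_derivable.
pose psi x := f x * phi x.
have dpsiE x : is_derive x (unitv R i) psi
    (f x * 'D_(unitv R i) phi x + phi x * 'D_(unitv R i) f x).
  by apply: is_deriveM; exact: derivableP.
have Dpsi x : 'D_(unitv R i) psi x =
    f x * 'D_(unitv R i) phi x + phi x * 'D_(unitv R i) f x.
  by have [_ ->] := dpsiE x.
have cpsi : continuous psi.
  by move=> x; apply: (@cvgM _ _ (nbhs x)); [exact: cf|exact: smooth_continuous].
have psiK x : ~ K x -> psi x = 0 by move=> /phiK; rewrite /psi => ->; rewrite mulr0.
have clK : closed K by exact: compact_closed.
have cDpsi : continuous (fun x => 'D_(unitv R i) psi x).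
  rewrite (funext Dpsi) => x; apply: (@cvgD _ _ _ (nbhs x)).
    by apply: (@cvgM _ _ (nbhs x)); [exact: cf|exact: smooth_derive_continuous].
  by apply: (@cvgM _ _ (nbhs x)); [exact: smooth_continuous|exact: cdf].
have Dpsi0 := derive_support i clK psiK.
have [M _ HM] := compact_support_bounded cK cDpsi Dpsi0.
have [|_ H] := integral_derive_eq0 cK psiK cpsi (fun x => (dpsiE x).(ex_derive)).
  by exists M.
have tdphi := test_function_derive i tphi.
apply/eqP; rewrite -subr_eq0 opprK; apply/eqP.
rewrite -RintegralD//; [|by apply: L1loc_test => //; exact: Lc|by apply: L1loc_test => //; exact: Lc].
rewrite -H (@Rintegral_patch _ _ setT B)//.
- by apply: eq_Rintegral => x _; rewrite Dpsi [phi x * _]mulrC.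
- by move=> x _ xB; apply: Dpsi0 => /KB.
Qed.

(** The reflected mollifier is a test function of [B], so the definition of the weak derivative
    applies; reflection changes the sign of its derivative and cancels the minus sign. *)
Lemma convol_weak_derive B i f g k x : open B -> weak_partial B i f g ->
  L1 B f -> L1 B g -> ecball x k.+1%:R^-1 `<=` B ->
  'D_(unitv R i) (convol (f \_ B) (moll k)) x = convol (g \_ B) (moll k) x.
Proof.
move=> oB [_ _ H] If Ig xB; have mB := open_rv_measurable oB.
have [_ ->] := conv_is_derive i x (L1_patch mB If) (@moll_test R n k).
have tx := moll_reflect_test xB.
have := H _ tx => {}H.
rewrite /convol (@Rintegral_patch _ _ setT B)//; last first.
  by move=> y _ yB; rewrite patchE memNset// mul0r.
rewrite [RHS](@Rintegral_patch _ _ setT B)//; last first.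
  by move=> y _ yB; rewrite patchE memNset// mul0r.
rewrite [RHS](_ : _ = \int[leb n]_(y in B) (g y * moll k (x - y))); last first.
  by apply: eq_Rintegral => y By; rewrite patchE By.
rewrite -[RHS]opprK -H.
rewrite [LHS](_ : _ = \int[leb n]_(y in B)
    (-1 * (f y * 'D_(unitv R i) (fun y => moll k (x - y)) y))); last first.
  apply: eq_Rintegral => y By; rewrite patchE By moll_reflect_derive.
  by rewrite mulrN mulN1r opprK.
rewrite RintegralZl ?mulN1r//.
apply: L1_bm => //; apply: (@bm_test _ _ B B).
exact: test_function_derive.
Qed.

End integration_by_parts.

(** * Chain rule *)

Section chain_rule.
Context {R : realType} {n : nat}.
Implicit Types (f g h phi : 'rV[R]_n -> R) (x y a : 'rV[R]_n) (k : nat)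
  (B D K : set 'rV[R]_n) (i : 'I_n) (r : R).

Lemma compact_sub_concentric a r K : compact K -> K `<=` eball a r ->
  exists2 rho, rho < r & K `<=` ecball a rho.
Proof.
move=> cK KB; have [->|/set0P K0] := eqVneq K set0.
  by exists (r - 1) => //; rewrite ltrBlDr ltrDl.
have cf : {within K, continuous (fun x => enorm (x - a))}.
  apply: continuous_subspaceT => x.
  apply: (@continuous_comp _ _ _ (fun x => x - a) (@enorm R n)).
    by apply: (@cvgB _ _ _ (nbhs x)) => //; exact: cvg_cst.
  exact: enorm_continuous.
have [c Kc hc] := EVT_max_rV K0 cK cf.
exists (enorm (c - a)); first by apply: KB; rewrite inE in Kc.
by move=> x /mem_set /hc.
Qed.

Lemma segment_bounded (F : R -> R) (M : R) : continuous F ->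
  exists2 C, 0 <= C & forall t, `|t| <= M -> `|F t| <= C.
Proof.
move=> cF; have [M0|M0] := leP 0 M; last first.
  by exists 0 => // t tM; have := normr_ge0 t; lra.
have cn : {within `[- M, M], continuous (fun t => `|F t|)}.
  apply: continuous_subspaceT => t.
  by apply: (@cvg_norm _ _ _ (nbhs t)); exact: cF.
have [|c _ hc] := EVT_max _ cn; first by rewrite ge0_cp.
exists `|F c| => // t tM; apply: hc.
by rewrite in_itv/= -ler_norml.
Qed.

(** For the mollifications the rule is classical. In the limit [f_k] converges pointwise by
    continuity of [f] and stays below [M], which makes [F] and [dF] bounded along the sequence,
    while the gradients converge in L^1. *)
Lemma weak_chain a r i f g (F dF : R -> R) (M : R) :
  (forall x, eball a r x -> {for x, continuous f}) ->
  (forall x, eball a r x -> `|f x| <= M) ->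
  weak_partial (eball a r) i f g -> L1 (eball a r) g ->
  (forall t : R, is_derive t 1 F (dF t)) -> continuous dF ->
  weak_partial (eball a r) i (fun x => F (f x)) (fun x => dF (f x) * g x).
Proof.
set B := eball a r => cf fM wfg Ig dFE cdF.
have oB : open B by exact: eball_open.
have mB : measurable B by exact: measurable_eball.
have fB : (leb n B < +oo)%E by exact: leb_eball_lty.
have cF := derivable_continuous1 dFE.
have [CF CF0 HCF] := segment_bounded M cF.
have [Cd Cd0 HCd] := segment_bounded M cdF.
have mcomp (G : R -> R) : continuous G -> measurable_fun B (fun x => G (f x)).
  move=> cG; apply: open_continuous_measurable_rv => // x Bx.
  by apply: (@continuous_comp _ _ _ f G); [exact: cf|exact: cG].
have mf : measurable_fun B f.
  by apply: open_continuous_measurable_rv => // x Bx; exact: cf.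
have mg := L1_measurable Ig.
have bB h (C : R) : measurable_fun B h -> (forall x, B x -> `|h x| <= C) -> L1 B h.
  move=> mh hC; apply: measurable_bounded_integrable => //.
  exists C; split; first by rewrite num_real.
  by move=> N hN x Bx /=; rewrite (le_trans _ (ltW hN))// hC.
have If : L1 B f by exact: bB fM.
have IFf : L1 B (fun x => F (f x)).
  by apply: (bB _ CF); [exact: mcomp|move=> x Bx; exact/HCF/fM].
have bd : bm B (fun x => dF (f x)).
  by split; [exact: mcomp|exists Cd => x Bx; exact/HCd/fM].
have Idg : L1 B (fun x => dF (f x) * g x).
  have := L1_bm mB Ig bd; apply: eq_integrable => // x _ /=.
  by rewrite mulrC.
split; [exact: L1_L1loc|exact: L1_L1loc|].
move=> phi tphi; have [sphi [K [cK KB phiK]]] := tphi.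
have tdphi := test_function_derive i tphi.
have [Cp Cp0 HCp] := test_function_bounded tphi.
have [Cq Cq0 HCq] := test_function_bounded tdphi.
have [rho rhor Krho] := compact_sub_concentric cK KB.
pose fk k := convol (f \_ B) (moll k); pose gk k := convol (g \_ B) (moll k).
have IfT := L1_patch mB If; have IgT := L1_patch mB Ig.
have M0 x : B x -> 0 <= M by move=> /fM; exact: le_trans.
have fkM k x : B x -> `|fk k x| <= M.
  move=> Bx; apply: conv_moll_bounded => // y; rewrite patchE.
  case: ifPn => [/set_mem|_]; first exact: fM.
  by rewrite normr0 (M0 _ Bx).
have sfk k : smooth (fk k) by exact: conv_smooth (@moll_test R n k).
have cfk k : continuous (fk k) by exact: smooth_continuous.
have fk_cvg x : B x -> fk ^~ x @ \oo --> f x.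
  move=> Bx; rewrite (_ : f x = (f \_ B) x); last by rewrite patchE mem_set.
  apply: conv_moll_cvg => //.
  have fBx : (f \_ B) x = f x by rewrite patchE mem_set.
  have H : (f \_ B) @ nbhs x --> (f \_ B) x.
    rewrite fBx; apply: cvg_trans (cf x Bx); apply: near_eq_cvg.
    have : nbhs x B by exact: open_nbhs_nbhs.
    by apply: filterS => y By; rewrite patchE mem_set.
  exact: H.
have mfk k (G : R -> R) : continuous G -> measurable_fun B (fun x => G (fk k x)).
  move=> cG; apply: measurable_funTS; apply: continuous_measurable_rv => x.
  by apply: (@continuous_comp _ _ _ (fk k) G); [exact: cfk|exact: cG].
have mgk k : measurable_fun B (gk k) by exact: conv_measurable.
have mphi : measurable_fun B phi by exact: test_function_measurable tphi.
have mdphi : measurable_fun B (fun x => 'D_(unitv R i) phi x).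
  exact: test_function_measurable tdphi.
pose P := \int[leb n]_(x in B) (F (f x) * 'D_(unitv R i) phi x).
pose Q := \int[leb n]_(x in B) (dF (f x) * g x * phi x).
pose Pk k := \int[leb n]_(x in B) (F (fk k x) * 'D_(unitv R i) phi x).
pose Qk k := \int[leb n]_(x in B) (dF (fk k x) * gk k x * phi x).
have IPk k : L1 B (fun x => F (fk k x) * 'D_(unitv R i) phi x).
  apply: L1_bm => //; last exact: bm_test tdphi.
  by apply: (bB _ CF); [exact: mfk|move=> x Bx; exact/HCF/fkM].
have Igk k : L1 B (gk k).
  have I : L1 setT (gk k).
    apply/integrableP; split.
      by apply/measurable_EFinP; exact: conv_measurable.
    apply: (le_lt_trans (conv_moll_L1_le k IgT)).
    by case/integrableP: IgT.
  by apply: integrableS I.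
have IQk k : L1 B (fun x => dF (fk k x) * gk k x * phi x).
  apply: L1_bm => //; last exact: bm_test tphi.
  have bdk : bm B (fun x => dF (fk k x)).
    by split; [exact: mfk|exists Cd => x Bx; exact/HCd/fkM].
  by have := L1_bm mB (Igk k) bdk; apply: eq_integrable => // x _ /=; rewrite mulrC.
have IP : L1 B (fun x => F (f x) * 'D_(unitv R i) phi x).
  by apply: L1_bm => //; exact: bm_test tdphi.
have IQ : L1 B (fun x => dF (f x) * g x * phi x).
  by apply: L1_bm => //; exact: bm_test tphi.
(* The gradient of the mollification equals the mollified gradient only at distance more than
   [1/(k+1)] from the boundary; the support of [phi] lies there for large [k]. *)
have PQk : \forall k \near \oo, Pk k = - Qk k.
  have d0 : 0 < r - rho by rewrite subr_gt0.
  near=> k.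
  have kd : k.+1%:R^-1 < r - rho.
    by near: k; exact: (near_infty_natSinv_lt (PosNum d0)).
  have dfk x : is_derive x (unitv R i) (fun x => F (fk k x))
      (dF (fk k x) * 'D_(unitv R i) (fk k) x).
    apply: line_is_derive.
    have h := is_derive_line (derivableP (@smooth_derivable _ _ _ i (0 *: unitv R i + x) (sfk k))).
    have := @is_derive1_comp R F (fun s => fk k (s *: unitv R i + x)) 0 _ _ (dFE _) h.
    by rewrite scale0r add0r.
  have cdfk : continuous (fun x => dF (fk k x) * 'D_(unitv R i) (fk k) x).
    move=> x; apply: (@cvgM _ _ (nbhs x)); last exact: smooth_derive_continuous.
    by apply: (@continuous_comp _ _ _ (fk k) dF); [exact: cfk|exact: cdF].
  have cFfk : continuous (fun x => F (fk k x)).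
    by move=> x; apply: (@continuous_comp _ _ _ (fk k) F); [exact: cfk|exact: cF].
  have DE : (fun x => 'D_(unitv R i) (fun x => F (fk k x)) x) =
      (fun x => dF (fk k x) * 'D_(unitv R i) (fk k) x).
    by apply/funext => x; have [_ ->] := dfk x.
  have [|_ _ H] := @weak_partial_C1 R n B i (fun x => F (fk k x)) oB cFfk
     (fun x => (dfk x).(ex_derive)); first by rewrite DE.
  rewrite /Pk H//; congr (- _).
  apply: eq_Rintegral => x /set_mem Bx; have [_ ->] := dfk x.
  have [Kx|Kx] := pselect (K x); last by rewrite phiK// !mulr0.
  congr (_ * _ * _).
  apply: (convol_weak_derive oB wfg If Ig).
  apply: ecball_sub_eball; have := Krho _ Kx; rewrite /ecball/= => h.
  by rewrite -ltrBrDl (lt_le_trans kd)// lerD2l lerN2.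
apply/eqP; rewrite -subr_eq0 opprK -normr_le0; apply/eqP.
apply/eqP/ler_addgt0Pr => e e0; rewrite add0r.
have e4 : 0 < e / 4 by rewrite divr_gt0.
have [||||_ HP] := @dct_abs _ _ R (leb n) B
  (fun k x => F (fk k x) * 'D_(unitv R i) phi x)
  (fun x => F (f x) * 'D_(unitv R i) phi x) (cst (CF * Cq)) mB.
- by move=> k; apply: measurable_funM => //; exact: mfk.
- move=> x Bx; apply: cvgM; last exact: cvg_cst.
  by apply: continuous_cvg; [exact: cF|exact: fk_cvg].
- exact: L1_cst.
- by move=> k x Bx; rewrite normrM ler_pM// HCF// fkM.
(* The difference [dF(f_k) g_k - dF(f) g] is split as [dF(f_k) (g_k - g) + (dF(f_k) - dF(f)) g]. The
   second term, with [g] fixed, is dominated by [2 Cd |g phi|]; the first is small by L^1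
   convergence. *)
have [||||_ HQ] := @dct_abs _ _ R (leb n) B
  (fun k x => (dF (fk k x) - dF (f x)) * (g x * phi x))
  (cst 0) (fun x => (Cd + Cd) * `|g x * phi x|) mB.
- by move=> k; apply: measurable_funM; [apply: measurable_funB; [exact: mfk|exact: mcomp]|exact: measurable_funM].
- move=> x Bx; rewrite [X in _ --> X](_ : _ = (dF (f x) - dF (f x)) * (g x * phi x)); last first.
    by rewrite /cst subrr mul0r.
  apply: cvgM; last exact: cvg_cst.
  apply: cvgB; last exact: cvg_cst.
  by apply: continuous_cvg; [exact: cdF|exact: fk_cvg].
- have I : L1 B (fun x => `|g x * phi x|).
    by apply: L1_norm => //; apply: L1_bm => //; exact: bm_test tphi.
  have := integrableZl mB (Cd + Cd) I.
  by apply: eq_integrable => // x _ /=; rewrite EFinM.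
- move=> k x Bx; rewrite normrM ler_wpM2r// (le_trans (ler_normB _ _))//.
  by rewrite lerD//; [exact/HCd/fkM|exact/HCd/fM].
pose rr := r + enorm a.
have goff x : rr < enorm x -> (g \_ B) x = 0.
  move=> xr; rewrite patchE memNset//; apply/negP; rewrite -leNgt.
  move: xr; rewrite /rr.
  have := enorm_dist x a; have := ler_norm (enorm x - enorm a); lra.
have eC : 0 < e / 4 / (Cd * Cp + 1) by rewrite divr_gt0// ltr_wpDl// mulr_ge0.
have Hg := moll_L1 IgT goff eC.
have [k _ /(_ k (leqnn k)) [[Hk1 Hk2] [Hk3 Hk4]]] :=
  filterI (filterI PQk (HP _ e4)) (filterI (HQ _ e4) Hg).
have d1 : `|Pk k - P| <= e / 4 by exact: Rintegral_dist_le.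
have d2 : `|Qk k - Q| <= e / 4 + e / 4.
  apply: Rintegral_dist_le => //.
  apply: (@le_trans _ _ (\int[leb n]_(x in B) (Cd * Cp * `|gk k x - (g \_ B) x|)%:E +
     \int[leb n]_(x in B) `|(dF (fk k x) - dF (f x)) * (g x * phi x) - cst 0 x|%:E)%E).
    have mgB : measurable_fun B (g \_ B).
      by apply: measurable_funTS; exact: L1_measurable IgT.
    apply: ge0_integral_le_add => //.
    + apply: measurable_norm; apply: measurable_funB; apply: measurable_funM => //.
        by apply: measurable_funM => //; exact: mfk.
      by apply: measurable_funM => //; exact: mcomp.
    + by apply: measurable_funM => //; apply: measurable_norm; exact: measurable_funB.
    + apply: measurable_norm; apply: measurable_funB => //; apply: measurable_funM.
        by apply: measurable_funB; [exact: mfk|exact: mcomp].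
      exact: measurable_funM.
    + by move=> x _; rewrite mulr_ge0// mulr_ge0.
    + move=> x Bx; rewrite patchE mem_set// subr0.
      have -> : dF (fk k x) * gk k x * phi x - dF (f x) * g x * phi x =
        dF (fk k x) * phi x * (gk k x - g x) + (dF (fk k x) - dF (f x)) * (g x * phi x) by ring.
      rewrite (le_trans (ler_normD _ _))// lerD2r normrM ler_wpM2r// normrM ler_pM//.
      exact/HCd/fkM.
  rewrite [leRHS]EFinD; apply: leeD => //.
  rewrite ge0_integralZ_fin//; last 2 first.
  - apply: measurable_norm; apply: measurable_funB => //.
    by apply: measurable_funTS; exact: L1_measurable IgT.
  - by rewrite mulr_ge0.
  apply: (@le_trans _ _ ((Cd * Cp)%:E * (e / 4 / (Cd * Cp + 1))%:E)%E).
    apply: lee_wpmul2l; first by rewrite lee_fin mulr_ge0.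
    apply: le_trans Hk4; apply: ge0_subset_integral => //.
    apply/measurable_EFinP/measurable_norm; apply: measurable_funB.
      exact: conv_measurable.
    exact: L1_measurable IgT.
  rewrite -EFinM lee_fin mulrCA ler_piMr ?(ltW e4)// ler_pdivrMr ?mul1r ?lerDl//.
  by rewrite ltr_wpDl// mulr_ge0.
rewrite -/P -/Q.
have -> : P + Q = (P - Pk k) + (Q - Qk k) by rewrite Hk1; ring.
rewrite (le_trans (ler_normD _ _))// distrC (distrC Q); lra.
Unshelve. all: by end_near. Qed.

End chain_rule.

(** * Stability of L^2 and of weak derivatives under sums and limits *)

Section L2_closure.
Context {R : realType} {n : nat}.
Implicit Types (f g h phi : 'rV[R]_n -> R) (x y a : 'rV[R]_n) (k : nat)
  (B D K : set 'rV[R]_n) (i : 'I_n) (r : R).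

Definition L2 D f := measurable_fun D f /\ (sqrL2 D f < +oo)%E.

Lemma cvg_norm_le (u_ : nat -> R) (l M : R) : u_ @ \oo --> l ->
  (forall k, `|u_ k| <= M) -> `|l| <= M.
Proof.
move=> ul uM; apply/ler_addgt0Pr => e e0.
have /cvgrPdist_le /(_ e e0) [k _ /(_ k (leqnn k))] := ul.
have := uM k; have := ler_distD (u_ k) l 0; rewrite !subr0; lra.
Qed.

Lemma L2_le D f g : measurable D -> measurable_fun D f -> L2 D g ->
  (forall x, D x -> `|f x| <= `|g x|) -> L2 D f.
Proof.
move=> mD mf [mg g2] fg; split => //; apply: le_lt_trans g2.
apply: ge0_integral_le => //; try exact: measurable_funX.
  by move=> x _; exact: sqr_ge0.
move=> x Dx; rewrite -(real_normK (num_real (f x))) -(real_normK (num_real (g x))).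
by rewrite lerXn2r ?nnegrE// fg.
Qed.

Lemma sqrL2_add D f g : measurable D -> measurable_fun D f -> measurable_fun D g ->
  (sqrL2 D (fun x => (f x + g x)%R) <= 2%:E * sqrL2 D f + 2%:E * sqrL2 D g)%E.
Proof.
move=> mD mf mg.
have mf2 := measurable_funX 2 mf; have mg2 := measurable_funX 2 mg.
rewrite /sqrL2 -!ge0_integralZ_fin//; try by move=> x _; exact: sqr_ge0.
apply: ge0_integral_le_add => //.
- by apply: measurable_funX; exact: measurable_funD.
- exact: measurable_funM.
- exact: measurable_funM.
- by move=> x _; exact: sqr_ge0.
- by move=> x _; rewrite mulr_ge0// sqr_ge0.
- by move=> x _; rewrite mulr_ge0// sqr_ge0.
- by move=> x _; have := sqr_ge0 (f x - g x); nra.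
Qed.

Lemma L2D D f g : measurable D -> L2 D f -> L2 D g -> L2 D (fun x => f x + g x).
Proof.
move=> mD [mf f2] [mg g2]; split; first exact: measurable_funD.
apply: le_lt_trans (sqrL2_add mD mf mg) _.
by rewrite lte_add_pinfty// lte_mul_pinfty// lee_fin.
Qed.

Lemma sqrL2Z D f (c : R) : measurable D -> measurable_fun D f ->
  (sqrL2 D (fun x => (c * f x)%R) = (c ^+ 2)%:E * sqrL2 D f)%E.
Proof.
move=> mD mf; rewrite /sqrL2 -ge0_integralZ_fin ?sqr_ge0//.
- by apply: eq_integral => x _; rewrite exprMn.
- exact: measurable_funX.
- by move=> x _; exact: sqr_ge0.
Qed.

Lemma L2Z D f (c : R) : measurable D -> L2 D f -> L2 D (fun x => c * f x).
Proof.
move=> mD [mf f2]; split; first exact: measurable_funM.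
by rewrite sqrL2Z// lte_mul_pinfty// lee_fin sqr_ge0.
Qed.

Lemma L2N D f : measurable D -> L2 D f -> L2 D (fun x => - f x).
Proof.
move=> mD /(L2Z (-1) mD); congr L2; apply/funext => x; exact: mulN1r.
Qed.

Lemma L2B D f g : measurable D -> L2 D f -> L2 D g -> L2 D (fun x => f x - g x).
Proof. by move=> mD f2 g2; apply: L2D => //; exact: L2N. Qed.

Lemma L2_norm D f : L2 D f -> L2 D (fun x => `|f x|).
Proof.
move=> [mf f2]; split; first exact: measurable_norm.
move: f2; congr (_ < _)%E; apply: eq_integral => x _.
by rewrite real_normK ?num_real.
Qed.

Lemma L2_bm D f h : measurable D -> L2 D f -> bm D h -> L2 D (fun x => h x * f x).
Proof.
move=> mD f2 [mh [M hM]].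
apply: (L2_le mD _ (L2Z `|M| mD f2)).
  by apply: measurable_funM => //; exact: f2.1.
move=> x Dx; rewrite !normrM normr_id ler_wpM2r// (le_trans (hM _ Dx))//.
exact: ler_norm.
Qed.

Lemma L2_bounded D f (M : R) : measurable D -> (leb n D < +oo)%E ->
  measurable_fun D f -> (forall x, D x -> `|f x| <= M) -> L2 D f.
Proof.
move=> mD fD mf fM.
apply: (@L2_le _ _ (cst M)) => //; last first.
  by move=> x /fM h; rewrite (le_trans h)// ler_norm.
split; first exact: measurable_cst.
have -> : sqrL2 D (cst M) = (\int[leb n]_(x in D) cst (M ^+ 2)%:E x)%E by [].
by rewrite integral_cst// lte_mul_pinfty// lee_fin sqr_ge0.
Qed.

Lemma L2_sum D (I : Type) (s : seq I) (F : I -> 'rV[R]_n -> R) : measurable D ->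
  (forall j, L2 D (F j)) -> L2 D (fun x => \sum_(j <- s) F j x).
Proof.
move=> mD F2; elim: s => [|j s IH].
  have -> : (fun x => \sum_(j <- [::]) F j x) = (fun x => 0 * 0).
    by apply/funext => x; rewrite big_nil mulr0.
  split; first exact: measurable_cst.
  rewrite /sqrL2; under eq_integral do rewrite mulr0 expr0n/=.
  by rewrite integral0.
have -> : (fun x => \sum_(j <- j :: s) F j x) =
    (fun x => F j x + \sum_(j <- s) F j x).
  by apply/funext => x; rewrite big_cons.
exact: L2D.
Qed.

Lemma L2_L1 D f : measurable D -> (leb n D < +oo)%E -> L2 D f -> L1 D f.
Proof. by move=> mD fD [mf f2]; exact: L1_of_L2. Qed.

Lemma dct_L2 D (f_ : nat -> 'rV[R]_n -> R) f h : measurable D ->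
  (forall k, measurable_fun D (f_ k)) ->
  (forall x, D x -> f_ ^~ x @ \oo --> f x) ->
  L2 D h -> (forall k x, D x -> `|f_ k x| <= h x) ->
  L2 D f /\ forall e : R, 0 < e -> \forall k \near \oo,
    (sqrL2 D (fun x => (f_ k x - f x)%R) <= e%:E)%E.
Proof.
move=> mD mf ff [mh h2] fh.
have fh' x : D x -> `|f x| <= h x.
  by move=> Dx; apply: (cvg_norm_le (ff x Dx)) => k; exact: fh.
have mlim : measurable_fun D f by exact: (measurable_fun_cvg (h := f_)).
have Lf : L2 D f.
  apply: (L2_le mD mlim (conj mh h2)) => x Dx.
  by rewrite (le_trans (fh' x Dx))// ler_norm.
split => // e e0.
have [||||_ H] := @dct_abs _ _ R (leb n) D (fun k x => (f_ k x - f x) ^+ 2)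
    (cst 0) (fun x => (2 * h x) ^+ 2) mD.
- by move=> k; apply: measurable_funX; exact: measurable_funB.
- move=> x Dx; rewrite [X in _ --> X](_ : _ = (f x - f x) * (f x - f x)); last first.
    by rewrite subrr mulr0.
  have c : (fun k => f_ k x - f x) @ \oo --> f x - f x.
    by apply: cvgB; [exact: ff|exact: cvg_cst].
  exact: cvgM.
- apply: L1_sqr; first exact: measurable_funM.
  by rewrite sqrL2Z// lte_mul_pinfty// lee_fin sqr_ge0.
- move=> k x Dx; rewrite ger0_norm ?sqr_ge0// -(real_normK (num_real (_ - _))).
  have h0 : 0 <= h x by exact: le_trans (fh' x Dx).
  rewrite lerXn2r ?nnegrE ?mulr_ge0// (le_trans (ler_normB _ _))//.
  have := fh k x Dx; have := fh' x Dx; lra.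
apply: filterS (H e e0) => k; congr (_ <= _)%E; apply: eq_integral => x _.
by rewrite subr0 ger0_norm ?sqr_ge0.
Qed.

End L2_closure.

Section weak_partial_closure.
Context {R : realType} {n : nat} (B : set 'rV[R]_n) (mB : measurable B).
Implicit Types (f g h phi : 'rV[R]_n -> R) (x y a : 'rV[R]_n) (k : nat) (i : 'I_n).

Lemma weak_partialD i f1 g1 f2 g2 : L1 B f1 -> L1 B g1 -> L1 B f2 -> L1 B g2 ->
  weak_partial B i f1 g1 -> weak_partial B i f2 g2 ->
  weak_partial B i (fun x => f1 x + f2 x) (fun x => g1 x + g2 x).
Proof.
move=> If1 Ig1 If2 Ig2 [_ _ H1] [_ _ H2].
have ID h1 h2 : L1 B h1 -> L1 B h2 -> L1 B (fun x => h1 x + h2 x).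
  move=> I1 I2; have := integrableD mB I1 I2.
  by apply: eq_integrable => // x _ /=; rewrite EFinD.
split; [by apply: L1_L1loc => //; exact: ID|by apply: L1_L1loc => //; exact: ID|].
move=> phi tphi; have tdphi := test_function_derive i tphi.
have E h1 h2 psi : L1 B h1 -> L1 B h2 -> test_function B psi ->
    \int[leb n]_(x in B) ((h1 x + h2 x) * psi x) =
    \int[leb n]_(x in B) (h1 x * psi x) + \int[leb n]_(x in B) (h2 x * psi x).
  move=> I1 I2 tpsi; rewrite -RintegralD//; first last.
  - by apply: L1_bm => //; exact: bm_test tpsi.
  - by apply: L1_bm => //; exact: bm_test tpsi.
  by apply: eq_Rintegral => x _; rewrite mulrDl.
by rewrite !E// H1// H2// opprD.
Qed.

Lemma weak_partialZ i f g (c : R) : L1 B f -> L1 B g ->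
  weak_partial B i f g -> weak_partial B i (fun x => c * f x) (fun x => c * g x).
Proof.
move=> If Ig [_ _ H].
have IZ h : L1 B h -> L1 B (fun x => c * h x).
  move=> I; have := integrableZl mB c I.
  by apply: eq_integrable => // x _ /=; rewrite EFinM.
split; [by apply: L1_L1loc => //; exact: IZ|by apply: L1_L1loc => //; exact: IZ|].
move=> phi tphi; have tdphi := test_function_derive i tphi.
have E h psi : L1 B h -> test_function B psi ->
    \int[leb n]_(x in B) (c * h x * psi x) = c * \int[leb n]_(x in B) (h x * psi x).
  move=> I tpsi; rewrite -RintegralZl//; last first.
    by apply: L1_bm => //; exact: bm_test tpsi.
  by apply: eq_Rintegral => x _; rewrite mulrA.
by rewrite !E// H// mulrN.
Qed.

Lemma weak_partialB i f1 g1 f2 g2 : L1 B f1 -> L1 B g1 -> L1 B f2 -> L1 B g2 ->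
  weak_partial B i f1 g1 -> weak_partial B i f2 g2 ->
  weak_partial B i (fun x => f1 x - f2 x) (fun x => g1 x - g2 x).
Proof.
move=> If1 Ig1 If2 Ig2 w1 w2.
have IN h : L1 B h -> L1 B (fun x => -1 * h x).
  move=> I; have := integrableZl mB (-1) I.
  by apply: eq_integrable => // x _ /=; rewrite EFinM.
have := weak_partialD If1 Ig1 (IN _ If2) (IN _ Ig2) w1 (weak_partialZ (-1) If2 Ig2 w2).
by congr weak_partial; apply/funext => x; rewrite mulN1r.
Qed.

(** Both sides of the defining identity pass to the limit by dominated convergence, test functions
    and their derivatives being bounded. *)
Lemma weak_partial_lim i (f_ g_ : nat -> 'rV[R]_n -> R) f g F G :
  (forall k, weak_partial B i (f_ k) (g_ k)) -> L1 B F -> L1 B G ->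
  (forall k x, B x -> `|f_ k x| <= F x) -> (forall k x, B x -> `|g_ k x| <= G x) ->
  (forall x, B x -> f_ ^~ x @ \oo --> f x) ->
  (forall x, B x -> g_ ^~ x @ \oo --> g x) ->
  weak_partial B i f g.
Proof.
move=> wk IF IG fF gG ff gg.
have mf k : measurable_fun B (f_ k) by have [[]] := wk k.
have mg k : measurable_fun B (g_ k) by have [_ []] := wk k.
have I1 h H : measurable_fun B h -> L1 B H -> (forall x, B x -> `|h x| <= H x) -> L1 B h.
  move=> mh IH hH; apply: le_integrable IH => //; first exact/measurable_EFinP.
  by move=> x Bx; rewrite /= lee_fin (le_trans (hH x Bx))// ler_norm.
have step (h_ : nat -> 'rV[R]_n -> R) h H psi : (forall k, measurable_fun B (h_ k)) -> L1 B H ->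
    (forall k x, B x -> `|h_ k x| <= H x) -> (forall x, B x -> h_ ^~ x @ \oo --> h x) ->
    test_function B psi ->
    [/\ L1 B h, (forall k, L1 B (h_ k)) &
      forall e : R, 0 < e -> \forall k \near \oo,
        `|\int[leb n]_(x in B) (h_ k x * psi x) - \int[leb n]_(x in B) (h x * psi x)| <= e].
  move=> mh IH hH hh tpsi.
  have [C C0 HC] := test_function_bounded tpsi.
  have mlim : measurable_fun B h by exact: (measurable_fun_cvg (h := h_)).
  have Ih : L1 B h.
    apply: (I1 _ _ mlim IH) => x Bx.
    by apply: (cvg_norm_le (hh x Bx)) => k; exact: hH.
  have Ihk k : L1 B (h_ k) by apply: (I1 _ _ (mh k) IH) => x Bx; exact: hH.
  have bpsi : bm B psi by exact: bm_test tpsi.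
  split=> // e e0.
  have [||||_ D] := @dct_abs _ _ R (leb n) B (fun k x => h_ k x * psi x)
    (fun x => h x * psi x) (fun x => C * H x) mB.
  - by move=> k; apply: measurable_funM => //; exact: bpsi.1.
  - by move=> x Bx; apply: cvgM; [exact: hh|exact: cvg_cst].
  - have := integrableZl mB C IH.
    by apply: eq_integrable => // x _ /=; rewrite EFinM.
  - by move=> k x Bx; rewrite normrM mulrC ler_pM// hH.
  apply: filterS (D e e0) => k hk.
  by apply: Rintegral_dist_le => //; exact: L1_bm.
(* The integrability of the limits comes out of [step] for any test function; the zero function
   serves to extract it. *)
have t0 : test_function B (fun=> 0 : R).
  split.
    move=> s.
    have -> : iter_partial s (fun=> 0 : R) = fun _ : 'rV[R]_n => 0 : R.
      elim: s => //= j s ->; apply/funext => x; exact: derive_cst.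
    by split => [x|j x]; [exact: cst_continuous|exact: derivable_cst].
  by exists set0; split => //; exact: compact0.
have [If _ _] := step _ _ _ _ mf IF fF ff t0.
have [Ig _ _] := step _ _ _ _ mg IG gG gg t0.
split; [exact: L1_L1loc|exact: L1_L1loc|].
move=> phi tphi; have tdphi := test_function_derive i tphi.
apply/eqP; rewrite -subr_eq0 opprK -normr_le0; apply/eqP.
apply/eqP/ler_addgt0Pr => e e0; rewrite add0r.
have e2 : 0 < e / 2 by rewrite divr_gt0.
have [_ _ /(_ _ e2) H1] := step _ _ _ _ mf IF fF ff tdphi.
have [_ _ /(_ _ e2) H2] := step _ _ _ _ mg IG gG gg tphi.
have [k _ /(_ k (leqnn k)) [h1 h2]] := filterI H1 H2.
have [_ _ /(_ _ tphi) E] := wk k.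
move: h1 h2; rewrite E.
set p := \int[leb n]_(x in B) (g_ k x * phi x).
set P := \int[leb n]_(x in B) (f x * _).
set Q := \int[leb n]_(x in B) (g x * _).
move=> h1 h2; have -> : P + Q = - (- p - P) - (p - Q) by ring.
by rewrite (le_trans (ler_normB _ _))// normrN; lra.
Qed.

End weak_partial_closure.

(** * Regularized positive parts and square roots *)

Section calculus_functions.
Context {R : realType}.

(** A first-order expansion with quadratic error identifies the derivative; it treats the square of
    the positive part uniformly, the origin included. *)
Lemma quadratic_is_derive (F dF : R -> R) (t : R) :
  (forall s, `|F s - F t - dF t * (s - t)| <= (s - t) ^+ 2) ->
  is_derive t (1 : R) F (dF t).
Proof.
move=> H.
have C : (fun h : R => h^-1 *: ((F \o shift t) (h *: 1) - F t)) @ 0^' --> dF t.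
  apply/cvgrPdist_le => e e0; near=> h.
  have h0 : h != 0 by near: h; exact: nbhs_dnbhs_neq.
  have he : `|h| <= e.
    by near: h; exact: dnbhs0_le.
  have := H (h + t); rewrite addrK => H1.
  rewrite /= distrC /GRing.scale/= mulr1.
  have -> : h^-1 * (F (h + t) - F t) - dF t = h^-1 * (F (h + t) - F t - dF t * h) by field.
  rewrite normrM normfV ler_pdivrMl ?normr_gt0// (le_trans H1)//.
  by rewrite -(real_normK (num_real h)) expr2 ler_wpM2l.
split; first by apply/cvg_ex; exists (dF t).
exact: cvg_lim C.
Unshelve. all: by end_near. Qed.

Definition ppos (t : R) : R := Num.max 0 t.

Lemma ppos_ge0 t : 0 <= ppos t. Proof. by rewrite /ppos le_max lexx. Qed.
Lemma ppos_pos t : 0 <= t -> ppos t = t. Proof. by move=> t0; rewrite /ppos max_r. Qed.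
Lemma ppos_neg t : t <= 0 -> ppos t = 0. Proof. by move=> t0; rewrite /ppos max_l. Qed.
Lemma ppos_continuous : continuous ppos.
Proof.
move=> t; apply: (@continuous_max _ _ _ _ t); [exact: cst_continuous|].
exact: cvg_id.
Qed.

Lemma ppos_sqr_is_derive (t : R) : is_derive t (1 : R) (fun s => ppos s ^+ 2) (2 * ppos t).
Proof.
apply: (@quadratic_is_derive (fun s => ppos s ^+ 2) (fun t => 2 * ppos t)) => s.
have h1 := sqr_ge0 (s - t); have h2 := sqr_ge0 s; have h3 := sqr_ge0 t.
rewrite /= ler_norml; have [s0|/ltW s0] := leP 0 s; have [t0|/ltW t0] := leP 0 t;
  rewrite ?(ppos_pos s0) ?(ppos_pos t0) ?(ppos_neg s0) ?(ppos_neg t0).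
- by apply/andP; split; lra.
- have := mulr_ge0 s0 (_ : 0 <= - t); rewrite oppr_ge0 => /(_ t0) h4.
  by apply/andP; split; nra.
- have := mulr_ge0 t0 (_ : 0 <= - s); rewrite oppr_ge0 => /(_ s0) h4.
  by apply/andP; split; nra.
- by apply/andP; split; nra.
Qed.

Lemma sqr_is_derive (t : R) : is_derive t (1 : R) (fun s => s ^+ 2) (2 * t).
Proof.
apply: (@quadratic_is_derive (fun s => s ^+ 2) (fun t => 2 * t)) => s.
have -> : s ^+ 2 - t ^+ 2 - 2 * t * (s - t) = (s - t) ^+ 2 by ring.
by rewrite ger0_norm// sqr_ge0.
Qed.

Lemma sqrt_shift_is_derive (F dF : R -> R) (d : R) : 0 < d ->
  (forall t, 0 <= F t) -> (forall t : R, is_derive t (1 : R) F (dF t)) ->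
  forall t : R, is_derive t (1 : R) (fun s => Num.sqrt (F s + d))
    (dF t / (2 * Num.sqrt (F t + d))).
Proof.
move=> d0 F0 dFE t.
have p : 0 < F t + d by rewrite ltr_wpDl.
have h1 : is_derive t (1 : R) (fun s => F s + d) (dF t).
  have := is_deriveD (dFE t) (is_derive_cst d t (1 : R)).
  by rewrite addr0.
have := @is_derive1_comp R Num.sqrt (fun s => F s + d) t _ _ (is_derive1_sqrt p) h1.
by rewrite mulrC.
Qed.

(** [root4 d] is smooth on the whole line and tends to the square root on
    [t >= 0] as [d] tends to [0]: applied to [|u|^2] it yields the chain rule for
    [|u|] across the zeros of [u]. *)
Definition root2 (d t : R) := Num.sqrt (t ^+ 2 + d).
Definition root4 (d t : R) := Num.sqrt (root2 d t).
Definition droot4 (d t : R) := t / (2 * root2 d t * root4 d t).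
Definition root4V (d t : R) := (root4 d t)^-1.
Definition droot4V (d t : R) := - (root4 d t) ^- 2 * droot4 d t.

Lemma root2_gt0 d t : 0 < d -> 0 < root2 d t.
Proof. by move=> d0; rewrite sqrtr_gt0 ltr_wpDl// sqr_ge0. Qed.

Lemma root4_gt0 d t : 0 < d -> 0 < root4 d t.
Proof. by move=> d0; rewrite sqrtr_gt0 root2_gt0. Qed.

Lemma root2_continuous d : continuous (root2 d).
Proof.
have -> : root2 d = Num.sqrt \o (fun t : R => t ^+ 2 + d) by [].
move=> t; apply: (@continuous_comp _ _ _ _ Num.sqrt); last exact: sqrt_continuous.
by apply: cvgD; [exact: exprn_continuous|exact: cst_continuous].
Qed.

Lemma root4_continuous d : continuous (root4 d).
Proof.
move=> t; apply: (@continuous_comp _ _ _ (root2 d) Num.sqrt).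
  exact: root2_continuous.
exact: sqrt_continuous.
Qed.

Lemma droot4_continuous d : 0 < d -> continuous (droot4 d).
Proof.
move=> d0 t; apply: cvgM; first exact: cvg_id.
apply: cvgV; first by rewrite mulf_neq0// ?mulf_neq0// ?gt_eqF// ?root2_gt0// root4_gt0.
apply: cvgM; last exact: root4_continuous.
by apply: cvgM; [exact: cst_continuous|exact: root2_continuous].
Qed.

Lemma droot4V_continuous d : 0 < d -> continuous (droot4V d).
Proof.
move=> d0 t; apply: cvgM; last exact: droot4_continuous.
apply: cvgN; apply: cvgV; first by rewrite expf_neq0// gt_eqF// root4_gt0.
rewrite expr2 (_ : (fun _ => _) = (fun x => root4 d x * root4 d x))//.
by apply: cvgM; exact: root4_continuous.
Qed.

Lemma root4_is_derive d (t : R) : 0 < d -> is_derive t (1 : R) (root4 d) (droot4 d t).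
Proof.
move=> d0.
have h1 : is_derive t (1 : R) (root2 d) (2 * t / (2 * root2 d t)).
  by apply: (sqrt_shift_is_derive d0 _ (@sqr_is_derive)) => s; exact: sqr_ge0.
have := @is_derive1_comp R Num.sqrt (root2 d) t _ _ (is_derive1_sqrt (root2_gt0 t d0)) h1.
move=> h; apply: is_derive_eq h _; rewrite /droot4 -/(root4 d t).
have := gt_eqF (root2_gt0 t d0); have := gt_eqF (root4_gt0 t d0).
move=> /negbT h2 /negbT h3; field; by rewrite h2 h3.
Qed.

Lemma root4V_is_derive d (t : R) : 0 < d -> is_derive t (1 : R) (root4V d) (droot4V d t).
Proof.
move=> d0; have h4 : root4 d t != 0 by rewrite gt_eqF// root4_gt0.
have := is_deriveV h4 (root4_is_derive t d0).
by [].
Qed.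

(** A C^1 approximation of the positive part, vanishing exactly where it does. *)
Definition bpos (d t : R) := Num.sqrt (ppos t ^+ 2 + d) - Num.sqrt d.
Definition dbpos (d t : R) := ppos t / Num.sqrt (ppos t ^+ 2 + d).

Lemma bpos_is_derive d (t : R) : 0 < d -> is_derive t (1 : R) (bpos d) (dbpos d t).
Proof.
move=> d0.
have h := sqrt_shift_is_derive d0 (fun t => sqr_ge0 (ppos t)) ppos_sqr_is_derive t.
have := is_deriveB h (is_derive_cst (Num.sqrt d) t (1 : R)).
rewrite subr0; congr is_derive; rewrite /dbpos.
have : Num.sqrt (ppos t ^+ 2 + d) != 0 by rewrite gt_eqF// sqrtr_gt0 ltr_wpDl// sqr_ge0.
by move=> h0; field.
Qed.

Lemma dbpos_continuous d : 0 < d -> continuous (dbpos d).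
Proof.
move=> d0 t; apply: cvgM; first exact: ppos_continuous.
apply: cvgV; first by rewrite gt_eqF// sqrtr_gt0 ltr_wpDl// sqr_ge0.
apply: (@continuous_comp _ _ _ (fun t => ppos t ^+ 2 + d) Num.sqrt); last exact: sqrt_continuous.
apply: cvgD; last exact: cst_continuous.
by apply: (@continuous_comp _ _ _ ppos (fun t => t ^+ 2)); [exact: ppos_continuous|exact: exprn_continuous].
Qed.

Lemma cvg_natSinv : (fun k => k.+1%:R^-1 : R) @ \oo --> (0 : R).
Proof.
apply/cvgrPdist_le => e e0; have [N _ HN] := near_infty_natSinv_lt (PosNum e0).
by exists N => // k Nk /=; rewrite sub0r normrN ger0_norm ?invr_ge0// ltW// (HN k Nk).
Qed.

Lemma sqrt_cvg (u_ : nat -> R) (l : R) : u_ @ \oo --> l ->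
  (fun k => Num.sqrt (u_ k)) @ \oo --> Num.sqrt l.
Proof. by move=> ul; apply: continuous_cvg; first exact: sqrt_continuous. Qed.

Lemma bpos_cvg t : (fun k => bpos k.+1%:R^-1 t) @ \oo --> ppos t.
Proof.
have -> : ppos t = Num.sqrt (ppos t ^+ 2 + 0) - Num.sqrt 0.
  by rewrite addr0 sqrtr0 subr0 sqrtr_sqr ger0_norm// ppos_ge0.
apply: cvgB; apply: sqrt_cvg; last exact: cvg_natSinv.
by apply: cvgD; [exact: cvg_cst|exact: cvg_natSinv].
Qed.

Lemma dbpos_cvg t : (fun k => dbpos k.+1%:R^-1 t) @ \oo --> (if 0 < t then 1 else 0 : R).
Proof.
case: ifPn => [t0|]; last first.
  rewrite -leNgt => t0; rewrite /dbpos; under eq_fun do rewrite ppos_neg// mul0r.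
  exact: cvg_cst.
rewrite [X in _ --> X](_ : _ = ppos t / Num.sqrt (ppos t ^+ 2 + 0)); last first.
  rewrite addr0 sqrtr_sqr ppos_pos ?ltW// ger0_norm ?ltW// divff// gt_eqF//.
apply: cvgM; first exact: cvg_cst.
apply: cvgV; first by rewrite addr0 sqrtr_sqr ppos_pos ?ltW// normr_eq0 gt_eqF.
apply: sqrt_cvg; by apply: cvgD; [exact: cvg_cst|exact: cvg_natSinv].
Qed.

Lemma dbpos_bound d t : 0 < d -> `|dbpos d t| <= 1.
Proof.
move=> d0; have p := ppos_ge0 t.
have s0 : 0 < Num.sqrt (ppos t ^+ 2 + d) by rewrite sqrtr_gt0 ltr_wpDl// sqr_ge0.
rewrite ger0_norm ?divr_ge0 ?(ltW s0)// ler_pdivrMr// mul1r.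
by rewrite -[leLHS]ger0_norm// -sqrtr_sqr ler_wsqrtr// lerDl ltW.
Qed.

Lemma bpos_bound d t : 0 < d -> `|bpos d t| <= `|t|.
Proof.
move=> d0; have p := ppos_ge0 t.
have pt : ppos t <= `|t| by rewrite /ppos ge_max normr_ge0 ler_norm.
have h1 : Num.sqrt d <= Num.sqrt (ppos t ^+ 2 + d) by rewrite ler_wsqrtr// lerDr sqr_ge0.
have h2 : Num.sqrt (ppos t ^+ 2 + d) <= ppos t + Num.sqrt d.
  rewrite -[leRHS]ger0_norm ?addr_ge0 ?sqrtr_ge0// -sqrtr_sqr ler_wsqrtr//.
  have := sqr_sqrtr (ltW d0); have := mulr_ge0 p (sqrtr_ge0 d).
  set w := Num.sqrt d; nra.
rewrite /bpos ger0_norm ?subr_ge0//; lra.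
Qed.

Lemma root4_cvg t : 0 <= t -> (fun k => root4 k.+1%:R^-1 t) @ \oo --> Num.sqrt t.
Proof.
move=> t0; have -> : Num.sqrt t = Num.sqrt (Num.sqrt (t ^+ 2 + 0)).
  by rewrite addr0 sqrtr_sqr ger0_norm.
apply: sqrt_cvg; apply: sqrt_cvg.
by apply: cvgD; [exact: cvg_cst|exact: cvg_natSinv].
Qed.

Lemma root2_cvg t : 0 <= t -> (fun k => root2 k.+1%:R^-1 t) @ \oo --> t.
Proof.
move=> t0; have E : t = Num.sqrt (t ^+ 2 + 0) by rewrite addr0 sqrtr_sqr ger0_norm.
rewrite [X in _ --> X]E; apply: sqrt_cvg.
by apply: cvgD; [exact: cvg_cst|exact: cvg_natSinv].
Qed.

Lemma root2_ge d t : 0 < d -> `|t| <= root2 d t.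
Proof. by move=> d0; rewrite -sqrtr_sqr ler_wsqrtr// lerDl ltW. Qed.

Lemma root4_ge d t : 0 < d -> Num.sqrt t <= root4 d t.
Proof.
move=> d0; rewrite ler_wsqrtr//; apply: le_trans (root2_ge t d0); exact: ler_norm.
Qed.

Lemma root4V_cvg t : 0 < t -> (fun k => root4V k.+1%:R^-1 t) @ \oo --> (Num.sqrt t)^-1.
Proof.
move=> t0; apply: cvgV; first by rewrite gt_eqF// sqrtr_gt0.
exact/root4_cvg/ltW.
Qed.

(** At [t = 0] the approximants vanish, and so does the limit by the convention [0^-1 = 0]. Thus the
    formula for the gradient of [|u|] gives 0 at zeros of [u]. *)
Lemma droot4_cvg t : 0 <= t ->
  (fun k => droot4 k.+1%:R^-1 t) @ \oo --> (Num.sqrt t)^-1 / 2.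
Proof.
rewrite le_eqVlt => /predU1P[<-|t0].
  rewrite sqrtr0 invr0 mul0r /droot4; under eq_fun do rewrite mul0r.
  exact: cvg_cst.
have s0 : Num.sqrt t != 0 by rewrite gt_eqF// sqrtr_gt0.
have t1 : t != 0 by rewrite gt_eqF.
rewrite [X in _ --> X](_ : _ = t / (2 * t * Num.sqrt t)); last by field; rewrite s0 t1.
apply: cvgM; first exact: cvg_cst.
apply: cvgV; first by rewrite !mulf_neq0.
apply: cvgM; last exact/root4_cvg/ltW.
apply: cvgM; first exact: cvg_cst.
exact/root2_cvg/ltW.
Qed.

Lemma droot4V_cvg t : 0 < t -> (fun k => droot4V k.+1%:R^-1 t) @ \oo -->
  - (Num.sqrt t) ^- 2 * ((Num.sqrt t)^-1 / 2).
Proof.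
move=> t0; apply: cvgM; last exact/droot4_cvg/ltW.
apply: cvgN; apply: cvgV; first by rewrite expf_neq0// gt_eqF// sqrtr_gt0.
rewrite expr2; under eq_fun do rewrite expr2.
by apply: cvgM; exact/root4_cvg/ltW.
Qed.

(** Equivalent to [|t| <= root2 d t]. For [s = |u|^2] the gradient of [root4 d s] is
    [2 droot4 d s (u . Du)] with [|u . Du| <= root4 d s * sum_j |D u_j|], so this bounds it by
    [sum_j |D u_j|] uniformly in [d]. *)
Lemma droot4_bound d t : 0 < d -> 2 * `|droot4 d t| * root4 d t <= 1.
Proof.
move=> d0; have r2 := root2_gt0 t d0; have r4 := root4_gt0 t d0.
rewrite /droot4 normrM normfV !normrM (gtr0_norm r2) (gtr0_norm r4) (gtr0_norm (ltr0n R 2)).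
have -> : 2 * (`|t| / (2 * root2 d t * root4 d t)) * root4 d t = `|t| / root2 d t.
  by field; rewrite !gt_eqF.
by rewrite ler_pdivrMr// mul1r root2_ge.
Qed.

End calculus_functions.

(** * Bounded continuous functions of class W^{1,2} *)

Section bounded_continuous_W12.
Context {R : realType} {n : nat} (a : 'rV[R]_n) (r : R).
Let B : set 'rV[R]_n := eball a r.
Implicit Types (f h phi : 'rV[R]_n -> R) (x y : 'rV[R]_n) (k : nat) (i : 'I_n)
  (g : 'I_n -> 'rV[R]_n -> R).
Let mB : measurable B. Proof. exact: measurable_eball. Qed.
Let oB : open B. Proof. exact: eball_open. Qed.
Let fB : (leb n B < +oo)%E. Proof. exact: leb_eball_lty. Qed.

(** The weak gradient is carried along explicitly, so that the gradients of composites are given by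
    formulas valid at every point. Boundedness gives stability under products and C^1 functions;
    continuity makes mollifications converge pointwise. *)
Definition cbW12 f g := [/\ forall x, B x -> {for x, continuous f},
  exists M, forall x, B x -> `|f x| <= M,
  forall i, weak_partial B i f (g i) & forall i, L2 B (g i)].

Lemma cbW12_measurable f g : cbW12 f g -> measurable_fun B f.
Proof. by case=> cf _ _ _; apply: open_continuous_measurable_rv. Qed.

Lemma cbW12_L2 f g : cbW12 f g -> L2 B f.
Proof.
by move=> nf; have [_ [M fM] _ _] := nf; apply: L2_bounded fM => //; exact: cbW12_measurable nf.
Qed.

Lemma cbW12_L1 f g : cbW12 f g -> L1 B f.
Proof. by move=> nf; apply: L2_L1 => //; exact: cbW12_L2 nf. Qed.

Lemma cbW12_L1g f g i : cbW12 f g -> L1 B (g i).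
Proof. by move=> [_ _ _ nf]; exact: L2_L1. Qed.

Lemma cbW12_chain f g (F dF : R -> R) : cbW12 f g ->
  (forall t : R, is_derive t (1 : R) F (dF t)) -> continuous dF ->
  cbW12 (fun x => F (f x)) (fun i x => dF (f x) * g i x).
Proof.
move=> nf dFE cdF; have [cf [M fM] w g2] := nf.
have cF := derivable_continuous1 dFE.
have [CF CF0 HCF] := segment_bounded M cF.
have [Cd Cd0 HCd] := segment_bounded M cdF.
split.
- move=> x Bx.
  by apply: (@continuous_comp _ _ _ f F); [exact: cf|exact: cF].
- by exists CF => x Bx; exact/HCF/fM.
- by move=> i; apply: weak_chain fM _ _ _ _ => //; exact: cbW12_L1g nf.
- move=> i; apply: L2_bm => //; split.
    apply: open_continuous_measurable_rv => // x Bx.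
    by apply: (@continuous_comp _ _ _ f dF); [exact: cf|exact: cdF].
  by exists Cd => x Bx; exact/HCd/fM.
Qed.

Lemma cbW12D f1 g1 f2 g2 : cbW12 f1 g1 -> cbW12 f2 g2 ->
  cbW12 (fun x => f1 x + f2 x) (fun i x => g1 i x + g2 i x).
Proof.
move=> n1 n2; have [c1 [M1 b1] w1 l1] := n1; have [c2 [M2 b2] w2 l2] := n2; split.
- by move=> x Bx; apply: (@cvgD _ _ _ (nbhs x)); [exact: c1|exact: c2].
- exists (M1 + M2) => x Bx; rewrite (le_trans (ler_normD _ _))// lerD//.
    exact: b1.
  exact: b2.
- move=> i; apply: weak_partialD => //; [exact: cbW12_L1 n1|exact: cbW12_L1g n1|exact: cbW12_L1 n2|exact: cbW12_L1g n2].
- by move=> i; exact: L2D.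
Qed.

Lemma cbW12Z f g (c : R) : cbW12 f g -> cbW12 (fun x => c * f x) (fun i x => c * g i x).
Proof.
move=> nf; have [cf [M b] w l] := nf; split.
- by move=> x Bx; apply: (@cvgM _ _ (nbhs x)); [exact: cvg_cst|exact: cf].
- by exists (`|c| * M) => x Bx; rewrite normrM ler_wpM2l// b.
- by move=> i; apply: weak_partialZ => //; [exact: cbW12_L1 nf|exact: cbW12_L1g nf].
- by move=> i; exact: L2Z.
Qed.

Lemma cbW12_ext f g f' g' : f =1 f' -> (forall i, g i =1 g' i) -> cbW12 f g -> cbW12 f' g'.
Proof.
move=> /funext -> E; suff -> : g = g' by [].
by apply/funext => i; apply/funext.
Qed.

Lemma cbW12B f1 g1 f2 g2 : cbW12 f1 g1 -> cbW12 f2 g2 ->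
  cbW12 (fun x => f1 x - f2 x) (fun i x => g1 i x - g2 i x).
Proof.
move=> n1 n2; apply: cbW12_ext (cbW12D n1 (cbW12Z (-1) n2)).
  by move=> x; rewrite mulN1r.
by move=> i x; rewrite mulN1r.
Qed.

Lemma cbW12_cst (c : R) : cbW12 (fun=> c) (fun i x => 0).
Proof.
have z : L2 B (fun=> 0 : R).
  by apply: (L2_bounded (M := 0)) => // x _; rewrite normr0.
split.
- by move=> x _; exact: cst_continuous.
- by exists `|c|.
- move=> i; have [||_ _ H] := @weak_partial_C1 R n B i (fun=> c) oB (@cst_continuous _ _ c).
  + by move=> x; exact: derivable_cst.
  + by under eq_fun do rewrite derive_cst; exact: cst_continuous.
  split.
  + apply: L1_L1loc => //; apply: L2_L1 => //.
    by apply: (L2_bounded (M := `|c|)).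
  + by apply: L1_L1loc => //; exact: L2_L1.
  + move=> phi tphi; rewrite H//; congr (- _); apply: eq_Rintegral => x _.
    by rewrite derive_cst.
- by [].
Qed.

(* Polarization reduces products to the chain rule for squares. *)
Lemma cbW12M f1 g1 f2 g2 : cbW12 f1 g1 -> cbW12 f2 g2 ->
  cbW12 (fun x => f1 x * f2 x) (fun i x => f1 x * g2 i x + f2 x * g1 i x).
Proof.
move=> n1 n2.
have c2 : continuous (fun t : R => 2 * t).
  by move=> t; apply: cvgM; [exact: cvg_cst|exact: cvg_id].
have sq f g : cbW12 f g -> cbW12 (fun x => f x ^+ 2) (fun i x => 2 * f x * g i x).
  by move=> nf; exact: (cbW12_chain nf (@sqr_is_derive R) c2).
have := cbW12Z (4^-1) (cbW12B (sq _ _ (cbW12D n1 n2)) (sq _ _ (cbW12B n1 n2))).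
apply: cbW12_ext => [x|i x]; by field.
Qed.

Lemma cbW12_sum (I : Type) (s : seq I) (F : I -> 'rV[R]_n -> R)
    (G : I -> 'I_n -> 'rV[R]_n -> R) : (forall j, cbW12 (F j) (G j)) ->
  cbW12 (fun x => \sum_(j <- s) F j x) (fun i x => \sum_(j <- s) G j i x).
Proof.
move=> nF; elim: s => [|j s IH].
  apply: cbW12_ext (cbW12_cst 0) => [x|i x]; by rewrite big_nil.
apply: cbW12_ext (cbW12D (nF j) IH) => [x|i x]; by rewrite big_cons.
Qed.

(** Continuity of the limit is assumed because convergence is only pointwise; the gradients are
    dominated by a fixed L^2 function. *)
Lemma cbW12_lim (f_ : nat -> 'rV[R]_n -> R) (g_ : nat -> 'I_n -> 'rV[R]_n -> R)
    f g (M : R) (G : 'I_n -> 'rV[R]_n -> R) :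
  (forall k, cbW12 (f_ k) (g_ k)) ->
  (forall x, B x -> {for x, continuous f}) -> (forall i, L2 B (G i)) ->
  (forall k x, B x -> `|f_ k x| <= M) ->
  (forall k i x, B x -> `|g_ k i x| <= G i x) ->
  (forall x, B x -> f_ ^~ x @ \oo --> f x) ->
  (forall i x, B x -> (fun k => g_ k i x) @ \oo --> g i x) ->
  cbW12 f g.
Proof.
move=> nk cf G2 fM gG ff gg; split => //.
- by exists M => x Bx; apply: (cvg_norm_le (ff x Bx)) => k; exact: fM.
- move=> i; apply: (@weak_partial_lim _ _ _ mB i f_ (fun k => g_ k i) f (g i) (cst M) (G i)) => //.
  + by move=> k; have [] := nk k.
  + exact: L1_cst.
  + exact: L2_L1.
  + by move=> k x Bx; exact: gG.
  + by move=> x Bx; exact: gg.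
- move=> i; have [||||//] := @dct_L2 R n B (fun k => g_ k i) (g i) (G i) mB.
  + by move=> k; have [_ _ _ l] := nk k; exact: (l i).1.
  + by move=> x Bx; exact: gg.
  + exact: G2.
  + by move=> k x Bx; exact: gG.
Qed.

(** The C^1 functions [bpos] have derivative bounded by 1 and tending to the indicator of [t > 0];
    at [t = 0] it is exactly 0. *)
Lemma cbW12_ppos f g : cbW12 f g ->
  cbW12 (fun x => ppos (f x)) (fun i x => if 0 < f x then g i x else 0).
Proof.
move=> nf; have [cf [M fM] w g2] := nf.
have d0 k : 0 < k.+1%:R^-1 :> R by [].
apply: (@cbW12_lim (fun k x => bpos k.+1%:R^-1 (f x))
   (fun k i x => dbpos k.+1%:R^-1 (f x) * g i x) _ _ M (fun i x => `|g i x|)).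
- move=> k; apply: (cbW12_chain nf); last exact: dbpos_continuous.
  by move=> t; exact: bpos_is_derive.
- move=> x Bx; apply: (@continuous_comp _ _ _ f ppos); first exact: cf.
  exact: ppos_continuous.
- by move=> i; exact: L2_norm.
- by move=> k x Bx; rewrite (le_trans (bpos_bound _ (d0 k)))// fM.
- by move=> k i x Bx; rewrite normrM ler_piMl// dbpos_bound.
- by move=> x Bx; exact: bpos_cvg.
- move=> i x Bx; rewrite [X in _ --> X](_ : _ = (if 0 < f x then 1 else 0) * g i x); last first.
    by case: ifP; rewrite ?mul1r ?mul0r.
  by apply: cvgM; [exact: dbpos_cvg|exact: cvg_cst].
Qed.

(** * Modulus and radial direction of a vector-valued function *)

Section radial_part.
Context {m : nat} (u : 'I_m -> 'rV[R]_n -> R) (g : 'I_m -> 'I_n -> 'rV[R]_n -> R)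
  (nu : forall j, cbW12 (u j) (g j)).

Let s x := \sum_(j < m) u j x ^+ 2.
Let rho x := Num.sqrt (s x).
Let ug i x := \sum_(j < m) u j x * g j i x.

Let s0 x : 0 <= s x. Proof. by apply: sumr_ge0 => j _; exact: sqr_ge0. Qed.

Let ns : cbW12 s (fun i x => 2 * ug i x).
Proof.
have := @cbW12_sum _ (index_enum 'I_m) _ _ (fun j => cbW12M (nu j) (nu j)).
apply: cbW12_ext => [x|i x]; first by apply: eq_bigr => j _; rewrite expr2.
rewrite /ug big_distrr/=; apply: eq_bigr => j _; ring.
Qed.

Lemma rho_continuous x : B x -> {for x, continuous rho}.
Proof.
move=> Bx; apply: (@continuous_comp _ _ _ s Num.sqrt); last exact: sqrt_continuous.
by have [c _ _ _] := ns; exact: c.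
Qed.

Lemma u_le_rho j x : `|u j x| <= rho x.
Proof.
rewrite /rho -sqrtr_sqr ler_wsqrtr// /s (bigD1 j)//= lerDl.
by apply: sumr_ge0 => l _; exact: sqr_ge0.
Qed.

Lemma ug_bound i x (c : R) : rho x <= c -> `|ug i x| <= c * \sum_(j < m) `|g j i x|.
Proof.
move=> rc; rewrite /ug big_distrr/= (le_trans (ler_norm_sum _ _ _))//.
apply: ler_sum => j _; rewrite normrM ler_wpM2r//.
by rewrite (le_trans (u_le_rho j x)).
Qed.

Let G2 i : L2 B (fun x => \sum_(j < m) `|g j i x|).
Proof. by apply: L2_sum => // j; apply: L2_norm; have [_ _ _] := nu j. Qed.

(** Apply the chain rule to [root4 d (|u|^2)] and let [d] tend to 0. The gradient at zeros of [u] is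
    0 through [0^-1 = 0]. *)
Lemma cbW12_rho : cbW12 rho (fun i x => (rho x)^-1 * ug i x).
Proof.
have d0 k : 0 < k.+1%:R^-1 :> R by [].
have [cs [M sM] _ _] := ns.
(* [root4 d] increases with [d] and [1/(k+1) <= 1], so the bound for [d = 1] serves for all [k]. *)
have [C C0 HC] := segment_bounded M (@root4_continuous R 1).
apply: (@cbW12_lim (fun k x => root4 k.+1%:R^-1 (s x))
   (fun k i x => droot4 k.+1%:R^-1 (s x) * (2 * ug i x)) _ _ C
   (fun i x => \sum_(j < m) `|g j i x|)) => //.
- move=> k; apply: (cbW12_chain ns); last exact: droot4_continuous.
  by move=> t; exact: root4_is_derive.
- exact: rho_continuous.
- move=> k x Bx; apply: le_trans (HC _ (sM x Bx)).
  rewrite !ger0_norm ?sqrtr_ge0// ler_wsqrtr// ler_wsqrtr// lerD2l.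
  by rewrite invf_le1// ler1n.
- move=> k i x Bx.
  have h1 := droot4_bound (s x) (d0 k).
  have h2 := ug_bound i (root4_ge (s x) (d0 k)).
  set S := \sum_(j < m) _ in h2 *.
  have S0 : 0 <= S by apply: sumr_ge0.
  set D := droot4 _ _ in h1 *; clearbody D.
  rewrite !normrM (gtr0_norm (ltr0n R 2)).
  apply: (@le_trans _ _ (`|D| * (2 * (root4 k.+1%:R^-1 (s x) * S)))).
    by rewrite ler_wpM2l// ler_wpM2l.
  have -> : `|D| * (2 * (root4 k.+1%:R^-1 (s x) * S)) =
    2 * `|D| * root4 k.+1%:R^-1 (s x) * S by ring.
  by rewrite ler_piMl.
- by move=> x Bx; exact: root4_cvg.
- move=> i x Bx.
  have -> : (rho x)^-1 * ug i x = (rho x)^-1 / 2 * (2 * ug i x).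
    by set v := (rho x)^-1; clearbody v; field.
  by apply: cvgM; [exact: droot4_cvg|exact: cvg_cst].
Qed.

Section direction.
Context (w : 'rV[R]_n -> R) (p : 'I_n -> 'rV[R]_n -> R) (nw : cbW12 w p)
  (w_rho : forall x, B x -> 0 <= w x <= rho x)
  (p_rho : forall i x, B x -> rho x = 0 -> p i x = 0).

(** The gradient of [w u / rho]; it is correct also where [rho = 0], since there
    [rho^-1 = 0] and [p] and [w] vanish. *)
Definition dir_grad (j : 'I_m) (i : 'I_n) x : R :=
  p i x * u j x / rho x +
  w x * (g j i x / rho x - u j x * (ug i x / rho x) / rho x ^+ 2).

(** Replace [1/rho] by the smooth [1/A], [A = root4 d (rho^2) >= rho]. Then [w/A] and [u_j/A] are at
    most 1 in absolute value, so the gradients are dominated uniformly in [d] by those of [w] and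
    [u]. At zeros of [rho] both [w] and [p] vanish, so the approximants are identically 0 there. *)
Lemma weak_partial_dir j i :
  weak_partial B i (fun x => w x * u j x / rho x) (dir_grad j i) /\
  L2 B (dir_grad j i).
Proof.
have d0 k : 0 < k.+1%:R^-1 :> R by [].
have nk k := cbW12M (cbW12M nw (nu j))
  (cbW12_chain ns (fun t => root4V_is_derive t (d0 k)) (droot4V_continuous (d0 k))).
pose H x := `|p i x| + (`|g j i x| + \sum_(j < m) `|g j i x|).
have H2 : L2 B H.
  have [_ _ _ p2] := nw; have [_ _ _ g2] := nu j.
  apply: L2D => //; first exact: L2_norm.
  by apply: L2D => //; exact: L2_norm.
have gH k x : B x ->
  `|w x * u j x * (droot4V k.+1%:R^-1 (s x) * (2 * ug i x)) +
    root4V k.+1%:R^-1 (s x) * (w x * g j i x + u j x * p i x)| <= H x.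
  move=> Bx; have /andP[w0 wr] := w_rho Bx.
  have h1 := droot4_bound (s x) (d0 k).
  have rr := root4_ge (s x) (d0 k); rewrite -/(rho x) in rr.
  have h2 := ug_bound i rr.
  have ur := le_trans (u_le_rho j x) rr.
  have r4 := root4_gt0 (s x) (d0 k).
  rewrite /root4V /droot4V.
  set S := \sum_(j < m) _ in h2 *; set A := root4 _ _ in h1 rr h2 ur r4 *.
  set D := droot4 _ _ in h1 *; clearbody D.
  have S0 : 0 <= S by apply: sumr_ge0.
  have wA : `|w x / A| <= 1.
    by rewrite ger0_norm ?divr_ge0 ?(ltW r4)// ler_pdivrMr// mul1r (le_trans wr).
  have uA : `|u j x / A| <= 1.
    by rewrite normrM normfV (gtr0_norm r4) ler_pdivrMr// mul1r.
  have A0 : A != 0 by rewrite gt_eqF.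
  have -> : w x * u j x * (- A ^- 2 * D * (2 * ug i x)) +
     A^-1 * (w x * g j i x + u j x * p i x) =
     (u j x / A) * p i x + ((w x / A) * g j i x - (w x / A) * ((u j x / A) * (2 * D * ug i x))).
    by field.
  rewrite (le_trans (ler_normD _ _))// lerD//.
    by rewrite normrM ler_piMl.
  rewrite (le_trans (ler_normB _ _))// lerD//.
    by rewrite normrM ler_piMl.
  rewrite normrM -[leRHS]mul1r ler_pM// normrM -[leRHS]mul1r ler_pM//.
  rewrite !normrM (gtr0_norm (ltr0n R 2)).
  apply: (@le_trans _ _ (2 * `|D| * (A * S))); first by rewrite ler_wpM2l// mulr_ge0.
  by rewrite mulrA ler_piMl.
have [cw [M wM] _ _] := nw.
have limf x : B x -> (fun k => w x * u j x * root4V k.+1%:R^-1 (s x)) @ \oo -->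
    w x * u j x / rho x.
  move=> Bx; have [r0|r0] := eqVneq (rho x) 0.
    have w0 : w x = 0 by apply/eqP; rewrite eq_le; have := w_rho Bx; rewrite r0 andbC.
    rewrite w0 !mul0r; under eq_fun do rewrite mul0r; exact: cvg_cst.
  apply: cvgM; first exact: cvg_cst.
  apply: root4V_cvg; rewrite lt0r s0 andbT; apply: contra_neq r0 => sx.
  by rewrite /rho sx sqrtr0.
have limg x : B x -> (fun k => w x * u j x * (droot4V k.+1%:R^-1 (s x) * (2 * ug i x)) +
    root4V k.+1%:R^-1 (s x) * (w x * g j i x + u j x * p i x)) @ \oo --> dir_grad j i x.
  move=> Bx; have [r0|r0] := eqVneq (rho x) 0.
    have w0 : w x = 0 by apply/eqP; rewrite eq_le; have := w_rho Bx; rewrite r0 andbC.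
    rewrite /dir_grad w0 (p_rho i Bx r0) !mul0r addr0.
    under eq_fun do rewrite mulr0 !mul0r addr0 mulr0 add0r; exact: cvg_cst.
  have sx : 0 < s x.
    by rewrite lt0r s0 andbT; apply: contra_neq r0 => sx; rewrite /rho sx sqrtr0.
  have -> : dir_grad j i x = w x * u j x * (- (Num.sqrt (s x)) ^- 2 * ((Num.sqrt (s x))^-1 / 2) *
      (2 * ug i x)) + (Num.sqrt (s x))^-1 * (w x * g j i x + u j x * p i x).
    by rewrite /dir_grad -/(rho x); field.
  apply: cvgD.
    apply: cvgM; first exact: cvg_cst.
    by apply: cvgM; [exact: droot4V_cvg|exact: cvg_cst].
  by apply: cvgM; [exact: root4V_cvg|exact: cvg_cst].
split.
  apply: (@weak_partial_lim _ _ _ mB i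
    (fun k x => w x * u j x * root4V k.+1%:R^-1 (s x))
    (fun k x => w x * u j x * (droot4V k.+1%:R^-1 (s x) * (2 * ug i x)) +
      root4V k.+1%:R^-1 (s x) * (w x * g j i x + u j x * p i x))
    _ _ (fun x => `|w x|) H) => //.
  - by move=> k; have [_ _ wk _] := nk k; exact: wk.
  - by apply: L1_norm => //; exact: cbW12_L1 nw.
  - exact: L2_L1.
  - move=> k x Bx; rewrite -mulrA normrM ler_piMr// normrM /root4V normfV.
    have r4 := root4_gt0 (s x) (d0 k).
    rewrite (gtr0_norm r4) ler_pdivrMr// mul1r.
    by rewrite (le_trans (u_le_rho j x))// root4_ge.
apply: (dct_L2 mB _ limg H2 gH).1 => k.
by have [_ _ _ l] := nk k; exact: (l i).1.
Qed.

End direction.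
End radial_part.
End bounded_continuous_W12.

(** * Zero trace *)

Section nonnegative_norms.
Context {R : realType} {n : nat}.
Implicit Types (D : set 'rV[R]_n) (f : 'rV[R]_n -> R).

(** Brings the limits in the definitions of [W12_0] and [sphere_trace] to epsilon form. *)
Lemma cvge0P (u_ : nat -> \bar R) : (forall k, 0 <= u_ k)%E ->
  u_ @ \oo --> 0%E <-> forall e : R, 0 < e -> \forall k \near \oo, (u_ k <= e%:E)%E.
Proof.
move=> u0; split => [H e e0|H].
  have : nbhs 0%E [set y : \bar R | (y < e%:E)%E].
    by apply: open_nbhs_nbhs; split; [exact: open_ereal_lt_ereal|rewrite /= lte_fin].
  move=> Ne; have {}H : \forall k \near \oo, (u_ k < e%:E)%E := H _ Ne.
  by apply: filterS H => k /ltW.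
apply: cvg_EFin.
  apply: filterS (H 1 ltr01) => k uk; rewrite ge0_fin_numE//.
  by rewrite (le_lt_trans uk)// ltry.
apply/cvgrPdist_le => e e0; apply: filterS (H e e0) => k uk /=.
rewrite sub0r normrN ger0_norm ?fine_ge0// -lee_fin fineK//.
by rewrite ge0_fin_numE// (le_lt_trans uk)// ltry.
Qed.

Lemma sqrL2_ge0 D f : (0 <= sqrL2 D f)%E.
Proof. by apply: integral_ge0 => x _; rewrite lee_fin sqr_ge0. Qed.

Lemma sqrW12_ge0 D f : (0 <= sqrW12 D f)%E.
Proof. by rewrite adde_ge0 ?sqrL2_ge0// sume_ge0// => i _; exact: sqrL2_ge0. Qed.

End nonnegative_norms.

Section zero_trace_approximation.
Context {R : realType} {n : nat} (a : 'rV[R]_n) (r : R).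
Let B : set 'rV[R]_n := eball a r.
Implicit Types (f h phi : 'rV[R]_n -> R) (x y : 'rV[R]_n) (k : nat) (i : 'I_n)
  (g : 'I_n -> 'rV[R]_n -> R).
Let mB : measurable B. Proof. exact: measurable_eball. Qed.
Let oB : open B. Proof. exact: eball_open. Qed.
Let fB : (leb n B < +oo)%E. Proof. exact: leb_eball_lty. Qed.

Lemma sqrW12_weak f g : (forall i, weak_partial B i f (g i)) ->
  sqrW12 B f = (sqrL2 B f + \sum_(i < n) sqrL2 B (g i))%E.
Proof.
by move=> w; congr (_ + _)%E; apply: eq_bigr => i _; exact: sqrL2_wD.
Qed.

(** [f], with weak gradient [g], is a W^{1,2} limit of test functions. *)
Definition wapprox f g := forall e : R, 0 < e -> exists2 phi, test_function B phi &
  (sqrL2 B (fun x => (phi x - f x)%R) <= e%:E)%E /\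
  forall i, (sqrL2 B (fun x => ('D_(unitv R i) phi x - g i x)%R) <= e%:E)%E.

(** Mollifications at a scale finer than half the distance from the support to the sphere are test
    functions, and their gradients are the mollified weak gradients. *)
Lemma wapprox_compact f g (rho : R) : rho < r -> L2 B f -> (forall i, L2 B (g i)) ->
  (forall i, weak_partial B i f (g i)) ->
  (forall x, B x -> ~ ecball a rho x -> f x = 0) ->
  (forall i x, B x -> ~ ecball a rho x -> g i x = 0) ->
  wapprox f g.
Proof.
move=> rhor f2 g2 w f0 g0 e e0.
pose rho' := (rho + r) / 2.
have If := L2_L1 mB fB f2; have Ig i := L2_L1 mB fB (g2 i).
have IfT := L1_patch mB If; have IgT i := L1_patch mB (Ig i).
have off h : (forall x, B x -> ~ ecball a rho x -> h x = 0) ->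
    forall x, ~ ecball a rho x -> (h \_ B) x = 0.
  move=> h0 x xr; rewrite patchE; case: ifPn => // /set_mem Bx; exact: h0.
have far h : (forall x, B x -> ~ ecball a rho x -> h x = 0) ->
    forall x, rho + enorm a < enorm x -> (h \_ B) x = 0.
  move=> h0 x xr; apply: off => //; apply/negP; rewrite -ltNge.
  have := enorm_dist x a; have := ler_norm (enorm x - enorm a); lra.
have L2T h : L2 B h -> (sqrL2 setT (h \_ B) < +oo)%E.
  move=> [_]; congr (_ < _)%E; rewrite /sqrL2 integral_mkcond.
  apply: eq_integral => x _; rewrite !patchE; case: ifP => // _.
  by rewrite expr0n.
have cvgm h : L2 B h -> (forall x, B x -> ~ ecball a rho x -> h x = 0) ->
    \forall k \near \oo, (sqrL2 B (fun x => (convol (h \_ B) (moll k) x - h x)%R) <= e%:E)%E.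
  move=> h2 h0.
  have IhT := L1_patch mB (L2_L1 mB fB h2).
  have mT := L1_measurable IhT.
  apply: filterS (moll_L2 mT (L2T _ h2) IhT (far _ h0) e0) => k; apply: le_trans.
  rewrite /sqrL2 (eq_integral (fun x => ((convol (h \_ B) (moll k) x - (h \_ B) x) ^+ 2)%:E)); last first.
    by move=> x xB; rewrite patchE xB.
  apply: ge0_subset_integral => //.
  - by apply/measurable_EFinP; apply: measurable_funX; apply: measurable_funB => //; exact: conv_measurable.
  - by move=> x _; rewrite lee_fin sqr_ge0.
have d0 : 0 < (r - rho) / 2 by rewrite divr_gt0// subr_gt0.
have Hg : \forall k \near \oo, forall i,
    (sqrL2 B (fun x => (convol (g i \_ B) (moll k) x - g i x)%R) <= e%:E)%E.
  by apply: filter_forall => i; exact: (cvgm _ (g2 i) (g0 i)).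
have [k _ /(_ k (leqnn k)) [[k1 k2] k3]] :=
  filterI (filterI (cvgm _ f2 f0) Hg) (near_infty_natSinv_lt (PosNum d0)).
have {}k3 : k.+1%:R^-1 < (r - rho) / 2 by exact: k3.
have conv0 h x : (forall x, B x -> ~ ecball a rho x -> h x = 0) ->
    ~ ecball a rho' x -> convol (h \_ B) (moll k) x = 0.
  move=> h0 /negP; rewrite -ltNge => xr; apply: conv_eq0 => y.
  have [yr|yr] := pselect (ecball a rho y); last by rewrite off// mul0r.
  rewrite moll_eq0 ?mulr0//.
  move: yr; rewrite /ecball/= => yr.
  have : enorm (x - a) <= enorm (x - y) + enorm (y - a).
    by rewrite -[x - a](subrKA y); exact: enorm_triangle.
  move: k3 xr; rewrite /rho'; set dk := k.+1%:R^-1; lra.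
exists (convol (f \_ B) (moll k)).
  split; first exact: conv_smooth (@moll_test R n k).
  exists (ecball a rho'); split; first exact: ecball_compact.
    by move=> x; rewrite /ecball /B /eball /= /rho'; lra.
  by move=> x; exact: conv0.
split=> // i; apply: le_trans (k2 i).
rewrite /sqrL2 le_eqVlt; apply/orP; left; apply/eqP; apply: eq_integral => x /set_mem Bx.
congr (((_ - _) ^+ 2)%:E).
have [xK|xK] := pselect (ecball a rho' x); last first.
  rewrite (conv0 _ _ (g0 i) xK).
  apply: (@derive_support _ _ (convol (f \_ B) (moll k)) (ecball a rho')) => //.
    exact: ecball_closed.
  by move=> y; exact: conv0.
apply: (convol_weak_derive oB (w i) If (Ig i)).
apply: ecball_sub_eball; move: xK k3; rewrite /ecball /= /rho'; set dk := k.+1%:R^-1; lra.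
Qed.

Lemma sqrL2_dist_le f1 f2 f3 (e : R) : measurable_fun B f1 -> measurable_fun B f2 ->
  measurable_fun B f3 -> (sqrL2 B (fun x => (f1 x - f2 x)%R) <= (e / 4)%:E)%E ->
  (sqrL2 B (fun x => (f2 x - f3 x)%R) <= (e / 4)%:E)%E ->
  (sqrL2 B (fun x => (f1 x - f3 x)%R) <= e%:E)%E.
Proof.
move=> m1 m2 m3 h1 h2.
have -> : (fun x => f1 x - f3 x) = (fun x => (f1 x - f2 x) + (f2 x - f3 x)).
  by apply/funext => x; ring.
apply: le_trans (sqrL2_add mB (measurable_funB m1 m2) (measurable_funB m2 m3)) _.
have -> : e%:E = (2%:E * (e / 4)%:E + 2%:E * (e / 4)%:E)%E.
  by rewrite -!EFinM -EFinD; congr EFin; field.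
by apply: leeD; apply: lee_wpmul2l.
Qed.

Lemma wapprox_lim (f_ : nat -> 'rV[R]_n -> R) (g_ : nat -> 'I_n -> 'rV[R]_n -> R)
    f g F (G : 'I_n -> 'rV[R]_n -> R) :
  (forall k, wapprox (f_ k) (g_ k)) ->
  (forall k, measurable_fun B (f_ k)) -> (forall k i, measurable_fun B (g_ k i)) ->
  L2 B F -> (forall i, L2 B (G i)) ->
  (forall k x, B x -> `|f_ k x| <= F x) ->
  (forall k i x, B x -> `|g_ k i x| <= G i x) ->
  (forall x, B x -> f_ ^~ x @ \oo --> f x) ->
  (forall i x, B x -> (fun k => g_ k i x) @ \oo --> g i x) ->
  wapprox f g.
Proof.
move=> H mf mg F2 G2 fF gG ff gg e e0.
have e4 : 0 < e / 4 by rewrite divr_gt0.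
have [Lf Hf] := dct_L2 mB mf ff F2 fF.
have Hg i : L2 B (g i) /\ forall e : R, 0 < e -> \forall k \near \oo,
    (sqrL2 B (fun x => (g_ k i x - g i x)%R) <= e%:E)%E.
  apply: (@dct_L2 _ _ B (fun k => g_ k i) (g i) (G i) mB) => //.
  - by move=> x; exact: gg.
  - by move=> k x; exact: gG.
have Hg' : \forall k \near \oo, forall i,
    (sqrL2 B (fun x => (g_ k i x - g i x)%R) <= (e / 4)%:E)%E.
  by apply: filter_forall => i; exact: (Hg i).2.
have [k _ /(_ k (leqnn k)) [k1 k2]] := filterI (Hf _ e4) Hg'.
have [phi tphi [p1 p2]] := H k _ e4; exists phi => //.
have mp : measurable_fun B phi by exact: test_function_measurable tphi.
split=> [|i].
  by apply: sqrL2_dist_le p1 k1 => //; exact: Lf.1.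
apply: sqrL2_dist_le (p2 i) (k2 i) => //; last exact: (Hg i).1.1.
exact: (test_function_measurable (test_function_derive i tphi)).
Qed.

Lemma smooth_cbW12 phi : smooth phi ->
  cbW12 a r phi (fun i x => 'D_(unitv R i) phi x).
Proof.
move=> sphi.
have bd h : continuous h -> exists M, forall x, B x -> `|h x| <= M.
  move=> ch; have cn : {within ecball a r, continuous (fun x => `|h x|)}.
    apply: continuous_subspaceT => x.
    by apply: (@cvg_norm _ _ _ (nbhs x)); exact: ch.
  have [->|/set0P B0] := eqVneq B set0; first by exists 0.
  have E0 : ecball a r !=set0 by case: B0 => x /eball_sub_ecball; exists x.
  have [c _ hc] := EVT_max_rV E0 (@ecball_compact _ _ a r) cn.
  by exists `|h c| => x /eball_sub_ecball/mem_set/hc.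
have cphi := smooth_continuous sphi.
have cd i := @smooth_derive_continuous _ _ _ i sphi.
split=> [x _|||]; first exact: cphi.
- exact: bd.
- move=> i; apply: weak_partial_C1 => //.
  by move=> x; exact: smooth_derivable.
- move=> i; have [M HM] := bd _ (cd i).
  apply: L2_bounded HM => //; apply: measurable_funTS.
  exact: continuous_measurable_rv.
Qed.

Lemma wapprox_sequence f g : wapprox f g -> L2 B f -> (forall i, L2 B (g i)) ->
  (forall i, weak_partial B i f (g i)) ->
  exists phi : nat -> 'rV[R]_n -> R, (forall k, test_function B (phi k)) /\
    (fun k => sqrW12 B (fun x => phi k x - f x)) @ \oo --> 0%E.
Proof.
move=> H f2 g2 w.
(* The squared W^{1,2} norm has [n + 1] summands, each at most [e k], hence a total of [1/(k+1)]. *)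
pose e k : R := (n.+1%:R * k.+1%:R)^-1.
have e0 k : 0 < e k by rewrite invr_gt0 mulr_gt0.
pose phi k := s2val (cid2 (H _ (e0 k))).
exists phi.
have tphi k : test_function B (phi k) by rewrite /phi; case: cid2.
have hphi k := s2valP' (cid2 (H _ (e0 k))); rewrite -/(phi _) in hphi.
split=> //; apply/cvge0P => [k|d d0]; first exact: sqrW12_ge0.
have If := L2_L1 mB fB f2; have Ig i := L2_L1 mB fB (g2 i).
have := near_infty_natSinv_lt (PosNum d0); apply: filterS => k kd.
have {}kd : k.+1%:R^-1 < d by exact: kd.
have nphi := smooth_cbW12 (tphi k).1.
have [h1 h2] := hphi k.
rewrite (@sqrW12_weak _ (fun i x => 'D_(unitv R i) (phi k) x - g i x)); last first.
  move=> i; apply: weak_partialB => //; last by have [_ _ wp _] := nphi; exact: wp.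
  - exact: cbW12_L1 nphi.
  - exact: (cbW12_L1g i nphi).
apply: (@le_trans _ _ ((e k)%:E + \sum_(i < n) (e k)%:E)%E).
  by apply: leeD => //; apply: lee_sum => i _.
rewrite sumEFin sumr_const card_ord -EFinD lee_fin -mulrS.
rewrite -mulr_natr /e invfM mulrAC mulVf// mul1r; exact: ltW.
Qed.

Lemma wapprox_W12_0 f g : wapprox f g -> L2 B f -> (forall i, L2 B (g i)) ->
  (forall i, weak_partial B i f (g i)) -> W12_0 B f.
Proof.
move=> H f2 g2 w; split; last exact: wapprox_sequence g2 w.
split; [exact: f2.1|exact: f2.2|].
by move=> i; exists (g i) => //; exact: (g2 i).2.
Qed.

End zero_trace_approximation.

(** * Invariance of the trace under perturbations with zero trace *)

Section trace_perturbation.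
Context {R : realType} {n : nat} (hn : (0 < n)%N) (r : R) (r0 : 0 < r).
Let B : set 'rV[R]_n := eball 0 r.
Implicit Types (f h phi : 'rV[R]_n -> R) (x y : 'rV[R]_n) (k : nat) (i : 'I_n)
  (g : 'I_n -> 'rV[R]_n -> R).
Let mB : measurable B. Proof. exact: measurable_eball. Qed.
Let fB : (leb n B < +oo)%E. Proof. exact: leb_eball_lty. Qed.

(** Dilation by 2 fixes the origin and multiplies measure by [2^n >= 2], so its finite measure is
    0. *)
Lemma leb_point : leb n [set (0%R : 'rV[R]_n)] = 0%E.
Proof.
have m0 : measurable [set (0%R : 'rV[R]_n)].
  by apply: compact_rv_measurable; exact: compact_set1.
have f0 : (leb n [set (0%R : 'rV[R]_n)] < +oo)%E.
  by apply: leb_bounded_lty => //; apply: compact_bounded; exact: compact_set1.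
have two0 : (2 : R) != 0 by rewrite pnatr_eq0.
have := @leb_affine R n 2 0 _ two0 m0.
have -> : (fun x : 'rV[R]_n => 2 *: x + 0) @^-1` [set 0] = [set 0].
  apply/seteqP; split => x /=; last by move=> ->; rewrite scaler0 addr0.
  by move=> /eqP; rewrite addr0 scaler_eq0 (pnatr_eq0 R 2)/= => /eqP.
have [t -> t0] : exists2 t : R, leb n [set (0%R : 'rV[R]_n)] = t%:E & 0 <= t.
  exists (fine (leb n [set (0%R : 'rV[R]_n)])); last exact: fine_ge0.
  by rewrite fineK// ge0_fin_numE.
rewrite -EFinM => -[H]; congr EFin.
have : 2 <= 2 ^+ n :> R by rewrite -{1}(expr1 2) ler_weXn2l// ler1n.
by move: H; rewrite (ger0_norm (ler0n R 2)) => H h; nra.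
Qed.

Lemma sphere_proj_measurable D :
  measurable_fun D (fun x : 'rV[R]_n => (r / enorm x) *: x).
Proof.
apply: measurable_funTS.
have m1 : measurable_fun setT (fun x : 'rV[R]_n => r / enorm x).
  apply: measurable_funM => //.
  (* The limit of [|x| / (|x|^2 + 1/(k+1))] is [1/|x|] away from the origin and 0 at it, in
     agreement with [0^-1 = 0]. *)
  apply: (measurable_fun_cvg (h := fun k x => enorm x / (enorm x ^+ 2 + k.+1%:R^-1))).
    move=> k; apply: continuous_measurable_rv => x.
    apply: (@cvgM _ _ (nbhs x)); first exact: enorm_continuous.
    apply: (@cvgV _ _ (nbhs x)); first by rewrite gt_eqF// ltr_wpDl// sqr_ge0.
    apply: (@cvgD _ _ _ (nbhs x)); last exact: cvg_cst.
    by apply: (@cvgM _ _ (nbhs x)); exact: enorm_continuous.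
  move=> x _; have [x0|x0] := eqVneq (enorm x) 0.
    rewrite x0 invr0; under eq_fun do rewrite mul0r; exact: cvg_cst.
  rewrite [X in _ --> X](_ : _ = enorm x / (enorm x ^+ 2 + 0)); last by rewrite addr0; field.
  apply: cvgM; first exact: cvg_cst.
  apply: cvgV; first by rewrite addr0 expf_neq0.
  by apply: cvgD; [exact: cvg_cst|exact: cvg_natSinv].
have := measurableT_comp (@measurable_scale_rv R n)
  (measurable_fun_pair m1 (@measurable_id _ 'rV[R]_n setT)).
by [].
Qed.

(** The point [(r/|x|) x] lies on the sphere for every [x] except the origin, which is a null
    set. *)
Lemma sphere_integral_eq f h : measurable_fun setT f -> measurable_fun setT h ->
  (forall x, enorm x = r -> f x = h x) -> sphere_integral r f = sphere_integral r h.
Proof.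
move=> mf mh fh; rewrite /sphere_integral; congr (_ * _)%E.
apply: ae_eq_integral => //.
- apply/measurable_EFinP; apply: (measurableT_comp mf); exact: sphere_proj_measurable.
- apply/measurable_EFinP; apply: (measurableT_comp mh); exact: sphere_proj_measurable.
exists [set 0]; split.
- by apply: compact_rv_measurable; exact: compact_set1.
- exact: leb_point.
- move=> x /= H; apply: contrapT => x0; apply: H => _.
  rewrite fh// enormZ normrM normfV (ger0_norm (enorm_ge0 x)) gtr0_norm//.
  rewrite mulfVK//; apply/eqP => /enorm_eq0; exact: x0.
Qed.

(** Test functions of the ball vanish on the sphere. Adding those that approximate [f] to the smooth
    functions approximating [Psi] therefore leaves the sphere integrals unchanged. *)
Lemma A_ball_add q Psi f g : A_ball q r Psi -> wapprox 0 r f g -> L2 B f ->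
  (forall i, L2 B (g i)) -> (forall i, weak_partial B i f (g i)) ->
  A_ball q r (fun x => Psi x + f x).
Proof.
move=> [[mP P2 wP] [phi [sphi cphi tphi]]] H f2 g2 w.
have [psi [tpsi cpsi]] := wapprox_sequence H f2 g2 w.
have LP : L2 B Psi by [].
pose p i := s2val (cid2 (wP i)).
have wp i : weak_partial B i Psi (p i) by rewrite /p; case: cid2.
have p2 i : L2 B (p i).
  by split; [have [_ []] := wp i|rewrite /p; case: cid2].
have IP := L2_L1 mB fB LP; have Ip i := L2_L1 mB fB (p2 i).
have If := L2_L1 mB fB f2; have Ig i := L2_L1 mB fB (g2 i).
split.
  split; [exact: (L2D mB LP f2).1|exact: (L2D mB LP f2).2|].
  move=> i; exists (fun x => p i x + g i x); first exact: weak_partialD.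
  exact: (L2D mB (p2 i) (g2 i)).2.
exists (fun k x => phi k x + psi k x); split.
- by move=> k; apply: smoothD => //; exact: (tpsi k).1.
- apply/cvge0P => [k|e e0]; first exact: sqrW12_ge0.
  have /cvge0P c1 := cphi; have /cvge0P c2 := cpsi.
  have e4 : 0 < e / 4 by rewrite divr_gt0.
  have {}c1 := c1 (fun k => sqrW12_ge0 _ _) _ e4.
  have {}c2 := c2 (fun k => sqrW12_ge0 _ _) _ e4.
  apply: filterS (filterI c1 c2) => k [h1 h2].
  have n1 := smooth_cbW12 0 r (sphi k); have n2 := smooth_cbW12 0 r (tpsi k).1.
  have [_ _ w1 l1] := n1; have [_ _ w2 l2] := n2.
  have I1 := cbW12_L1 n1; have I2 := cbW12_L1 n2.
  have J1 i := cbW12_L1g i n1; have J2 i := cbW12_L1g i n2.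
  pose d1 i x := 'D_(unitv R i) (phi k) x - p i x.
  pose d2 i x := 'D_(unitv R i) (psi k) x - g i x.
  have W1 i : weak_partial B i (fun x => phi k x - Psi x) (d1 i).
    by apply: weak_partialB.
  have W2 i : weak_partial B i (fun x => psi k x - f x) (d2 i).
    by apply: weak_partialB.
  have M1 : measurable_fun B (fun x => phi k x - Psi x).
    exact: L1_measurable (L1B mB I1 IP).
  have M2 : measurable_fun B (fun x => psi k x - f x).
    exact: L1_measurable (L1B mB I2 If).
  have M3 i : measurable_fun B (d1 i) by exact: L1_measurable (L1B mB (J1 i) (Ip i)).
  have M4 i : measurable_fun B (d2 i) by exact: L1_measurable (L1B mB (J2 i) (Ig i)).
  have -> : (fun x => phi k x + psi k x - (Psi x + f x)) =
      (fun x => (phi k x - Psi x) + (psi k x - f x)).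
    by apply/funext => x; ring.
  rewrite (@sqrW12_weak _ _ _ _ _ (fun i x => d1 i x + d2 i x)); last first.
    move=> i; apply: weak_partialD => //; try exact: L1B.
  move: h1 h2; rewrite (sqrW12_weak W1) (sqrW12_weak W2) => h1 h2.
  apply: (@le_trans _ _ (2%:E * (sqrL2 B (fun x => (phi k x - Psi x)%R) + \sum_(i < n) sqrL2 B (d1 i)) +
     2%:E * (sqrL2 B (fun x => (psi k x - f x)%R) + \sum_(i < n) sqrL2 B (d2 i)))%E); last first.
    have -> : e%:E = (2%:E * (e / 4)%:E + 2%:E * (e / 4)%:E)%E.
      by rewrite -!EFinM -EFinD; congr EFin; field.
    by apply: leeD; apply: lee_wpmul2l.
  have S0 h (s : 'I_n -> 'rV[R]_n -> R) : (0 <= \sum_(i < n) sqrL2 B (s i))%E.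
    by apply: sume_ge0 => i _; exact: sqrL2_ge0.
  have distr (A S C T : \bar R) : (0 <= A)%E -> (0 <= S)%E -> (0 <= C)%E -> (0 <= T)%E ->
      (2%:E * (A + S) + 2%:E * (C + T) = (2%:E * A + 2%:E * C) + (2%:E * S + 2%:E * T))%E.
    by move=> A0 s0 C0 T0; rewrite !ge0_muleDr// addeACA.
  rewrite distr ?sqrL2_ge0 ?S0//; apply: leeD; first exact: sqrL2_add.
  have sumZ (s : 'I_n -> 'rV[R]_n -> R) :
      (2%:E * \sum_(i < n) sqrL2 B (s i) = \sum_(i < n) 2%:E * sqrL2 B (s i))%E.
    by rewrite ge0_sume_distrr// => i _; exact: sqrL2_ge0.
  rewrite !sumZ -big_split/=; apply: lee_sum => i _; exact: sqrL2_add.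
- rewrite (_ : (fun k => _) = (fun k => sphere_integral r (fun x => (phi k x - cst q x) ^+ 2)))//.
  apply/funext => k; apply: sphere_integral_eq.
  + apply: measurable_funX; apply: measurable_funB => //; apply: measurable_funD.
      by apply: continuous_measurable_rv; apply: smooth_continuous.
    exact: test_function_measurable (tpsi k).
  + apply: measurable_funX; apply: measurable_funB => //.
    by apply: continuous_measurable_rv; apply: smooth_continuous.
  + move=> x xr; have [_ [K [_ KB psi0]]] := tpsi k.
    rewrite (psi0 x) ?addr0// => /KB; rewrite /B /eball/= subr0 xr; by rewrite ltxx.
Qed.

End trace_perturbation.

(** * Boundary values *)

Section radial_difference.
Context {R : realType} {n : nat}.
Implicit Types (f h phi : 'rV[R]_n -> R) (x y : 'rV[R]_n) (k : nat) (i : 'I_n)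
  (r s t : R).

(** The interval is open at [b] because this endpoint will correspond to a point of the sphere,
    which the shell does not contain. *)
Lemma FTC_abs_le (F dF : R -> R) (a b : R) : a < b ->
  (forall t : R, is_derive t (1 : R) F (dF t)) -> continuous dF ->
  (`|F b - F a|%:E <= \int[lebesgue_measure]_(t in `[a, b[) `|dF t|%:E)%E.
Proof.
move=> ab dFE cdF.
have cF := derivable_continuous1 dFE.
have mdF : measurable_fun setT dF by exact: continuous_measurable_fun.
have cdFab : {within `[a, b], continuous dF} by exact: continuous_subspaceT.
have LR : derivable_oo_LRcontinuous F a b.
  split.
  - by move=> t _; exact: (dFE t).(ex_derive).
  - by apply: cvg_at_right_filter; exact: cF.
  - by apply: cvg_at_left_filter; exact: cF.
have E : {in `]a, b[%R, derive1 F =1 dF}.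
  by move=> t _; rewrite derive1E; have [_ ->] := dFE t.
have H := continuous_FTC2 ab cdFab LR E.
rewrite -EFinB in H.
have mE : measurable_fun setT (EFin \o dF) by exact/measurable_EFinP.
rewrite -(@integral_itv_bndo_bndc R (BLeft a) b (fun t => (dF t)%:E)) in H; last first.
  exact: measurable_funTS.
rewrite (_ : `|F b - F a|%:E = `|(F b - F a)%:E|%E)// -H.
have := @le_abse_integral _ _ R lebesgue_measure `[a, b[%classic (EFin \o dF)
  (measurable_itv _).
apply; exact: measurable_funTS.
Qed.

Lemma radial_line_derive phi x : smooth phi ->
  let dF t := \sum_(i < n) 'D_(unitv R i) phi (t *: x) * x ord0 i in
  (forall t : R, is_derive t (1 : R) (fun t => phi (t *: x)) (dF t)) /\ continuous dF.
Proof.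
move=> sphi dF.
have line h t : smooth h ->
    is_derive t (1 : R) (fun t => h (t *: x)) (\sum_(i < n) 'D_(unitv R i) h (t *: x) * x ord0 i).
  move=> sh; have H z := @C1_is_derive R n h z x (fun i y => @smooth_derivable _ _ h i y sh)
    (fun i => @smooth_derive_continuous _ _ h i sh).
  have := @is_derive_line R n h 0 x t _ (H _).
  by rewrite addr0; congr is_derive; apply/funext => u; rewrite addr0.
split=> [t|]; first exact: line.
rewrite (_ : dF = fun t => \sum_(i <- index_enum 'I_n) 'D_(unitv R i) phi (t *: x) * x ord0 i)//.
elim: (index_enum 'I_n) => [|i l IH].
  by under eq_fun do rewrite big_nil; exact: cst_continuous.
under eq_fun do rewrite big_cons.
move=> t; apply: cvgD; last exact: IH.
apply: cvgM; last exact: cvg_cst.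
exact: (derivable_continuous1 (fun t => line _ t (smooth_derive i sphi))).
Qed.

(** The dilation by [t] has Jacobian [t^n >= 1]. *)
Lemma integral_dilation_le h (c t : R) : measurable_fun setT h -> (forall x, 0 <= h x) ->
  0 <= c -> 1 <= t ->
  (\int[leb n]_x (c * h (t *: x))%:E <= c%:E * \int[leb n]_x (h x)%:E)%E.
Proof.
move=> mh h0 c0 t1; have t0 : 0 < t by exact: lt_le_trans t1.
have mht : measurable_fun setT (fun x => h (t *: x)).
  have := measurableT_comp mh (measurable_affine_rv t (0 : 'rV[R]_n)).
  by congr measurable_fun; apply/funext => x /=; rewrite addr0.
have -> := @ge0_integralZ_fin _ _ setT (fun x => h (t *: x)) c measurableT mht c0 (fun x _ => h0 _).
apply: lee_wpmul2l => //.
have tn0 : t != 0 by rewrite gt_eqF.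
have mEh : measurable_fun setT (EFin \o h) by exact/measurable_EFinP.
have Eh0 x : (0 <= (EFin \o h) x)%E by rewrite lee_fin.
have := @ge0_integral_affine R n t 0 (EFin \o h) tn0 mEh Eh0.
under [X in _ = (_ * X)%E -> _]eq_integral do rewrite addr0.
move=> ->.
apply: (@le_trans _ _ (1%:E * \int[leb n]_x (h (t *: x))%:E)%E); first by rewrite mul1e.
rewrite lee_wpmul2r//; first by apply: integral_ge0 => x _; rewrite lee_fin.
by rewrite lee_fin (gtr0_norm t0) exprn_ege1.
Qed.

Definition shell s r : set 'rV[R]_n := eball 0 r `\` eball 0 s.

Lemma measurable_shell s r : measurable (shell s r).
Proof. by apply: measurableD; exact: measurable_eball. Qed.

(** Integrate the derivative of [t -> phi (t x)] from 1 to [r/|x|]; the segment stays in the shell.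
    After Tonelli, each dilate contributes at most the integral over the shell, the range of [t] has
    length at most [r/s - 1], and [|x| <= r]. *)
Lemma radial_difference phi r s : smooth phi -> 0 < s -> s < r ->
  (\int[leb n]_(x in shell s r) `|phi ((r / enorm x) *: x) - phi x|%:E <=
   ((r / s - 1) * r)%:E *
   \sum_(i < n) \int[leb n]_(x in shell s r) `|'D_(unitv R i) phi x|%:E)%E.
Proof.
move=> sphi s0 sr; have r0 : 0 < r by exact: lt_trans sr.
set S := shell s r; have mS : measurable S by exact: measurable_shell.
pose f x := \sum_(i < n) `|'D_(unitv R i) phi x|.
have cd i : continuous (fun x => 'D_(unitv R i) phi x) by exact: smooth_derive_continuous.
have md i : measurable_fun setT (fun x => `|'D_(unitv R i) phi x|).
  by apply: measurable_norm; apply: continuous_measurable_rv.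
have mf : measurable_fun setT f by apply: measurable_sum => i; exact: md.
have f0 x : 0 <= f x by apply: sumr_ge0.
pose h := f \_ S.
have h0 x : 0 <= h x by rewrite /h patchE; case: ifP.
have mh : measurable_fun setT h.
  by apply/(measurable_restrictT _ mS); exact: measurable_funTS.
pose H : \bar R := (\int[leb n]_x (h x)%:E)%E.
have HE : H = (\sum_(i < n) \int[leb n]_(x in S) `|'D_(unitv R i) phi x|%:E)%E.
  rewrite -ge0_integral_sum//; last first.
    by move=> i; apply/measurable_EFinP; exact: measurable_funTS.
  rewrite /H [RHS]integral_mkcond; apply: eq_integral => x _.
  by rewrite /h !patchE; case: ifP => // _; rewrite /f sumEFin.
have H0 : (0 <= H)%E by apply: integral_ge0 => x _; rewrite lee_fin.
rewrite -HE.
pose T := r / s.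
have T1 : 1 < T by rewrite ltr_pdivlMr// mul1r.
(* Exchanging the integrals calls for a range of [t] independent of [x]: [r/|x| <= T] on the shell.
   The factor [r] bounds the coordinates of [x]. *)
pose K (p : 'rV[R]_n * measurableTypeR R) : R := r * (\1_(`[1, T]) p.2 * h (p.2 *: p.1)).
have K0 p : 0 <= K p by rewrite mulr_ge0 ?(ltW r0)// mulr_ge0.
have mI : measurable_fun setT (\1_(`[1, T]) : measurableTypeR R -> R).
  by apply: measurable_indic; exact: measurable_itv.
have mK : measurable_fun setT K.
  apply: measurable_funM => //; apply: measurable_funM.
    exact: (measurableT_comp mI measurable_snd).
  apply: (measurableT_comp mh).
  exact: (measurableT_comp (@measurable_scale_rv R n)
    (measurable_fun_pair (@measurable_snd _ _ 'rV[R]_n (measurableTypeR R)) measurable_fst)).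
have mEK : measurable_fun setT (EFin \o K) by exact/measurable_EFinP.
have EK0 p : (0 <= (EFin \o K) p)%E by rewrite lee_fin.
have mKx := @measurable_fun_fubini_tonelli_F _ _ _ _ R (@lebesgue_measure R) (EFin \o K) mEK EK0.
apply: (@le_trans _ _ (\int[leb n]_x \int[lebesgue_measure]_t (EFin \o K) (x, t))%E).
  apply: (@le_trans _ _ (\int[leb n]_(x in S) \int[lebesgue_measure]_t (EFin \o K) (x, t))%E); last first.
    by apply: ge0_subset_integral => // x _; apply: integral_ge0 => t _.
  apply: ge0_le_integral => //.
  - apply/measurable_EFinP; apply: measurable_norm; apply: measurable_funB.
      have mp : measurable_fun setT phi.
        by apply: continuous_measurable_rv; exact: smooth_continuous.
      by apply: (measurableT_comp mp); exact: sphere_proj_measurable.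
    by apply: measurable_funTS; apply: continuous_measurable_rv; exact: smooth_continuous.
  - exact: measurable_funTS.
  - move=> x [xr xs].
    have {}xr : enorm x < r by move: xr; rewrite /eball/= subr0.
    have {}xs : s <= enorm x by move: xs => /negP; rewrite -leNgt subr0.
    have x0 : 0 < enorm x by exact: lt_le_trans xs.
    pose b := r / enorm x.
    have b1 : 1 < b by rewrite ltr_pdivlMr// mul1r.
    have bT : b <= T by rewrite ler_wpM2l ?(ltW r0)// lef_pV2.
    have [dF cdF] := radial_line_derive x sphi.
    have := FTC_abs_le b1 dF cdF; rewrite scale1r => /le_trans; apply.
    apply: (@le_trans _ _ (\int[lebesgue_measure]_(t in `[1%R, b[) (K (x, t))%:E)%E).
      apply: ge0_le_integral => //.
      + apply/measurable_EFinP; apply: measurable_norm.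
        by apply: measurable_funTS; exact: continuous_measurable_fun.
      + apply: measurable_funTS.
        exact: (measurableT_comp mEK (measurable_pair1 x)).
      + move=> t; rewrite /= in_itv/= => /andP[t1 tb].
        have tS : S (t *: x).
          split; rewrite /eball/= subr0 enormZ gtr0_norm ?(lt_le_trans ltr01)//.
            by rewrite -ltr_pdivlMr.
          by apply/negP; rewrite -leNgt (le_trans xs)// ler_peMl// ltW.
        rewrite lee_fin /K/= indicE mem_set ?mul1r; last first.
          by rewrite /= in_itv/= t1 (le_trans (ltW tb)).
        rewrite /h patchE mem_set// /f big_distrr/= (le_trans (ler_norm_sum _ _ _))//.
        apply: ler_sum => i _; rewrite normrM mulrC ler_wpM2r//.
        by rewrite (le_trans (coord_le_enorm x i))// ltW.
    apply: (@ge0_subset_integral _ (measurableTypeR R) R (@lebesgue_measure R) `[1, b[%classic setT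
      (measurable_itv _) measurableT (fun t => (K (x, t))%:E)) => //.
    - exact: (measurableT_comp mEK (measurable_pair1 x)).
    - by move=> t _; rewrite lee_fin.
have -> := @fubini_tonelli _ _ _ _ R (@leb R n) (@lebesgue_measure R) (EFin \o K) mEK EK0.
apply: (@le_trans _ _ (\int[lebesgue_measure]_t ((r * \1_(`[1%R, T]) t)%:E * H))%E); last first.
  rewrite ge0_integralZr//; last 2 first.
  - by apply/measurable_EFinP; apply: measurable_funM.
  - by move=> t _; rewrite lee_fin mulr_ge0// ltW.
  rewrite lee_wpmul2r//.
  under eq_integral do rewrite EFinM.
  rewrite ge0_integralZl//; last 2 first.
  - exact/measurable_EFinP.
  - by rewrite lee_fin ltW.
  rewrite integral_indic//= setIT lebesgue_measure_itv/= lte_fin T1 -EFinB -EFinM lee_fin.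
  by rewrite mulrC.
apply: ge0_le_integral => //.
- by move=> t _; apply: integral_ge0 => x _.
- by have := @measurable_fun_fubini_tonelli_G _ _ _ _ R (@leb R n) (EFin \o K) mEK EK0.
- apply: emeasurable_funM; last exact: measurable_cst.
  by apply/measurable_EFinP; exact: measurable_funM.
- move=> t _; rewrite /K/= indicE.
  case: (boolP (t \in `[1, T]%classic)) => [|_]; last first.
    rewrite mulr0 mul0e; under eq_integral do rewrite mul0r mulr0.
    by rewrite integral0.
  rewrite inE/= in_itv/= => /andP[t1 tT].
  rewrite mulr1; under eq_integral do rewrite mul1r.
  exact: integral_dilation_le (ltW r0) t1.
Qed.

(** Pointwise [|f| <= eta + f^2/eta]. With [eta = e/(2(V + 1))], [V] the measure of [D], the
    constant contributes at most [e/2], and [d = eta e/2] makes the other term at most [e/2]. *)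
Lemma L1_small D (e : R) : measurable D -> (leb n D < +oo)%E -> 0 < e ->
  exists2 d : R, 0 < d & forall f, measurable_fun D f -> (sqrL2 D f <= d%:E)%E ->
    (\int[leb n]_(x in D) `|f x|%:E <= e%:E)%E.
Proof.
move=> mD fD e0; pose V := fine (leb n D).
have V0 : 0 <= V by exact: fine_ge0.
have VE : leb n D = V%:E by rewrite fineK// ge0_fin_numE.
pose eta := e / (2 * (V + 1)).
have eta0 : 0 < eta by rewrite divr_gt0// mulr_gt0// ltr_wpDl.
exists (eta * (e / 2)); first by rewrite mulr_gt0// divr_gt0.
move=> f mf fd.
apply: (@le_trans _ _ (\int[leb n]_(x in D) (cst eta x)%:E + \int[leb n]_(x in D) (eta^-1 * f x ^+ 2)%:E)%E).
  apply: ge0_integral_le_add => //.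
  - exact: measurable_norm.
  - by apply: measurable_funM => //; exact: measurable_funX.
  - by move=> x _; exact: ltW.
  - by move=> x _; rewrite mulr_ge0 ?sqr_ge0// invr_ge0 ltW.
  - move=> x _ /=; rewrite -(real_normK (num_real (f x))).
    set t := `|f x|; rewrite -(ler_pM2l eta0) mulrDr mulVKf ?gt_eqF//.
    have := sqr_ge0 (t - eta); have := sqr_ge0 t; have := sqr_ge0 eta.
    have : 0 <= t by exact: normr_ge0.
    nra.
rewrite [X in (_ + X)%E]ge0_integralZ_fin//; last 3 first.
- exact: measurable_funX.
- by rewrite invr_ge0 ltW.
- by move=> x _; exact: sqr_ge0.
apply: (@le_trans _ _ ((eta * V)%:E + (eta^-1 * (eta * (e / 2)))%:E)%E).
  apply: leeD; last by rewrite EFinM lee_wpmul2l// lee_fin invr_ge0 ltW.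
  have -> : (\int[leb n]_(x in D) (cst eta x)%:E = \int[leb n]_(x in D) cst eta%:E x)%E by [].
  rewrite integral_cst// [leRHS]EFinM lee_wpmul2l ?lee_fin ?(ltW eta0)//.
  by have := lexx V%:E; rewrite -{1}VE.
rewrite -EFinD lee_fin mulKf ?gt_eqF// [leRHS](splitr e) lerD2r /eta.
rewrite mulrAC ler_pdivrMr ?mulr_gt0 ?ltr_wpDl//.
have -> : e / 2 * (2 * (V + 1)) = e * V + e by field.
by rewrite lerDl ltW.
Qed.

End radial_difference.

(** * Pointwise boundary values from the trace *)

Section boundary_values.
Context {R : realType} {n : nat}.
Implicit Types (f h phi : 'rV[R]_n -> R) (x y : 'rV[R]_n) (k : nat) (i : 'I_n)
  (s t : R).

Lemma within_continuous_dist (V : normedModType R) (A : set 'rV[R]_n) (F : 'rV[R]_n -> V) x (e : R) :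
  {within A, continuous F} -> A x -> 0 < e ->
  exists2 d : R, 0 < d & forall y, A y -> enorm (y - x) < d -> `|F x - F y| < e.
Proof.
move=> /subspace_continuousP cF Ax e0.
have /cvgrPdist_lt/(_ e e0) := cF x Ax.
move=> /nbhs_ballP[d /= d0 Hd]; exists d => // y Ay yx.
apply: Hd => //; rewrite -ball_normE/= distrC.
exact: le_lt_trans (norm_le_enorm _) yx.
Qed.

Context (hn : (0 < n)%N) (r : R) (r0 : 0 < r) (q : R) (Psi : 'rV[R]_n -> R)
  (p : 'I_n -> 'rV[R]_n -> R).
Let B : set 'rV[R]_n := eball 0 r.
Let mB : measurable B. Proof. exact: measurable_eball. Qed.
Let fB : (leb n B < +oo)%E. Proof. exact: leb_eball_lty. Qed.
Context (Psi_A : A_ball q r Psi) (p_weak : forall i, weak_partial B i Psi (p i))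
  (p_L2 : forall i, L2 B (p i)).

(* Compare [Psi] with its smooth approximations [phi k] on the shell and [phi k]
   with its radial projection, whose distance to [q] is controlled by the trace. *)
Lemma trace_shell_bound s (c : R) (E : set 'rV[R]_n) : 0 < s -> s < r -> 0 <= c ->
  measurable E -> E `<=` shell s r -> (forall x, E x -> c <= `|Psi x - q|) ->
  (c%:E * leb n E <= ((r / s - 1) * r)%:E *
    \sum_(i < n) \int[leb n]_(x in shell s r) `|p i x|%:E)%E.
Proof.
move=> s0 sr c0 mE ES cE.
set S := shell s r; have mS : measurable S by exact: measurable_shell.
have SB : S `<=` B by move=> x [].
have [[mP P2 _] [phi [sphi cphi tphi]]] := Psi_A.
have LP : L2 B Psi by [].
have IP := L2_L1 mB fB LP; have Ip i := L2_L1 mB fB (p_L2 i).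
pose T := (r / s - 1) * r.
have T0 : 0 <= T.
  by rewrite mulr_ge0 ?(ltW r0)// subr_ge0 ler_pdivlMr// mul1r ltW.
have sub_le f : measurable_fun B f ->
    (\int[leb n]_(x in S) `|f x|%:E <= \int[leb n]_(x in B) `|f x|%:E)%E.
  move=> mf; apply: ge0_subset_integral => //.
  by apply/measurable_EFinP; exact: measurable_norm.
apply/lee_addgt0Pr => e e0.
(* One error [e1] for the projection against [q], one for [phi k - Psi], and [T] times one for each
   of the [n] partial derivatives. *)
pose e1 := e / (2 + T * n%:R).
have D0 : 0 < 2 + T * n%:R by rewrite ltr_wpDr// mulr_ge0.
have e10 : 0 < e1 by rewrite divr_gt0.
have [d d0 Hd] := L1_small mB fB e10.
have dn0 : 0 < n%:R / r * d by rewrite mulr_gt0// divr_gt0// ltr0n.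
have /(cvge0P (fun k => sqrW12_ge0 _ _)).1 /(_ d d0) c1 := cphi.
have si_ge0 k : (0 <= sphere_integral r (fun x => ((phi k x - cst q x) ^+ 2)%R))%E.
  rewrite mule_ge0//; first by rewrite lee_fin divr_ge0// ltW.
  by apply: integral_ge0 => x _; rewrite lee_fin sqr_ge0.
have /(cvge0P si_ge0).1 /(_ _ dn0) c2 := tphi.
have [k _ /(_ k (leqnn k)) [h1 h2]] := filterI c1 c2.
have np := smooth_cbW12 0 r (sphi k); have [_ _ wp l2p] := np.
have Iphi := cbW12_L1 np; have Idphi i := cbW12_L1g i np.
have mphi : measurable_fun setT (phi k).
  by apply: continuous_measurable_rv; exact: smooth_continuous.
have W i : weak_partial B i (fun x => phi k x - Psi x)
    (fun x => 'D_(unitv R i) (phi k) x - p i x).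
  by apply: weak_partialB.
move: h1; rewrite (sqrW12_weak W) => h1.
have k1 : (\int[leb n]_(x in B) `|phi k x - Psi x|%:E <= e1%:E)%E.
  apply: Hd; first exact: L1_measurable (L1B mB Iphi IP).
  by apply: le_trans h1; rewrite leeDl// sume_ge0// => i _; exact: sqrL2_ge0.
have k2 i : (\int[leb n]_(x in B) `|'D_(unitv R i) (phi k) x - p i x|%:E <= e1%:E)%E.
  apply: Hd; first exact: L1_measurable (L1B mB (Idphi i) (Ip i)).
  apply: le_trans h1; rewrite (bigD1 i)//= addeCA leeDl// adde_ge0 ?sqrL2_ge0//.
  by apply: sume_ge0 => j _; exact: sqrL2_ge0.
have mpj : measurable_fun B (fun x => phi k ((r / enorm x) *: x)).
  by apply: (measurableT_comp mphi); exact: sphere_proj_measurable.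
have k3 : (\int[leb n]_(x in B) `|phi k ((r / enorm x) *: x) - q|%:E <= e1%:E)%E.
  apply: Hd; first exact: measurable_funB.
  move: h2; rewrite /sphere_integral [leRHS]EFinM lee_pmul2l//.
  by rewrite lte_fin divr_gt0// ltr0n.
have mpS : measurable_fun S (phi k) by exact: measurable_funTS.
have mPS : measurable_fun S Psi by exact: measurable_funS mP.
have mpjS : measurable_fun S (fun x => phi k ((r / enorm x) *: x)) by exact: measurable_funS mpj.
apply: (@le_trans _ _ (\int[leb n]_(x in S) `|Psi x - q|%:E)%E).
  rewrite -(integral_cst (leb n) mE c%:E).
  apply: (@le_trans _ _ (\int[leb n]_(x in E) `|Psi x - q|%:E)%E).
    apply: ge0_le_integral => //.
    by apply/measurable_EFinP; apply: measurable_norm; apply: measurable_funB => //; exact: measurable_funS mPS.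
  apply: ge0_subset_integral => //.
  by apply/measurable_EFinP; apply: measurable_norm; exact: measurable_funB.
apply: (@le_trans _ _ (\int[leb n]_(x in S) `|phi k ((r / enorm x) *: x) - q|%:E +
   \int[leb n]_(x in S) (`|phi k ((r / enorm x) *: x) - phi k x| + `|phi k x - Psi x|)%:E)%E).
  apply: ge0_integral_le_add => //.
  - by apply: measurable_norm; exact: measurable_funB.
  - by apply: measurable_norm; exact: measurable_funB.
  - by apply: measurable_funD; apply: measurable_norm; exact: measurable_funB.
  - move=> x _; set z := phi k (_ *: _).
    have -> : Psi x - q = (z - q) - (z - phi k x) - (phi k x - Psi x) by ring.
    by rewrite addrA (le_trans (ler_normB _ _))// lerD2r ler_normB.
have S3 := le_trans (sub_le _ (measurable_funB mpj (measurable_cst q))) k3.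
have S1 : (\int[leb n]_(x in S) `|phi k x - Psi x|%:E <= e1%:E)%E.
  by apply: le_trans (sub_le _ _) k1; exact: L1_measurable (L1B mB Iphi IP).
apply: (@le_trans _ _ (e1%:E + (T%:E * \sum_(i < n) (\int[leb n]_(x in S) `|p i x|%:E + e1%:E) + e1%:E))%E).
  apply: leeD => //.
  apply: (@le_trans _ _ (\int[leb n]_(x in S) `|phi k ((r / enorm x) *: x) - phi k x|%:E +
     \int[leb n]_(x in S) `|phi k x - Psi x|%:E)%E).
    apply: ge0_integral_le_add => //.
    - by apply: measurable_funD; apply: measurable_norm; exact: measurable_funB.
    - by apply: measurable_norm; exact: measurable_funB.
    - by apply: measurable_norm; exact: measurable_funB.
  apply: leeD => //.
  apply: (le_trans (radial_difference (sphi k) s0 sr)).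
  apply: lee_wpmul2l; first by rewrite lee_fin.
  apply: lee_sum => i _.
  have md : measurable_fun S (fun x => 'D_(unitv R i) (phi k) x).
    exact: measurable_funS (L1_measurable (Idphi i)).
  have mp : measurable_fun S (p i) by exact: measurable_funS (p_L2 i).1.
  apply: (@le_trans _ _ (\int[leb n]_(x in S) `|p i x|%:E +
     \int[leb n]_(x in S) `|'D_(unitv R i) (phi k) x - p i x|%:E)%E).
    apply: ge0_integral_le_add => //.
    - exact: measurable_norm.
    - exact: measurable_norm.
    - by apply: measurable_norm; exact: measurable_funB.
    - move=> x _; rewrite -{1}(subrK (p i x) ('D_(unitv R i) (phi k) x)) addrC.
      exact: ler_normD.
  rewrite leeD2l//; apply: le_trans (sub_le _ _) (k2 i).
  exact: L1_measurable (L1B mB (Idphi i) (Ip i)).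
rewrite big_split/= sumEFin sumr_const card_ord ge0_muleDr//; last 2 first.
- by apply: sume_ge0 => i _; apply: integral_ge0 => x _; rewrite lee_fin.
- by rewrite lee_fin mulrn_wge0// ltW.
set I := (T%:E * \sum_(i < n) _)%E.
rewrite addeC -!addeA leeD2l// -EFinM -!EFinD lee_fin.
have -> : T * (e1 *+ n) + (e1 + e1) = e1 * (2 + T * n%:R) by rewrite -mulr_natr; ring.
by rewrite /e1 divfK// gt_eqF.
Qed.

Context (Psi_cont : {within ecball 0 r, continuous Psi}).

(* If [|Psi - q| >= c] near [x], then [c] times the measure of a conical piece of
   the shell, which is comparable to the width of the shell, is bounded by that
   width times the integral of [|D Psi|] over the shell, which tends to [0]. *)
Lemma boundary_value x : enorm x = r -> Psi x = q.
Proof.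
move=> xr; apply: contrapT => /eqP Pq.
pose c := `|Psi x - q| / 2.
have c0 : 0 < c by rewrite divr_gt0// normr_gt0 subr_eq0.
have Bx : ecball 0 r x by rewrite /ecball/= subr0 xr.
have [d d0 Hd] := within_continuous_dist Psi_cont Bx c0.
have cP y : ecball 0 r y -> enorm (y - x) < d -> c <= `|Psi y - q|.
  move=> By yx; have := Hd y By yx.
  have := ler_distD (Psi y) (Psi x) q; rewrite {2}/c.
  rewrite -/c; have : `|Psi x - q| = c * 2 by rewrite divfK.
  lra.
(* The open cone over the cap of radius [d/2] around [x], within the ball. Away from the origin
   membership depends only on direction, so dilations preserve the cone. *)
pose C : set 'rV[R]_n := B `&` (fun y => (r / enorm y) *: y) @^-1` eball x (d / 2).
have mC : measurable C.
  apply: measurableI => //; rewrite -[X in measurable X]setTI.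
  by apply: (@sphere_proj_measurable R n r setT) => //; exact: measurable_eball.
have proj_norm y : y != 0 -> enorm ((r / enorm y) *: y) = r.
  move=> y0; rewrite enormZ normrM normfV (ger0_norm (enorm_ge0 y)) gtr0_norm//.
  by rewrite mulfVK//; apply: contra_neq y0 => /enorm_eq0.
have proj_dist y : y != 0 -> enorm y <= r -> enorm (y - (r / enorm y) *: y) = r - enorm y.
  move=> y0 yr.
  have e0 : enorm y != 0 by apply: contra_neq y0 => /enorm_eq0.
  have ep : 0 < enorm y by rewrite lt0r e0 enorm_ge0.
  rewrite -[X in enorm (X - _)]scale1r -scalerBl enormZ -normrN opprB ger0_norm; last first.
    by rewrite subr_ge0 ler_pdivlMr// mul1r.
  by rewrite mulrBl mul1r divfK.
have C0 : (0 < leb n C)%E.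
  (* A point of the ball within [eta] of [x] is at distance less than [eta] from its projection,
     which is then within [2 eta <= d/2] of [x]; [eta <= r] keeps the origin away. The point
     [t *: x] lies inside the ball at distance [eta/2] from [x]. *)
  pose eta := Num.min (d / 4) r.
  have eta0 : 0 < eta by rewrite lt_min divr_gt0.
  pose t := 1 - eta / (2 * r).
  have tr : eta / (2 * r) * r = eta / 2 by field; rewrite gt_eqF.
  have t0 : 0 < eta / (2 * r) by rewrite divr_gt0// mulr_gt0.
  have t1 : eta / (2 * r) < 1.
    by rewrite ltr_pdivrMr ?mulr_gt0// mul1r (@le_lt_trans _ _ r)// ?ge_min ?lexx ?orbT// ltr_pMl// ltr1n.
  have oU : open (B `&` eball x eta) by apply: openI; exact: eball_open.
  have Uz : (B `&` eball x eta) (t *: x).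
    split; rewrite /B /eball/=.
      rewrite subr0 enormZ xr gtr0_norm ?subr_gt0//.
      by rewrite /t mulrBl mul1r tr ltrBlDr ltrDl divr_gt0.
    rewrite -[X in _ - X]scale1r -scalerBl enormZ xr /t addrAC subrr sub0r normrN.
    by rewrite gtr0_norm// tr ltr_pdivrMr// ltr_pMr// ltr1n.
  apply: (lt_le_trans (leb_open_gt0 oU Uz)).
  apply: le_measure; rewrite ?inE//; first by apply: open_rv_measurable.
  move=> y [By]; rewrite /eball/= => yx; split => //=.
  have {}By : enorm y < r by move: By; rewrite /B /eball/= subr0.
  have y0 : y != 0.
    apply/eqP => y0; move: yx; rewrite y0 sub0r enormN xr lt_min ltxx.
    by rewrite andbF.
  have h1 : enorm (y - (r / enorm y) *: y) = r - enorm y by apply: proj_dist => //; exact: ltW.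
  have h2 : r - enorm y <= enorm (y - x).
    by rewrite -xr enormB (le_trans (ler_norm _))// enorm_dist.
  have h3 : eta <= d / 4 by rewrite ge_min lexx.
  have h4 : enorm ((r / enorm y) *: y - x) <= enorm (y - (r / enorm y) *: y) + enorm (y - x).
    rewrite -[_ - x](subrKA y) (enormB y (_ *: y)); exact: enorm_triangle.
  rewrite /eball/=; lra.
have fC : (leb n C < +oo)%E.
  by apply: le_lt_trans fB; apply: le_measure; rewrite ?inE// => y [].
pose V := fine (leb n C).
have VE : leb n C = V%:E by rewrite fineK// ge0_fin_numE.
have V0 : 0 < V by rewrite -lte_fin -VE.
(* The cone below radius [s] is the dilate of [C] by [s/r], of measure [(s/r)^n V <= (s/r) V] since
   [n >= 1]. *)
have scal s : 0 < s -> s < r -> (leb n (C `\` eball 0%R s) >= ((1 - s / r) * V)%:E)%E.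
  move=> s0 sr.
  have ms : measurable (eball (0 : 'rV[R]_n) s) by exact: measurable_eball.
  rewrite measureD//= VE.
  have sr1 : s / r != 0 by rewrite mulf_neq0// ?invr_eq0 gt_eqF.
  have srp : 0 < s / r by rewrite divr_gt0.
  have := leb_affine 0 sr1 (measurableI _ _ mC ms).
  have -> : (fun y : 'rV[R]_n => (s / r) *: y + 0) @^-1` (C `&` eball 0 s) = C.
    have E y : (r / enorm ((s / r) *: y)) *: ((s / r) *: y) = (r / enorm y) *: y.
      have [->|y0] := eqVneq y 0; first by rewrite !scaler0.
      have e0 : enorm y != 0 by apply: contra_neq y0 => /enorm_eq0.
      rewrite enormZ (gtr0_norm srp) scalerA; congr (_ *: _).
      by field; rewrite e0 !gt_eqF.
    have Ebs y : (enorm ((s / r) *: y) < s) = (enorm y < r).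
      by rewrite enormZ (gtr0_norm srp) mulrAC ltr_pdivrMr// ltr_pM2l.
    apply/seteqP; split => y /=.
      by rewrite addr0 /C /= E /B /eball/= !subr0 Ebs => -[[_ ?] ?].
    rewrite addr0 /C /= E /B /eball/= !subr0 Ebs => -[yr yx]; split => //; split => //.
    by rewrite (lt_trans _ sr)// Ebs.
  rewrite VE => ->; rewrite (gtr0_norm srp) -EFinM -EFinB lee_fin mulrBl mul1r lerD2l lerN2.
  rewrite ler_wpM2r// ?(ltW V0)// -[leRHS]expr1 ler_wiXn2l//.
  - exact: ltW.
  - by rewrite ler_pdivrMr// mul1r ltW.
pose P y := \sum_(i < n) `|p i y|.
have Ip i : L1 B (p i) by exact: L2_L1.
have IP : L1 B P.
  have : L2 B P by apply: L2_sum => // i; exact: L2_norm.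
  exact: L2_L1.
have mP := L1_measurable IP.
(* The factor [r - s] occurs on both sides, as [1 - s/r = (r - s)/r] and [r/s - 1 = (r - s)/s], and
   is divided out; [s >= r/2] bounds [1/s] by [2/r]. The condition [s >= r - d/2] puts the cone over
   the shell within [d] of [x]. *)
have key s : 0 < s -> s < r -> r / 2 <= s -> r - d / 2 <= s ->
    ((c * V)%:E <= (2 * r)%:E * \int[leb n]_(y in shell s r) (P y)%:E)%E.
  move=> s0 sr sr2 srd.
  have mE : measurable (C `\` eball 0%R s) by apply: measurableD => //; exact: measurable_eball.
  have ES : C `\` eball 0%R s `<=` shell s r by move=> y [[]].
  have cE y : (C `\` eball 0%R s) y -> c <= `|Psi y - q|.
    move=> [[By yC] ys].
    have {}By : enorm y < r by move: By; rewrite /B /eball/= subr0.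
    have {}ys : s <= enorm y by move: ys => /negP; rewrite -leNgt subr0.
    apply: cP; first by rewrite /ecball/= subr0 ltW.
    have y0 : y != 0 by apply/eqP => y0; move: ys; rewrite y0 enorm0 leNgt s0.
    have h1 : enorm (y - (r / enorm y) *: y) = r - enorm y by apply: proj_dist => //; exact: ltW.
    have h4 : enorm (y - x) <= enorm (y - (r / enorm y) *: y) + enorm ((r / enorm y) *: y - x).
      by rewrite -[y - x](subrKA ((r / enorm y) *: y)); exact: enorm_triangle.
    move: yC; rewrite /eball/=; lra.
  have mS := @measurable_shell R n s r.
  have SB : shell s r `<=` B by move=> y [].
  have := trace_shell_bound s0 sr (ltW c0) mE ES cE.
  rewrite -ge0_integral_sum//; last first.
    by move=> i; apply/measurable_EFinP; apply: measurable_norm; exact: measurable_funS (p_L2 i).1.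
  under eq_integral do rewrite sumEFin -/(P _).
  set I := (\int[leb n]_(y in _) _)%E => H.
  have If : (I < +oo)%E.
    have : L1 (shell s r) P by apply: integrableS IP.
    case/integrableP => _; congr (_ < _)%E; apply: eq_integral => y _ /=.
    by rewrite ger0_norm// sumr_ge0.
  have I0 : (0 <= I)%E by apply: integral_ge0 => y _; rewrite lee_fin sumr_ge0.
  have IE : I = (fine I)%:E by rewrite fineK// ge0_fin_numE.
  have := le_trans (lee_wpmul2l (_ : (0 <= c%:E)%E) (scal s s0 sr)) H.
  rewrite lee_fin (ltW c0) => /(_ isT).
  rewrite IE -!EFinM !lee_fin; set J := fine I => {}H.
  have J0 : 0 <= J by exact: fine_ge0.
  have sE : 1 - s / r = (r - s) / r by field; rewrite gt_eqF.
  have rE : r / s - 1 = (r - s) / s by field; rewrite gt_eqF.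
  have rs : 0 < r - s by rewrite subr_gt0.
  have E1 : c * ((1 - s / r) * V) = (r - s) * (c * V / r) by rewrite sE; ring.
  have E2 : (r / s - 1) * r * J = (r - s) * (r * J / s) by rewrite rE; ring.
  move: H; rewrite E1 E2 ler_pM2l// => H.
  have := ler_wpM2r (ltW r0) H; rewrite divfK ?gt_eqF// => /le_trans; apply.
  rewrite mulrAC ler_pdivrMr//.
  have : 0 <= r * J by rewrite mulr_ge0// ltW.
  nra.
pose s_ k := r - (r / 2) * k.+1%:R^-1.
have s_r k : s_ k < r by rewrite ltrBlDr ltrDl mulr_gt0// divr_gt0.
have s_2 k : r / 2 <= s_ k.
  have h : k.+1%:R^-1 <= 1 :> R by rewrite invf_le1// ler1n.
  have r2 : 0 < r / 2 by rewrite divr_gt0.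
  rewrite /s_; move: h; set z := k.+1%:R^-1; nra.
have s_0 k : 0 < s_ k by rewrite (lt_le_trans _ (s_2 k))// divr_gt0.
(* Once the integral over the shell is below this threshold, [key] reads [c V <= c V / 2]. *)
have cV : 0 < c * V / (4 * r) by rewrite divr_gt0// mulr_gt0.
have s_cvg : s_ @ \oo --> r.
  have H : s_ @ \oo --> r - (r / 2) * 0.
    by apply: cvgB; [exact: cvg_cst|apply: cvgM; [exact: cvg_cst|exact: cvg_natSinv]].
  by move: H; rewrite mulr0 subr0.
have [||||_ H] := @dct_abs _ _ R (leb n) B (fun k y => P y * \1_(shell (s_ k) r) y)
    (cst 0) P mB.
- move=> k; apply: measurable_funM => //; apply: measurable_1; exact: measurable_shell.
- move=> y By; apply: cvg_near_cst.
  have {}By : enorm y < r by move: By; rewrite /B /eball/= subr0.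
  have /cvgrPdist_lt /(_ (r - enorm y)) := s_cvg; rewrite subr_gt0 => /(_ By).
  apply: filterS => k; rewrite gtr0_norm ?subr_gt0// => ks.
  rewrite indicE memNset ?mulr0// => -[_ /negP]; rewrite -leNgt subr0; lra.
- exact: IP.
- move=> k y _; rewrite normrM ger0_norm ?sumr_ge0// ler_piMr ?sumr_ge0//.
  by rewrite indicE; case: (y \in _); rewrite ?normr1 ?normr0.
have d2 : 0 < d / 2 by rewrite divr_gt0.
have /cvgrPdist_lt /(_ _ d2) s_d := s_cvg.
have [k _ /(_ k (leqnn k)) [k1 k2]] := filterI (H _ cV) s_d.
have k3 : r - d / 2 <= s_ k.
  by move: k2; rewrite gtr0_norm ?subr_gt0// => ?; lra.
have := key (s_ k) (s_0 k) (s_r k) (s_2 k) k3.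
have mS := @measurable_shell R n (s_ k) r.
have E : (\int[leb n]_(y in shell (s_ k) r) (P y)%:E =
    \int[leb n]_(y in B) `|P y * \1_(shell (s_ k) r) y - cst 0 y|%:E)%E.
  rewrite (@ge0_integral_eq0_off _ _ _ (leb n) B (shell (s_ k) r))//.
  - apply: eq_integral => y yS; rewrite indicE yS mulr1 subr0 ger0_norm//.
    exact: sumr_ge0.
  - by move=> y [].
  - by move=> y _ yS; rewrite indicE memNset// mulr0 subr0 normr0.
rewrite E => /le_trans /(_ (lee_wpmul2l _ k1)).
rewrite lee_fin mulr_ge0// ?(ltW r0)// => /(_ isT).
rewrite -EFinM lee_fin.
have -> : 2 * r * (c * V / (4 * r)) = c * V / 2 by field; rewrite gt_eqF.
have := mulr_gt0 c0 V0; lra.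
Qed.

End boundary_values.

(** * Comparison functions *)

Section comparison_functions.
Context {R : realType} {n : nat} (hn : (0 < n)%N) (r : R) (r0 : 0 < r) (q : R)
  (Psi : 'rV[R]_n -> R) (p : 'I_n -> 'rV[R]_n -> R).
Implicit Types (f h phi : 'rV[R]_n -> R) (x y : 'rV[R]_n) (k : nat) (i : 'I_n)
  (e : R).
Let B : set 'rV[R]_n := eball 0 r.
Let mB : measurable B. Proof. exact: measurable_eball. Qed.
Let fB : (leb n B < +oo)%E. Proof. exact: leb_eball_lty. Qed.
Context (Psi_A : A_ball q r Psi) (p_weak : forall i, weak_partial B i Psi (p i))
  (p_L2 : forall i, L2 B (p i)) (Psi_cont : {within ecball 0 r, continuous Psi}).

Lemma Psi_cbW12 : cbW12 0 r Psi p.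
Proof.
split => //.
- move=> x Bx.
  have /subspace_continuousP cP := Psi_cont.
  have := cP x (eball_sub_ecball Bx); rewrite within_interior//.
  have oB : open B by exact: eball_open.
  rewrite /interior; apply: filterS (@eball_sub_ecball _ _ 0 r) _.
  exact: open_nbhs_nbhs.
- have cn : {within ecball 0 r, continuous (fun x => `|Psi x|)}.
    by move=> x; apply: (@cvg_norm _ _ _ (nbhs x)); exact: Psi_cont.
  have E0 : ecball (0 : 'rV[R]_n) r !=set0.
    by exists 0; rewrite /ecball/= subrr enorm0 ltW.
  have [c _ hc] := EVT_max_rV E0 (@ecball_compact _ _ 0 r) cn.
  by exists `|Psi c| => x /eball_sub_ecball/mem_set/hc.
Qed.

(** The set where [Psi <= q - e] is compact and misses the sphere, where [Psi = q]; hence it lies in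
    a smaller concentric ball. *)
Lemma Psi_gap e : 0 < e -> exists2 rho, rho < r &
  forall x, B x -> ~ ecball 0 rho x -> q - e < Psi x.
Proof.
move=> e0; pose K : set 'rV[R]_n := ecball 0 r `&` [set x | Psi x <= q - e].
have clK : closed K.
  move=> x Kx.
  have Ex : ecball 0 r x.
    by apply: (@ecball_closed R n 0 r) => U /Kx[y [[Ey _] Uy]]; exists y.
  split => //=; rewrite leNgt; apply/negP => qP.
  have d0 : 0 < Psi x - (q - e) by rewrite subr_gt0.
  have [d dp Hd] := within_continuous_dist Psi_cont Ex d0.
  have : nbhs x (eball x d).
    by apply: open_nbhs_nbhs; split; [exact: eball_open|rewrite /eball/= subrr enorm0].
  move=> /Kx[y [[Ey /= Py] yx]].
  have := Hd y Ey yx; have := ler_norm (Psi x - Psi y); lra.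
have cK : compact K.
  by apply: (subclosed_compact clK (@ecball_compact _ _ 0 r)) => x [].
have KB : K `<=` B.
  move=> x [Ex /= Px]; rewrite /B /eball/= lt_neqAle; apply/andP; split => //.
  apply/eqP => xr; move: Px.
  have -> : Psi x = q.
    by apply: (boundary_value hn r0 Psi_A p_weak p_L2 Psi_cont); rewrite -xr subr0.
  by rewrite leNgt ltrBlDr ltrDl e0.
have [rho rr Krho] := compact_sub_concentric cK KB.
exists rho => // x Bx xrho; rewrite ltNge; apply/negP => Px; apply: xrho.
by apply: Krho; split => //; exact: eball_sub_ecball.
Qed.

Section positive_part.
Context (f : 'rV[R]_n -> R) (gf : 'I_n -> 'rV[R]_n -> R) (nf : cbW12 0 r f gf)
  (fq : forall x, B x -> f x <= q).

(** The shift [e] separates the support from the sphere; [e = 0] is the function of interest,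
    obtained as a limit dominated by itself. *)
Definition cut_pos e x := ppos (f x - Psi x - e).
Definition cut_grad e i x := if 0 < f x - Psi x - e then gf i x - p i x else 0.

Lemma cut_cbW12 e : cbW12 0 r (cut_pos e) (cut_grad e).
Proof.
apply: cbW12_ext (cbW12_ppos (cbW12B (cbW12B nf Psi_cbW12) (cbW12_cst 0 r e))) => //.
by move=> i x; rewrite /cut_grad subr0.
Qed.

Lemma cut_support e : 0 < e -> exists2 rho, rho < r &
  forall x, B x -> ~ ecball 0 rho x -> f x - Psi x - e <= 0.
Proof.
move=> /Psi_gap[rho rr H]; exists rho => // x Bx xrho.
have := H x Bx xrho; have := fq Bx; lra.
Qed.

Lemma cut_pos_ge0 e x : 0 <= cut_pos e x.
Proof. exact: ppos_ge0. Qed.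

Lemma cut_pos_le e x : 0 <= e -> cut_pos e x <= cut_pos 0 x.
Proof.
move=> e0; rewrite /cut_pos /ppos subr0 ge_max !le_max lexx/=.
by apply/orP; right; rewrite lerBlDr lerDl.
Qed.

Lemma cut_grad_bound e i x : `|cut_grad e i x| <= `|gf i x - p i x|.
Proof. by rewrite /cut_grad; case: ifP => _; rewrite ?normr0. Qed.

Lemma cut_pos_cvg x : (fun k => cut_pos k.+1%:R^-1 x) @ \oo --> cut_pos 0 x.
Proof.
apply: continuous_cvg; first exact: ppos_continuous.
by apply: cvgB; [exact: cvg_cst|exact: cvg_natSinv].
Qed.

Lemma cut_grad_cvg i x : (fun k => cut_grad k.+1%:R^-1 i x) @ \oo --> cut_grad 0 i x.
Proof.
apply: cvg_near_cst; rewrite /cut_grad subr0; case: ltP => [d0|d0]; last first.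
  near=> k; rewrite ifF//; apply/negbTE; rewrite -leNgt subr_le0.
  by rewrite (le_trans d0).
have := near_infty_natSinv_lt (PosNum d0); apply: filterS => k kd.
by rewrite subr_gt0 ifT.
Unshelve. all: by end_near. Qed.

Lemma cut_wapprox : wapprox 0 r (cut_pos 0) (cut_grad 0).
Proof.
have d0 k : 0 < k.+1%:R^-1 :> R by [].
have [_ _ _ gf2] := nf.
apply: (@wapprox_lim _ _ _ _ (fun k => cut_pos k.+1%:R^-1) (fun k => cut_grad k.+1%:R^-1)
  _ _ (cut_pos 0) (fun i x => `|gf i x - p i x|)).
- move=> k; have [rho rr H] := cut_support (d0 k).
  have nk := cut_cbW12 k.+1%:R^-1; have [_ _ w g2] := nk.
  apply: (wapprox_compact rr) => //; first exact: cbW12_L2 nk.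
    by move=> x Bx xr; rewrite /cut_pos ppos_neg// H.
  by move=> i x Bx xr; rewrite /cut_grad ifF//; apply/negbTE; rewrite -leNgt H.
- by move=> k; exact: cbW12_measurable (cut_cbW12 _).
- by move=> k i; have [_ _ _ g2] := cut_cbW12 k.+1%:R^-1; exact: (g2 i).1.
- exact: cbW12_L2 (cut_cbW12 _).
- by move=> i; apply: L2_norm; exact: L2B.
- by move=> k x Bx; rewrite ger0_norm ?cut_pos_ge0// cut_pos_le.
- by move=> k i x Bx; exact: cut_grad_bound.
- by move=> x _; exact: cut_pos_cvg.
- by move=> i x _; exact: cut_grad_cvg.
Qed.

End positive_part.

Section radial_retraction.
Context {m : nat} (u : 'I_m -> 'rV[R]_n -> R) (g : 'I_m -> 'I_n -> 'rV[R]_n -> R)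
  (nu : forall j, cbW12 0 r (u j) (g j)).

Let rho x := Num.sqrt (\sum_(j < m) u j x ^+ 2).
Let grho i x := (rho x)^-1 * \sum_(j < m) u j x * g j i x.
Context (rho_q : forall x, B x -> rho x <= q) (Psi0 : forall x, B x -> 0 <= Psi x).

Let nrho : cbW12 0 r rho grho. Proof. exact: cbW12_rho. Qed.

(** For [e = 0] this is the part of [u] removed by the radial retraction: the perturbation of [u] up
    to sign. *)
Definition retract_fun e (j : 'I_m) x := cut_pos rho e x * u j x / rho x.
Definition retract_grad e (j : 'I_m) i x :=
  dir_grad u g (cut_pos rho e) (cut_grad rho grho e) j i x.

(** The nonnegativity of [Psi] enters here. It makes the factor of [u / rho] vanish at the zeros of
    [u], as [weak_partial_dir] requires. *)
Let w_rho e x : 0 <= e -> B x -> 0 <= cut_pos rho e x <= rho x.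
Proof.
move=> e0 Bx; rewrite cut_pos_ge0/= /cut_pos /ppos ge_max sqrtr_ge0/=.
have := Psi0 Bx; lra.
Qed.

Let p_rho e i x : 0 <= e -> B x -> rho x = 0 -> cut_grad rho grho e i x = 0.
Proof.
move=> e0 Bx rx; rewrite /cut_grad ifF//; apply/negbTE; rewrite -leNgt rx.
have := Psi0 Bx; lra.
Qed.

Lemma retract_weak e (j : 'I_m) i : 0 <= e ->
  weak_partial B i (retract_fun e j) (retract_grad e j i) /\ L2 B (retract_grad e j i).
Proof.
move=> e0; apply: weak_partial_dir => //.
- exact: cut_cbW12 nrho e.
- by move=> x; exact: w_rho.
- by move=> l x; exact: p_rho.
Qed.

Lemma retract_fun_bound e j x : 0 <= e -> B x -> `|retract_fun e j x| <= cut_pos rho 0 x.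
Proof.
move=> e0 Bx; have /andP[w0 wr] := w_rho e0 Bx.
rewrite /retract_fun -mulrA normrM ger0_norm//.
apply: le_trans (cut_pos_le rho x e0); rewrite ler_piMr// normrM normfV.
have [z|z] := eqVneq (rho x) 0; first by rewrite z normr0 invr0 mulr0.
have rp : 0 < rho x by rewrite lt0r z sqrtr_ge0.
by rewrite (gtr0_norm rp) ler_pdivrMr// mul1r u_le_rho.
Qed.

Lemma retract_fun_L2 e j : 0 <= e -> L2 B (retract_fun e j).
Proof.
(* Measurability of the function is read off from its weak derivative in the first coordinate
   direction, which exists as [n > 0]. *)
move=> e0; have [[[mf _] _ _] _] : weak_partial B _ (retract_fun e j) _ /\ _ :=
  @retract_weak e j (Ordinal hn) e0.
apply: (L2_le mB mf (cbW12_L2 (cut_cbW12 nrho 0))) => x Bx.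
by rewrite (le_trans (retract_fun_bound j e0 Bx))// ler_norm.
Qed.

(** The bound is independent of [e], since [cut_pos / rho] and [u_j / rho] are at most 1 in absolute
    value; it provides the L^2 majorant for the limit [e -> 0]. *)
Lemma retract_grad_bound e j i x : 0 <= e -> B x -> `|retract_grad e j i x| <=
  `|grho i x - p i x| + (`|g j i x| + \sum_(j < m) `|g j i x|).
Proof.
move=> e0 Bx; have /andP[w0 wr] := w_rho e0 Bx.
rewrite /retract_grad /dir_grad.
rewrite -/(rho x).
have [z|z] := eqVneq (rho x) 0.
  have -> : cut_pos rho e x = 0 by apply/eqP; rewrite eq_le w0 -z wr.
  by rewrite p_rho// !mul0r addr0 normr0 !addr_ge0// sumr_ge0.
have rp : 0 < rho x by rewrite lt0r z sqrtr_ge0.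
have ur : `|u j x / rho x| <= 1.
  by rewrite normrM normfV (gtr0_norm rp) ler_pdivrMr// mul1r u_le_rho.
have wr1 : `|cut_pos rho e x / rho x| <= 1.
  by rewrite ger0_norm ?divr_ge0 ?(ltW rp)// ler_pdivrMr// mul1r.
have ug1 : `|(\sum_(l < m) u l x * g l i x) / rho x| <= \sum_(j < m) `|g j i x|.
  rewrite normrM normfV (gtr0_norm rp) ler_pdivrMr// mulrC.
  exact: (@ug_bound _ _ _ u g i x (rho x)).
set S := \sum_(l < m) u l x * _ in ug1 *.
have -> : cut_grad rho grho e i x * u j x / rho x + cut_pos rho e x *
    (g j i x / rho x - u j x * (S / rho x) / rho x ^+ 2) =
  (u j x / rho x) * cut_grad rho grho e i x + ((cut_pos rho e x / rho x) * g j i x -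
    (cut_pos rho e x / rho x) * ((u j x / rho x) * (S / rho x))) by field.
rewrite (le_trans (ler_normD _ _))// lerD//.
  rewrite normrM; apply: le_trans (cut_grad_bound rho grho e i x).
  by rewrite ler_piMl.
rewrite (le_trans (ler_normB _ _))// lerD//.
  by rewrite normrM ler_piMl.
rewrite normrM -[leRHS]mul1r ler_pM// normrM -[leRHS]mul1r ler_pM//.
Qed.

Lemma retract_wapprox j : wapprox 0 r (retract_fun 0 j) (retract_grad 0 j).
Proof.
have d0 k : 0 < k.+1%:R^-1 :> R by [].
have d1 k : 0 <= k.+1%:R^-1 :> R by [].
have [_ _ _ gr2] := nrho.
apply: (@wapprox_lim _ _ _ _ (fun k => retract_fun k.+1%:R^-1 j)
  (fun k => retract_grad k.+1%:R^-1 j) _ _ (cut_pos rho 0)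
  (fun i x => `|grho i x - p i x| + (`|g j i x| + \sum_(j < m) `|g j i x|))).
- move=> k; have [s sr H] := cut_support rho_q (d0 k).
  apply: (wapprox_compact sr) => //.
  + exact: retract_fun_L2.
  + by move=> i; have [] := retract_weak j i (d1 k).
  + by move=> i; have [] := retract_weak j i (d1 k).
  + by move=> x Bx xr; rewrite /retract_fun /cut_pos ppos_neg ?mul0r// H.
  + move=> i x Bx xr; rewrite /retract_grad /dir_grad /cut_pos ppos_neg ?H//.
    by rewrite /cut_grad ifF ?mul0r ?addr0//; apply/negbTE; rewrite -leNgt H.
- by move=> k; exact: (retract_fun_L2 j (d1 k)).1.
- by move=> k i; have [_ [m1 _]] := retract_weak j i (d1 k).
- exact: cbW12_L2 (cut_cbW12 nrho 0).
- move=> i; apply: L2D => //; first by apply: L2_norm; exact: L2B.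
  have gj l : L2 B (fun x => `|g l i x|) by apply: L2_norm; have [_ _ _] := nu l.
  by apply: L2D => //; exact: L2_sum.
- by move=> k x Bx; exact: retract_fun_bound.
- by move=> k i x Bx; exact: retract_grad_bound.
- move=> x _; apply: cvgM; last exact: cvg_cst.
  by apply: cvgM; [exact: cut_pos_cvg|exact: cvg_cst].
- move=> i x _; apply: cvgD.
    apply: cvgM; last exact: cvg_cst.
    by apply: cvgM; [exact: cut_grad_cvg|exact: cvg_cst].
  by apply: cvgM; [exact: cut_pos_cvg|exact: cvg_cst].
Qed.

End radial_retraction.
End comparison_functions.

(** * Translations and measurability *)

Section translation.
Context {R : realType} {n : nat} (a c : 'rV[R]_n) (r : R).
Implicit Types (f h phi : 'rV[R]_n -> R) (x y : 'rV[R]_n) (i : 'I_n)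
  (g : 'I_n -> 'rV[R]_n -> R).
Let B : set 'rV[R]_n := eball a r.
Let B' : set 'rV[R]_n := eball (a + c) r.
Let mB : measurable B. Proof. exact: measurable_eball. Qed.
Let mB' : measurable B'. Proof. exact: measurable_eball. Qed.

Lemma eball_shift x : B' x <-> B (x - c).
Proof. by rewrite /B /B' /eball/= opprD addrA addrAC. Qed.

Lemma measurable_shift f : measurable_fun B f -> measurable_fun B' (fun x => f (x - c)).
Proof.
move=> mf _ Y mY.
have m1 : measurable_fun setT (fun x : 'rV[R]_n => x - c).
  have := measurable_affine_rv 1 (- c); congr measurable_fun.
  by apply/funext => x; rewrite scale1r.
have := m1 measurableT _ (mf mB Y mY); rewrite setTI; congr measurable.
by apply/seteqP; split => x /= [h1 h2]; split => //; apply/eball_shift.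
Qed.

Lemma integral_shift f : measurable_fun B f ->
  (\int[leb n]_(x in B') (f (x - c))%:E = \int[leb n]_(x in B) (f x)%:E)%E.
Proof.
move=> mf.
have E (F : 'rV[R]_n -> \bar R) : measurable_fun B F -> (forall x, 0 <= F x)%E ->
    (\int[leb n]_(x in B') F (x - c)%R = \int[leb n]_(x in B) F x)%E.
  move=> mF F0; rewrite [RHS](@ge0_integral_affineD R n 1 (- c) B F)//.
  rewrite normr1 expr1n mul1e.
  have -> : (fun x => 1 *: x + - c) @^-1` B = B'.
    by apply/seteqP; split => x; rewrite /= scale1r => /eball_shift.
  by apply: eq_integral => x _; rewrite scale1r.
rewrite integralE [RHS]integralE.
have mE : measurable_fun B (EFin \o f) by exact/measurable_EFinP.
rewrite -(E _ (measurable_funepos mE))// -(E _ (measurable_funeneg mE))//.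
by congr (_ - _)%E; apply: eq_integral => x _; rewrite ?funeposE ?funenegE.
Qed.

Lemma sqrL2_shift f : measurable_fun B f ->
  sqrL2 B' (fun x => f (x - c)) = sqrL2 B f.
Proof.
by move=> mf; apply: (@integral_shift (fun x => f x ^+ 2)); exact: measurable_funX.
Qed.

Lemma L2_shift f : L2 B f -> L2 B' (fun x => f (x - c)).
Proof.
by move=> [mf f2]; split; [exact: measurable_shift|rewrite sqrL2_shift].
Qed.

Lemma shift_smooth phi (d : 'rV[R]_n) : smooth phi -> smooth (fun x => phi (x + d)).
Proof.
move=> /(smooth_affine 1 d); congr smooth; apply/funext => x.
by rewrite scale1r.
Qed.

Lemma shift_derive phi (d : 'rV[R]_n) i x : smooth phi ->
  'D_(unitv R i) (fun x => phi (x + d)) x = 'D_(unitv R i) phi (x + d).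
Proof.
move=> sphi; have [_] := derive_affine i 1 d x sphi.
have -> : (fun y => phi (1 *: y + d)) = (fun y => phi (y + d)).
  by apply/funext => y; rewrite scale1r.
by rewrite scale1r mul1r.
Qed.

Lemma shift_test phi (D D' : set 'rV[R]_n) (d : 'rV[R]_n) : (forall x, D' x -> D (x - d)) ->
  test_function D' phi -> test_function D (fun x => phi (x + d)).
Proof.
move=> DD [sphi [K [cK KD phiK]]]; split; first exact: shift_smooth.
exists ((fun x => x - d) @` K); split.
- apply: continuous_compact => //; apply: continuous_subspaceT => x.
  by apply: (@cvgB _ _ _ (nbhs x)); [exact: cvg_id|exact: cvg_cst].
- by move=> _ [x Kx <-]; apply: DD; exact: KD.
- by move=> x Kx; apply: phiK => Kxd; apply: Kx; exists (x + d) => //; rewrite addrK.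
Qed.

Lemma weak_partial_shift i f h : L1 B f -> L1 B h -> weak_partial B i f h ->
  weak_partial B' i (fun x => f (x - c)) (fun x => h (x - c)).
Proof.
move=> If Ih [_ _ H].
have L1s k : L1 B k -> L1 B' (fun x => k (x - c)).
  move=> Ik; have mk := L1_measurable Ik; apply/integrableP; split.
    by apply/measurable_EFinP; exact: measurable_shift.
  have := @integral_shift (fun x => `|k x|) (measurable_norm mk).
  by move=> /= ->; case/integrableP: Ik.
split; [by apply: L1_L1loc => //; exact: L1s|by apply: L1_L1loc => //; exact: L1s|].
move=> phi tphi.
have tphi' : test_function B (fun x => phi (x + c)).
  by apply: shift_test tphi => x /eball_shift.
have mphi D : measurable_fun D (fun x => phi (x + c)) by exact: test_function_measurable tphi'.
have := H _ tphi'; rewrite /Rintegral.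
have E1 : (\int[leb n]_(x in B) (f x * 'D_(unitv R i) (fun x => phi (x + c)) x)%:E =
    \int[leb n]_(x in B') (f (x - c) * 'D_(unitv R i) phi x)%:E)%E.
  rewrite -integral_shift.
    by apply: eq_integral => x _; rewrite shift_derive ?subrK//; exact: tphi.1.
  apply: measurable_funM; first exact: L1_measurable.
  exact: (test_function_measurable (test_function_derive i tphi')).
have E2 : (\int[leb n]_(x in B) (h x * phi (x + c))%:E =
    \int[leb n]_(x in B') (h (x - c) * phi x)%:E)%E.
  rewrite -(@integral_shift (fun x => h x * phi (x + c))).
    by apply: eq_integral => x _; rewrite subrK.
  by apply: measurable_funM; first exact: L1_measurable.
by rewrite E1 E2.
Qed.

Lemma cbW12_shift f g : cbW12 a r f g ->
  cbW12 (a + c) r (fun x => f (x - c)) (fun i x => g i (x - c)).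
Proof.
move=> nf; have [cf [M fM] w g2] := nf; split.
- move=> x /eball_shift Bx; apply: (@continuous_comp _ _ _ (fun x => x - c) f); last exact: cf.
  by apply: (@cvgB _ _ _ (nbhs x)); [exact: cvg_id|exact: cvg_cst].
- by exists M => x /eball_shift; exact: fM.
- by move=> i; apply: weak_partial_shift => //; [exact: cbW12_L1 nf|exact: cbW12_L1g nf].
- by move=> i; exact: L2_shift.
Qed.

Lemma wapprox_shift f g : measurable_fun B f -> (forall i, measurable_fun B (g i)) ->
  wapprox a r f g -> wapprox (a + c) r (fun x => f (x - c)) (fun i x => g i (x - c)).
Proof.
move=> mf mg H e e0; have [phi tphi [h1 h2]] := H e e0.
have mphi : measurable_fun B phi by exact: test_function_measurable tphi.
exists (fun x => phi (x - c)).
  by apply: shift_test tphi => x Bx; apply/eball_shift; rewrite opprK addrK.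
split=> [|i].
  rewrite (@sqrL2_shift (fun x => phi x - f x))//.
  exact: measurable_funB.
have -> : (fun x => 'D_(unitv R i) (fun x => phi (x - c)) x - g i (x - c)) =
    (fun x => (fun x => 'D_(unitv R i) phi x - g i x) (x - c)).
  by apply/funext => x; rewrite shift_derive//; exact: tphi.1.
rewrite (@sqrL2_shift (fun x => 'D_(unitv R i) phi x - g i x))//; apply: measurable_funB => //.
exact: (test_function_measurable (test_function_derive i tphi)).
Qed.

End translation.

(** * Measurability of the potentials, energies in terms of explicit gradients *)

Section measurability_of_potentials.
Context {R : realType} {n : nat}.

Lemma measurable_fun_coordinates (m : nat) (D : set 'rV[R]_n) (F : 'rV[R]_n -> 'rV[R]_m) :
  (forall j, measurable_fun D (vcomp F j)) -> measurable_fun D F.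
Proof.
move=> mF mD; apply: measurability => //.
move=> _ [A + <-]; rewrite -bigcup_seq/= => -[j _ [Y mY <-]].
rewrite setTI; exact: (mF j mD Y mY).
Qed.

(** Semicontinuity holds only relative to [A], so the superlevel set is replaced by an ambient open
    set with the same trace on [A]. *)
Lemma lsc_comp_measurable (m : nat) (D : set 'rV[R]_n) (A : set 'rV[R]_m)
    (W : 'rV[R]_m -> R) (F : 'rV[R]_n -> 'rV[R]_m) :
  @lower_semicontinuous (subspace A) R (fun y => (W y)%:E) ->
  measurable_fun D F -> (forall x, D x -> A (F x)) ->
  measurable_fun D (fun x => W (F x)).
Proof.
move=> lW mF DA.
move=> mD; apply: (measurability _ (RGenOInfty.measurableE R)) => // _ [_ [c ->] <-].
pose O : set 'rV[R]_m := [set y | nbhs y [set z | A z -> c < W z]]%classic.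
have oO : open O.
  by rewrite openE => y; rewrite /O/= => /nbhs_interior; exact.
have cO y : A y -> c < W y -> O y.
  move=> Ay cy.
  have [|V Vy VW] := lW y c; first by rewrite lte_fin.
  move: Vy; rewrite /nbhs/= -nbhs_subspace_in// => Vy.
  have {}Vy : nbhs y [set z | A z -> V z] by exact: Vy.
  by apply: filterS Vy => z Vz Az; have := VW z (Vz Az); rewrite lte_fin.
have := mF mD O (open_rv_measurable oO); congr measurable.
apply/seteqP; split => x /= [Dx h]; split => //.
  by rewrite in_itv/= andbT; exact: (nbhs_singleton h) (DA x Dx).
by apply: cO; [exact: DA|move: h; rewrite in_itv/= andbT].
Qed.

(** Clamping the argument to [[0, q]] gives a function monotone on the whole line, hence Borel, and
    [Wrad_ext] is its composition with the absolute value. *)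
Lemma Wrad_ext_measurable (D : set 'rV[R]_n) (q : R) (Wrad : R -> R) (h : 'rV[R]_n -> R) :
  0 < q -> (forall r s : R, 0 <= r -> r <= s -> s <= q -> Wrad r <= Wrad s) ->
  measurable D -> measurable_fun D h -> measurable_fun D (fun x => Wrad_ext q Wrad (h x)).
Proof.
move=> q0 mono mD mh.
pose V t := Wrad (Num.max 0 (Num.min t q)).
have VE t : Wrad_ext q Wrad t = V `|t|.
  rewrite /Wrad_ext /V; case: ifPn => [tq|]; first by rewrite min_l// max_r.
  by rewrite -ltNge => tq; rewrite min_r ?(ltW tq)// max_r// ltW.
have mV : measurable_fun setT V.
  apply: nondecreasing_measurable => // s t st; apply: mono.
  - by rewrite le_max lexx.
  - have h1 : Num.min s q <= Num.min t q by rewrite le_min !ge_min st lexx orbT.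
    by rewrite ge_max !le_max lexx h1 orbT.
  - by rewrite ge_max (ltW q0)/= ge_min lexx orbT.
under eq_fun do rewrite VE.
by apply: (measurableT_comp mV); exact: measurable_norm.
Qed.

(** Weak gradients are unique almost everywhere, so the choice hidden in [energy] does not affect
    its value. *)
Lemma energy_weak (a : 'rV[R]_n) (r : R) (m : nat) (W : 'rV[R]_m -> R)
    (v : 'rV[R]_n -> 'rV[R]_m) (G : 'I_m -> 'I_n -> 'rV[R]_n -> R) :
  (forall j i, weak_partial (eball a r) i (vcomp v j) (G j i)) ->
  measurable_fun (eball a r) (fun x => W (v x)) ->
  (energy W (eball a r) v = \int[leb n]_(x in eball a r)
    (2^-1 * (\sum_(j < m) \sum_(i < n) G j i x ^+ 2) + W (v x))%:E)%E.
Proof.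
set B := eball a r => w mW; have mB : measurable B by exact: measurable_eball.
have mint (H : 'I_m -> 'I_n -> 'rV[R]_n -> R) : (forall j i, measurable_fun B (H j i)) ->
    measurable_fun B (EFin \o (fun x => 2^-1 * (\sum_(j < m) \sum_(i < n) H j i x ^+ 2) + W (v x))).
  move=> mH; apply/measurable_EFinP; apply: measurable_funD => //.
  apply: measurable_funM => //; apply: measurable_sum => j; apply: measurable_sum => i.
  exact: measurable_funX.
apply: ae_eq_integral => //.
- by apply: mint => j i; have [_ []] := wD_weak_partial (w j i).
- by apply: mint => j i; have [_ []] := w j i.
have H : {ae leb n, forall x, forall j, forall i, B x -> wD B i (vcomp v j) x = G j i x}.
  by apply: filter_forall => j; apply: filter_forall => i; exact: wD_ae.
apply: filterS H => x H Bx; congr ((_ * _ + _)%:E).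
by apply: eq_bigr => j _; apply: eq_bigr => i _; rewrite H.
Qed.

Lemma J_ball_weak (r q : R) (Wrad : R -> R) (h : 'rV[R]_n -> R) (g : 'I_n -> 'rV[R]_n -> R) :
  (forall i, weak_partial (eball 0 r) i h (g i)) ->
  measurable_fun (eball 0 r) (fun x => Wrad_ext q Wrad (h x)) ->
  (J_ball q Wrad r h = \int[leb n]_(x in eball (0 : 'rV[R]_n) r)
    (2^-1 * (\sum_(i < n) g i x ^+ 2) + Wrad_ext q Wrad (h x))%:E)%E.
Proof.
set B := eball 0 r => w mW; have mB : measurable B by exact: measurable_eball.
have mint (H : 'I_n -> 'rV[R]_n -> R) : (forall i, measurable_fun B (H i)) ->
    measurable_fun B (EFin \o (fun x => 2^-1 * (\sum_(i < n) H i x ^+ 2) + Wrad_ext q Wrad (h x))).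
  move=> mH; apply/measurable_EFinP; apply: measurable_funD => //.
  apply: measurable_funM => //; apply: measurable_sum => i.
  exact: measurable_funX.
apply: ae_eq_integral => //.
- by apply: mint => i; have [_ []] := wD_weak_partial (w i).
- by apply: mint => i; have [_ []] := w i.
have H : {ae leb n, forall x, forall i, B x -> wD B i h x = g i x}.
  by apply: filter_forall => i; exact: wD_ae.
apply: filterS H => x H Bx; congr ((_ * _ + _)%:E).
by apply: eq_bigr => i _; rewrite H.
Qed.

End measurability_of_potentials.

(** * Energy comparison *)

Section pointwise_energy.
Context {R : realType}.

(** For one direction of differentiation: [U = u/|u|], [G] is the derivative of [u], [t] that of
    [|u|], [p] that of [Psi], and [lam = Psi/|u|]. Splitting [G] into [t U] and a part orthogonal to
    [U] turns the left side into [p^2 + lam^2 (|G|^2 - t^2) + t^2], and [lam <= 1]. *)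
Lemma retract_energy (m : nat) (U G : 'I_m -> R) (t p lam : R) :
  \sum_(j < m) U j ^+ 2 = 1 -> t = \sum_(j < m) U j * G j -> 0 <= lam <= 1 ->
  \sum_(j < m) (p * U j + lam * (G j - t * U j)) ^+ 2 + t ^+ 2 <=
  \sum_(j < m) G j ^+ 2 + p ^+ 2.
Proof.
move=> U1 tE /andP[l0 l1]; set S := \sum_(j < m) G j ^+ 2.
have E (c d : R) : \sum_(j < m) (c * U j + d * G j) ^+ 2 = c ^+ 2 + 2 * c * d * t + d ^+ 2 * S.
  have -> : \sum_(j < m) (c * U j + d * G j) ^+ 2 = c ^+ 2 * \sum_(j < m) U j ^+ 2 +
      2 * c * d * \sum_(j < m) U j * G j + d ^+ 2 * S.
    rewrite /S !big_distrr/= -!big_split/=; apply: eq_bigr => j _; ring.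
  by rewrite U1 -tE mulr1.
have h1 : 0 <= \sum_(j < m) (- t * U j + 1 * G j) ^+ 2.
  by apply: sumr_ge0 => j _; exact: sqr_ge0.
have -> : \sum_(j < m) (p * U j + lam * (G j - t * U j)) ^+ 2 =
    \sum_(j < m) ((p - lam * t) * U j + lam * G j) ^+ 2.
  by apply: eq_bigr => j _; congr (_ ^+ 2); ring.
move: h1; rewrite !E => h1.
have l2 : lam ^+ 2 <= 1 by rewrite expr_le1.
have : 0 <= (1 - lam ^+ 2) * (S - t ^+ 2) by rewrite mulr_ge0 ?subr_ge0//; lra.
lra.
Qed.

(** With [A], [D] the two roots, [(A - D)(A + D) = (b - a)(a + b)]; both roots are at least [r/2],
    so [A + D >= r >= a + b]. *)
Lemma sqrt_arc_lipschitz (r a b : R) : 0 < r -> 0 <= a -> a <= r / 2 -> 0 <= b -> b <= r / 2 ->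
  `|Num.sqrt (r ^+ 2 - a ^+ 2) - Num.sqrt (r ^+ 2 - b ^+ 2)| <= `|a - b|.
Proof.
move=> r0 a0 ar b0 br.
have H c : 0 <= c -> c <= r / 2 -> r / 2 <= Num.sqrt (r ^+ 2 - c ^+ 2) /\
    Num.sqrt (r ^+ 2 - c ^+ 2) ^+ 2 = r ^+ 2 - c ^+ 2.
  move=> c0 cr; have c2 : c ^+ 2 <= (r / 2) ^+ 2 by rewrite lerXn2r ?nnegrE ?divr_ge0// ltW.
  have p : (r / 2) ^+ 2 <= r ^+ 2 - c ^+ 2 by have := sqr_ge0 r; nra.
  split; last by rewrite sqr_sqrtr// (le_trans (sqr_ge0 _) p).
  by rewrite -[leLHS]ger0_norm ?divr_ge0 ?(ltW r0)// -sqrtr_sqr ler_wsqrtr.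
have [h1 h2] := H a a0 ar; have [h3 h4] := H b b0 br.
set A := Num.sqrt _ in h1 h2 *; set D := Num.sqrt _ in h3 h4 *.
have s0 : 0 < A + D by lra.
rewrite -(ler_pM2r s0) -{1}(gtr0_norm s0) -normrM.
have -> : (A - D) * (A + D) = (b - a) * (a + b).
  have -> : (A - D) * (A + D) = A ^+ 2 - D ^+ 2 by ring.
  by rewrite h2 h4; ring.
rewrite normrM distrC [X in _ * X <= _]ger0_norm ?addr_ge0//.
by rewrite ler_wpM2l//; lra.
Qed.

End pointwise_energy.

(** * Balls have Lipschitz boundary *)

Section lipschitz_ball.
Context {R : realType} {n : nat}.
Implicit Types (x y z e : 'rV[R]_n).

Lemma dotvBl x y e : dotv (x - y) e = dotv x e - dotv y e.
Proof.
rewrite /dotv -sumrB; apply: eq_bigr => i _; by rewrite !mxE mulrBl.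
Qed.

Lemma dotvZl (c : R) x e : dotv (c *: x) e = c * dotv x e.
Proof.
rewrite /dotv big_distrr/=; apply: eq_bigr => i _; by rewrite !mxE mulrA.
Qed.

Lemma dotvv e : dotv e e = enorm e ^+ 2.
Proof. by rewrite sqr_enorm; apply: eq_bigr => i _; rewrite expr2. Qed.

Lemma enorm_orthogonal z e : enorm e = 1 ->
  enorm (z - dotv z e *: e) ^+ 2 + dotv z e ^+ 2 = enorm z ^+ 2.
Proof.
move=> e1; have e2 : dotv e e = 1 by rewrite dotvv e1 expr1n.
have E d : enorm (z - d *: e) ^+ 2 =
    enorm z ^+ 2 + - (2 * d) * dotv z e + d ^+ 2 * dotv e e.
  rewrite !sqr_enorm /dotv !big_distrr/= -!big_split/=; apply: eq_bigr => i _.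
  by rewrite !mxE; ring.
by rewrite E e2; ring.
Qed.

Lemma enorm_distB x y z : `|enorm (x - z) - enorm (y - z)| <= enorm (x - y).
Proof.
rewrite (le_trans (enorm_dist _ _))//.
by rewrite opprB addrA subrK.
Qed.

(** At the boundary point [c] take the inner unit normal [e]. The ball is locally above the lower
    hemisphere, a function of the distance to the projected centre [y0]. Capping this distance at
    [r/2] makes the function 1-Lipschitz everywhere, and the cap is inactive within [r/2] of [c]. *)
Lemma lipschitz_boundary_eball x0 (r : R) : 0 < r -> lipschitz_boundary (eball x0 r).
Proof.
move=> r0 c cB cnB.
have cr : enorm (c - x0) = r.
  apply/eqP; rewrite eq_le (closure_eball cB)/=.
  by move/negP: cnB; rewrite -leNgt.
pose e := r^-1 *: (x0 - c).
have e1 : enorm e = 1.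
  by rewrite enormZ enormB cr ger0_norm ?invr_ge0 ?(ltW r0)// mulVf// gt_eqF.
have ce : c - x0 = - r *: e by rewrite /e scalerA mulNr divff ?gt_eqF// scaleN1r opprB.
have e2 : dotv e e = 1 by rewrite dotvv e1 expr1n.
pose y0 := x0 - dotv x0 e *: e.
pose gamma y := dotv x0 e - Num.sqrt (r ^+ 2 - Num.min (enorm (y - y0)) (r / 2) ^+ 2).
have r2 : 0 < r / 2 by rewrite divr_gt0.
exists (r / 2), 1, e, gamma; split => //.
  move=> y z _ _; rewrite mul1r /gamma.
  set A := Num.sqrt _; set D := Num.sqrt _.
  have -> : dotv x0 e - A - (dotv x0 e - D) = - (A - D) by ring.
  rewrite normrN; apply: (le_trans (sqrt_arc_lipschitz r0 _ _ _ _)).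
  - by rewrite le_min enorm_ge0 ltW.
  - by rewrite ge_min lexx orbT.
  - by rewrite le_min enorm_ge0 ltW.
  - by rewrite ge_min lexx orbT.
  have h : `|enorm (y - y0) - enorm (z - y0)| <= enorm (y - z).
    exact: enorm_distB.
  apply: le_trans h; move: (enorm (y - y0)) (enorm (z - y0)) => s t.
  rewrite ler_norml; apply/andP; split.
    by case: (leP s (r / 2)) => h1; case: (leP t (r / 2)) => h2;
      have := ler_norm (s - t); have := ler_norm (t - s); rewrite (distrC t s); lra.
  by case: (leP s (r / 2)) => h1; case: (leP t (r / 2)) => h2;
      have := ler_norm (s - t); have := ler_norm (t - s); rewrite (distrC t s); lra.
move=> x xc.
have yE : x - dotv x e *: e - y0 = (x - x0) - dotv (x - x0) e *: e.
  by rewrite /y0 dotvBl; apply/rowP => i; rewrite !mxE; ring.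
have yE' : x - dotv x e *: e - y0 = (x - c) - dotv (x - c) e *: e.
  rewrite yE; have -> : x - x0 = (x - c) - r *: e.
    by rewrite -scaleNr -ce addrA subrK.
  by rewrite dotvBl dotvZl e2 mulr1; apply/rowP => i; rewrite !mxE; ring.
have yr : enorm (x - dotv x e *: e - y0) < r / 2.
  rewrite yE'; apply: le_lt_trans xc.
  have := enorm_orthogonal (x - c) e1; set w := enorm (_ - _ *: _) => E.
  rewrite -(@ler_pXn2r _ 2) ?nnegrE ?enorm_ge0//.
  by rewrite -E lerDl sqr_ge0.
have de : dotv (x - x0) e < 0.
  have -> : x - x0 = (x - c) - r *: e.
    by rewrite -scaleNr -ce addrA subrK.
  rewrite dotvBl dotvZl e2 mulr1.
  have := cauchy_schwarz (x - c) e; rewrite e1 mulr1; lra.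
have E := enorm_orthogonal (x - x0) e1; rewrite -yE in E.
rewrite /gamma min_l; last exact: ltW.
set w := enorm (_ - y0) in yr E *.
have w0 : 0 <= w by exact: enorm_ge0.
have dd : dotv x0 e - dotv x e = - dotv (x - x0) e by rewrite dotvBl opprB.
rewrite /eball/= ltrBlDr -ltrBlDl dd.
set d := dotv (x - x0) e in de E *.
have p : 0 <= r ^+ 2 - w ^+ 2 by nra.
have dE : - d = Num.sqrt ((- d) ^+ 2) by rewrite sqrtr_sqr gtr0_norm// oppr_gt0.
have -> : (enorm (x - x0) < r) = (enorm (x - x0) ^+ 2 < r ^+ 2).
  by rewrite ltr_pXn2r ?nnegrE ?enorm_ge0// ltW.
rewrite -E; split => h.
  by rewrite dE ltr_sqrt; nra.
have s2 := sqr_sqrtr p; set s := Num.sqrt _ in h s2.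
have s0 : 0 <= s by exact: sqrtr_ge0.
nra.
Qed.

End lipschitz_ball.

Section continuity_almost_everywhere.
Context {R : realType} {n : nat}.

(** The set where the inequality fails is open and null, hence empty. *)
Lemma ae_le_continuous (D : set 'rV[R]_n) (f g : 'rV[R]_n -> R) : open D ->
  (forall x, D x -> {for x, continuous f}) -> (forall x, D x -> {for x, continuous g}) ->
  {ae leb n, forall x, D x -> f x <= g x} -> forall x, D x -> f x <= g x.
Proof.
move=> oD cf cg [N [mN N0 HN]] x Dx; rewrite leNgt; apply/negP => gf.
pose U := [set y | D y /\ g y < f y].
have oU : open U.
  rewrite openE => y [Dy gfy]; rewrite /interior.
  have c : {for y, continuous (fun z => f z - g z)}.
    by apply: (@cvgB _ _ _ (nbhs y)); [exact: cf|exact: cg].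
  have d0 : 0 < f y - g y by rewrite subr_gt0.
  have H1 : \forall z \near y, 0 < f z - g z.
    exact: (@cvgr_gt _ _ (nbhs y) _ _ _ c 0 d0).
  have H2 : \forall z \near y, D z by exact: open_nbhs_nbhs.
  apply: (@filterS _ (nbhs y) _ [set z | 0 < f z - g z /\ D z]); last exact: filterI.
  by move=> z [h1 h2]; split; [exact: h2|rewrite -subr_gt0].
have Ux : U x by [].
have := leb_open_gt0 oU Ux.
apply/negP; rewrite -leNgt -N0; apply: le_measure; rewrite ?inE//.
  exact: open_rv_measurable.
move=> y [Dy gfy]; apply: HN => /= H; have := H Dy.
by rewrite leNgt gfy.
Qed.

End continuity_almost_everywhere.

Lemma L1_sum {R : realType} {n : nat} (D : set 'rV[R]_n) (I : Type) (s : seq I)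
    (F : I -> 'rV[R]_n -> R) : measurable D ->
  (forall j, L1 D (F j)) -> L1 D (fun x => \sum_(j <- s) F j x).
Proof.
move=> mD IF; elim: s => [|j s IH].
  have := @integrable0 _ _ R (leb n) D.
  by apply: eq_integrable => // x _ /=; rewrite big_nil.
have := integrableD mD (IF j) IH.
by apply: eq_integrable => // x _ /=; rewrite big_cons EFinD.
Qed.

Section scaling_approximation.
Context {R : realType} {n : nat}.

Lemma iter_partialZ (c : R) (f : 'rV[R]_n -> R) s : smooth f ->
  iter_partial s (fun x => c * f x) = (fun x => c * iter_partial s f x).
Proof.
move=> sf; elim: s => //= i s ->; apply/funext => x.
have [_ di] := sf s.
by have [_ ->] := is_derive_cmul c (derivableP (di i x)).
Qed.

Lemma smoothZ (c : R) (f : 'rV[R]_n -> R) : smooth f -> smooth (fun x => c * f x).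
Proof.
move=> sf s; rewrite iter_partialZ//; have [cs ds] := sf s; split=> [x|i x].
  by apply: (@cvgM _ _ (nbhs x)); [exact: cvg_cst|exact: cs].
by have [] := is_derive_cmul c (derivableP (ds i x)).
Qed.

Lemma wapproxN (a : 'rV[R]_n) (r : R) f g : wapprox a r f g ->
  wapprox a r (fun x => - f x) (fun i x => - g i x).
Proof.
move=> H e e0; have [phi tphi [h1 h2]] := H e e0.
exists (fun x => -1 * phi x).
  have [sphi [K [cK KB phiK]]] := tphi; split; first exact: smoothZ.
  by exists K; split => // x /phiK ->; rewrite mulr0.
split=> [|i].
  move: h1; congr (_ <= _)%E; apply: eq_integral => x _.
  by congr EFin; ring.
move: (h2 i); congr (_ <= _)%E; apply: eq_integral => x _; congr EFin.
have [_ ->] := is_derive_cmul (-1) (derivableP (@smooth_derivable _ _ _ i x tphi.1)).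
by ring.
Qed.

End scaling_approximation.

Definition energy_density {R : realType} {n m : nat} (W : 'rV[R]_m -> R)
    (v : 'rV[R]_n -> 'rV[R]_m) (G : 'I_m -> 'I_n -> 'rV[R]_n -> R) x :=
  2^-1 * (\sum_(j < m) \sum_(i < n) G j i x ^+ 2) + W (v x).

(** * The comparison argument on a ball centred at the origin *)

Section comparison.
Context {R : realType} {n m : nat} (hn : (0 < n)%N) (q : R) (hq : 0 < q)
  (W W0 : 'rV[R]_m -> R) (Wrad : R -> R)
  (W_ge0 : forall y, ecball 0 q y -> 0 <= W y)
  (W_lsc : @lower_semicontinuous (subspace (ecball (0 : 'rV[R]_m) q)) R
             (fun y => (W y)%:E))
  (W_bounded : exists M : R, forall y, ecball 0 q y -> W y <= M)
  (W_split : forall y, ecball 0 q y -> W y = Wrad (enorm y) + W0 y)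
  (Wrad_ge0 : forall r : R, 0 <= r <= q -> 0 <= Wrad r)
  (Wrad_mono : forall r s : R, 0 <= r -> r <= s -> s <= q -> Wrad r <= Wrad s)
  (W0_mono : forall (r s : R) (xi : 'rV[R]_m), enorm xi = 1 ->
     0 <= r -> r <= s -> s <= q -> W0 (r *: xi) <= W0 (s *: xi)).
Context (r : R) (r0 : 0 < r) (Psi : 'rV[R]_n -> R)
  (Psi_greatest : greatest_minimizer q Wrad r Psi)
  (p : 'I_n -> 'rV[R]_n -> R)
  (p_weak : forall i, weak_partial (eball 0 r) i Psi (p i))
  (p_L2 : forall i, L2 (eball 0 r) (p i)).
Let B : set 'rV[R]_n := eball 0 r.
Let mB : measurable B. Proof. exact: measurable_eball. Qed.
Let oB : open B. Proof. exact: eball_open. Qed.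
Let fB : (leb n B < +oo)%E. Proof. exact: leb_eball_lty. Qed.

Let Psi_A : A_ball q r Psi. Proof. by have [[]] := Psi_greatest. Qed.
Let Psi_cont : {within ecball 0 r, continuous Psi}. Proof. by case: Psi_greatest. Qed.
Let nPsi : cbW12 0 r Psi p. Proof. exact: Psi_cbW12 Psi_cont. Qed.

Lemma Wrad_ext_min t : Wrad 0 <= Wrad_ext q Wrad t.
Proof.
rewrite /Wrad_ext; case: ifPn => tq; apply: Wrad_mono => //; exact: ltW.
Qed.

Lemma Wrad_ext_ge0 t : 0 <= Wrad_ext q Wrad t.
Proof. by apply: le_trans (Wrad_ext_min t); apply: Wrad_ge0; rewrite lexx ltW. Qed.

Lemma Wrad_extE t : 0 <= t <= q -> Wrad_ext q Wrad t = Wrad t.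
Proof. by move=> /andP[t0 tq]; rewrite /Wrad_ext ger0_norm// tq. Qed.

Section truncation.
Context (f : 'rV[R]_n -> R) (gf : 'I_n -> 'rV[R]_n -> R) (nf : cbW12 0 r f gf)
  (fq : forall x, B x -> f x <= q).

(** The maximum of [f] and [Psi], written as a perturbation of [Psi] with zero trace, so that
    [A_ball_add] yields its admissibility. *)
Definition trunc x := Psi x + cut_pos Psi f 0 x.
Definition trunc_grad i x := p i x + cut_grad Psi p f gf 0 i x.

Let ncut : cbW12 0 r (cut_pos Psi f 0) (cut_grad Psi p f gf 0).
Proof. exact: cut_cbW12. Qed.

Lemma trunc_cbW12 : cbW12 0 r trunc trunc_grad.
Proof. exact: cbW12D nPsi ncut. Qed.

Lemma trunc_A_ball : A_ball q r trunc.
Proof.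
have [_ _ w g2] := ncut.
apply: (A_ball_add hn r0 Psi_A _ (cbW12_L2 ncut) g2 w).
exact: (cut_wapprox hn r0 Psi_A p_weak p_L2 Psi_cont nf fq).
Qed.

Lemma truncE x : trunc x = if 0 < f x - Psi x then f x else Psi x.
Proof.
rewrite /trunc /cut_pos subr0; case: ltP => h; last by rewrite ppos_neg// addr0.
by rewrite ppos_pos ?(ltW h)// addrC subrK.
Qed.

Lemma trunc_gradE i x : trunc_grad i x = if 0 < f x - Psi x then gf i x else p i x.
Proof.
rewrite /trunc_grad /cut_grad subr0; case: ifP => _; last by rewrite addr0.
by rewrite addrC subrK.
Qed.

(** Maximality of [Psi] controls other minimizers only almost everywhere; continuity of [f] and
    [Psi] gives the inequality everywhere. *)
Lemma trunc_le_Psi : (J_ball q Wrad r trunc <= J_ball q Wrad r Psi)%E ->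
  forall x, B x -> f x <= Psi x.
Proof.
move=> H.
have Jt : J_minimizer q Wrad r trunc.
  split; first exact: trunc_A_ball.
  have [[_ Jmin] _ _] := Psi_greatest.
  by move=> k Ak; apply: le_trans H _; exact: Jmin.
have [_ _ /(_ _ Jt) ae] := Psi_greatest.
have [cf _ _ _] := nf; have [cP _ _ _] := nPsi.
apply: ae_le_continuous => //.
apply: filterS ae => x h Bx; have := h Bx; rewrite truncE.
by case: ltP => //; rewrite subr_le0.
Qed.

End truncation.

Let mWext h : measurable_fun B h -> measurable_fun B (fun x => Wrad_ext q Wrad (h x)).
Proof. by move=> mh; exact: Wrad_ext_measurable. Qed.

Let J_integrand (h : 'rV[R]_n -> R) (g : 'I_n -> 'rV[R]_n -> R) x :=
  2^-1 * (\sum_(i < n) g i x ^+ 2) + Wrad_ext q Wrad (h x).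

Let J_integrand_ge0 h g x : 0 <= J_integrand h g x.
Proof.
by rewrite addr_ge0 ?Wrad_ext_ge0// mulr_ge0// sumr_ge0// => i _; exact: sqr_ge0.
Qed.

Let J_integrand_measurable h g : cbW12 0 r h g -> measurable_fun B (J_integrand h g).
Proof.
move=> nh; have [_ _ _ g2] := nh; apply: measurable_funD; last by apply: mWext; exact: cbW12_measurable nh.
apply: measurable_funM => //; apply: measurable_sum => i.
by apply: measurable_funX; exact: (g2 i).1.
Qed.

Let J_ballE h g : cbW12 0 r h g ->
  J_ball q Wrad r h = (\int[leb n]_(x in B) (J_integrand h g x)%:E)%E.
Proof.
move=> nh; have [_ _ w _] := nh; apply: J_ball_weak => //.
by apply: mWext; exact: cbW12_measurable nh.
Qed.

(** With [f = 0] the truncation is the positive part of [Psi]: where [Psi < 0] the gradient is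
    discarded and the potential drops to its minimum [Wrad 0]. *)
Lemma Psi_ge0 x : B x -> 0 <= Psi x.
Proof.
have n0 : cbW12 (0 : 'rV[R]_n) r (fun=> 0) (fun i x => 0) := cbW12_cst 0 r 0.
move: x; apply: (trunc_le_Psi n0) => [x _|]; first exact: ltW.
have nt := trunc_cbW12 n0.
rewrite (J_ballE nt) (J_ballE nPsi).
apply: ge0_integral_le => //; try exact: J_integrand_measurable.
move=> x _; rewrite /J_integrand truncE.
under eq_bigr do rewrite trunc_gradE.
rewrite sub0r; case: ifP => // _; apply: lerD.
  rewrite ler_wpM2l//; apply: ler_sum => i _; by rewrite expr0n sqr_ge0.
by apply: le_trans (Wrad_ext_min (Psi x)); rewrite Wrad_extE// lexx ltW.
Qed.

Context (u : 'rV[R]_n -> 'rV[R]_m) (g : 'I_m -> 'I_n -> 'rV[R]_n -> R)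
  (nu : forall j, cbW12 0 r (vcomp u j) (g j)) (uq : forall x, B x -> enorm (u x) <= q).

Let rho x := Num.sqrt (\sum_(j < m) vcomp u j x ^+ 2).
Let grho i x := (rho x)^-1 * \sum_(j < m) vcomp u j x * g j i x.
Let nrho : cbW12 0 r rho grho. Proof. exact: cbW12_rho. Qed.
Let rhoE x : rho x = enorm (u x). Proof. by []. Qed.

(** Written as [u] minus the removed part because weak derivatives and zero trace are known for the
    latter; the closed form is [retractedE]. *)
Definition retracted x : 'rV[R]_m :=
  \row_j (u x ord0 j - retract_fun Psi (fun j => vcomp u j) 0 j x).
Definition retracted_grad j i x :=
  g j i x - retract_grad Psi p (fun j => vcomp u j) g 0 j i x.

Lemma retractedE x : retracted x =
  if Psi x < enorm (u x) then (Psi x / enorm (u x)) *: u x else u x.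
Proof.
apply/rowP => j; rewrite mxE /retract_fun /cut_pos subr0 -/(rho x) rhoE.
case: ltP => h; last by rewrite ppos_neg ?subr_le0// !mul0r subr0.
rewrite ppos_pos ?subr_ge0 ?(ltW h)// mxE /vcomp.
have [z|z] := eqVneq (enorm (u x)) 0.
  by rewrite (enorm_eq0 z) !mxE !mulr0 mul0r subr0.
by field.
Qed.

Lemma retracted_enorm x : B x -> enorm (retracted x) = Num.min (Psi x) (enorm (u x)).
Proof.
move=> Bx; have P0 := Psi_ge0 Bx.
rewrite retractedE; case: ltP => h //.
have up : 0 < enorm (u x) by exact: le_lt_trans h.
by rewrite enormZ ger0_norm ?divr_ge0 ?(ltW up)// divfK// gt_eqF.
Qed.

Lemma retracted_q x : B x -> enorm (retracted x) <= q.
Proof. by move=> Bx; rewrite retracted_enorm// ge_min uq ?orbT. Qed.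

Let vcomp_retracted j : vcomp retracted j =
  (fun x => vcomp u j x - retract_fun Psi (fun j => vcomp u j) 0 j x).
Proof. by apply/funext => x; rewrite /vcomp mxE. Qed.

Lemma retracted_L2 j : L2 B (vcomp retracted j).
Proof.
rewrite vcomp_retracted; apply: L2B => //; first exact: cbW12_L2 (nu j).
exact: (retract_fun_L2 hn r0 p_weak p_L2 Psi_cont nu Psi_ge0).
Qed.

Lemma retracted_grad_L2 j i : L2 B (retracted_grad j i).
Proof.
have [_ l] := retract_weak r0 p_weak p_L2 Psi_cont nu Psi_ge0 j i (lexx 0).
by have [_ _ _ lu] := nu j; exact: L2B.
Qed.

Lemma retracted_weak j i : weak_partial B i (vcomp retracted j) (retracted_grad j i).
Proof.
have [w l] := retract_weak r0 p_weak p_L2 Psi_cont nu Psi_ge0 j i (lexx 0).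
rewrite vcomp_retracted; have [_ _ wu _] := nu j.
apply: weak_partialB => //.
- exact: cbW12_L1 (nu j).
- exact: (cbW12_L1g i (nu j)).
- apply: L2_L1 => //.
  exact: (retract_fun_L2 hn r0 p_weak p_L2 Psi_cont nu Psi_ge0).
- exact: L2_L1.
Qed.

Lemma potential_measurable (v : 'rV[R]_n -> 'rV[R]_m) :
  (forall j, measurable_fun B (vcomp v j)) -> (forall x, B x -> enorm (v x) <= q) ->
  measurable_fun B (fun x => W (v x)).
Proof.
move=> mv vq; apply: (lsc_comp_measurable W_lsc).
  exact: measurable_fun_coordinates.
by move=> x Bx; rewrite /ecball/= subr0 vq.
Qed.

Lemma energy_density_ge0 v G x : B x -> enorm (v x) <= q -> 0 <= energy_density W v G x.
Proof.
move=> Bx vq; rewrite addr_ge0//.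
  rewrite mulr_ge0// sumr_ge0// => j _; rewrite sumr_ge0// => i _; exact: sqr_ge0.
by apply: W_ge0; rewrite /ecball/= subr0.
Qed.

Lemma energy_density_measurable v G : (forall j, measurable_fun B (vcomp v j)) ->
  (forall x, B x -> enorm (v x) <= q) -> (forall j i, measurable_fun B (G j i)) ->
  measurable_fun B (energy_density W v G).
Proof.
move=> mv vq mG; apply: measurable_funD; last exact: potential_measurable.
apply: measurable_funM => //; apply: measurable_sum => j; apply: measurable_sum => i.
exact: measurable_funX.
Qed.

(** The radial retraction trades the radial part of the energy of [u] for that
    of [Psi] wherever [|u| > Psi]. *)
Lemma integrand_comparison x : B x ->
  energy_density W retracted retracted_grad x + J_integrand (trunc rho) (trunc_grad rho grho) x <=
  energy_density W u g x + J_integrand Psi p x.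
Proof.
move=> Bx; have P0 := Psi_ge0 Bx; have ux := uq Bx.
rewrite /energy_density /J_integrand truncE retractedE.
under [X in _ + (2^-1 * X + _) <= _]eq_bigr do rewrite trunc_gradE.
(* Where [|u| <= Psi] nothing is changed: the competitors coincide with [u] and [Psi], gradients
   included. *)
rewrite rhoE subr_gt0; case: ltP => h; last first.
  rewrite lerD2r lerD2r le_eqVlt; apply/orP; left; apply/eqP.
  congr (_ * _); apply: eq_bigr => j _; apply: eq_bigr => i _.
  rewrite /retracted_grad /retract_grad /dir_grad /cut_pos /cut_grad subr0.
  by rewrite -/(rho x) rhoE ppos_neg ?subr_le0// ltNge subr_le0 h/= !mul0r addr0 subr0.
have up : 0 < enorm (u x) by exact: le_lt_trans h.
have u0 : enorm (u x) != 0 by rewrite gt_eqF.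
have Pq : Psi x <= q by rewrite (le_trans (ltW h)).
set lam := Psi x / enorm (u x).
have l01 : 0 <= lam <= 1 by rewrite divr_ge0 ?(ltW up)//= ler_pdivrMr// mul1r ltW.
pose U j := vcomp u j x / enorm (u x).
have U1 : \sum_(j < m) U j ^+ 2 = 1.
  rewrite /U; under eq_bigr do rewrite exprMn.
  by rewrite -big_distrl/= -[X in X * _]sqr_enorm -exprMn divff// expr1n.
have tE i : grho i x = \sum_(j < m) U j * g j i x.
  rewrite /grho rhoE big_distrr/=; apply: eq_bigr => j _; rewrite /U; ring.
have gE j i : retracted_grad j i x = p i x * U j + lam * (g j i x - grho i x * U j).
  rewrite /retracted_grad /retract_grad /dir_grad /cut_pos /cut_grad subr0.
  rewrite -/(rho x) rhoE ppos_pos ?subr_ge0 ?(ltW h)// subr_gt0 h.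
  rewrite /lam /U /grho rhoE; set S := \sum_(l < m) _.
  by field.
have grad_ineq : \sum_(j < m) \sum_(i < n) retracted_grad j i x ^+ 2 +
    \sum_(i < n) grho i x ^+ 2 <=
    \sum_(j < m) \sum_(i < n) g j i x ^+ 2 + \sum_(i < n) p i x ^+ 2.
  rewrite exchange_big/= [X in _ <= X + _]exchange_big/= -!big_split/=.
  apply: ler_sum => i _; under eq_bigr do rewrite gE.
  exact: retract_energy.
(* The radial potentials trade places: [Wrad (Psi x)] and [Wrad |u x|] occur on both sides. What
   remains is monotonicity of [W0] along the ray through [u x]. *)
have pot : W (lam *: u x) + Wrad_ext q Wrad (enorm (u x)) <= W (u x) + Wrad_ext q Wrad (Psi x).
  pose xi := (enorm (u x))^-1 *: u x.
  have xi1 : enorm xi = 1 by rewrite enormZ ger0_norm ?invr_ge0 ?(ltW up)// mulVf.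
  have E1 : lam *: u x = Psi x *: xi by rewrite scalerA.
  have E2 : u x = enorm (u x) *: xi by rewrite scalerA divff// scale1r.
  have n1 : enorm (lam *: u x) = Psi x by rewrite E1 enormZ xi1 mulr1 ger0_norm.
  rewrite !W_split; [|by rewrite /ecball/= subr0|by rewrite /ecball/= subr0 n1].
  rewrite n1 !Wrad_extE ?ux ?(ltW up) ?P0//.
  have : W0 (lam *: u x) <= W0 (u x).
    rewrite E1 [X in _ <= W0 X]E2; apply: W0_mono => //; exact: ltW.
  lra.
by move: grad_ineq pot; lra.
Qed.

Lemma energy_comparison :
  (\int[leb n]_(x in B) (energy_density W u g x)%:E <=
   \int[leb n]_(x in B) (energy_density W retracted retracted_grad x)%:E)%E ->
  forall x, B x -> enorm (u x) <= Psi x.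
Proof.
move=> H.
have rq x : B x -> rho x <= q by exact: uq.
apply: (trunc_le_Psi nrho rq).
have nt := trunc_cbW12 nrho.
rewrite (J_ballE nt) (J_ballE nPsi).
have mu j : measurable_fun B (vcomp u j) by exact: cbW12_measurable (nu j).
have mg j i : measurable_fun B (g j i) by have [_ _ _ l] := nu j; exact: (l i).1.
have mv j : measurable_fun B (vcomp retracted j).
  by have [[]] := retracted_weak j (Ordinal hn).
have mvg j i : measurable_fun B (retracted_grad j i) by have [_ []] := retracted_weak j i.
have mEu := energy_density_measurable mu uq mg.
have mEv := energy_density_measurable mv retracted_q mvg.
have mJt := J_integrand_measurable nt; have mJP := J_integrand_measurable nPsi.
have Eu0 x : B x -> 0 <= energy_density W u g x by move=> Bx; exact: energy_density_ge0 (uq Bx).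
have Ev0 x : B x -> 0 <= energy_density W retracted retracted_grad x.
  by move=> Bx; apply: energy_density_ge0 => //; exact: retracted_q.
(* Finiteness allows the energy of [u] to be cancelled from both sides at the end; it uses the
   square-integrable gradient, the bound on [W] and the finite measure of the ball. *)
have Eu_fin : (\int[leb n]_(x in B) (energy_density W u g x)%:E < +oo)%E.
  have I1 : L1 B (fun x => \sum_(j < m) \sum_(i < n) g j i x ^+ 2).
    apply: L1_sum => // j; apply: L1_sum => // i.
    by have [_ _ _ l] := nu j; have [mgi gi2] := l i; exact: L1_sqr.
  have [M HM] := W_bounded.
  have I2 : L1 B (fun x => W (u x)).
    apply: measurable_bounded_integrable => //; first exact: potential_measurable.
    exists M; split; first by rewrite num_real.
    move=> N MN x Bx /=; rewrite ger0_norm ?W_ge0 /ecball/= ?subr0 ?uq//.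
    by rewrite (le_trans _ (ltW MN))// HM// /ecball/= subr0 uq.
  have I : L1 B (energy_density W u g).
    have := integrableD mB (integrableZl mB 2^-1 I1) I2.
    by apply: eq_integrable => // x _ /=; rewrite EFinD EFinM.
  have /integrableP[_] := I; congr (_ < _)%E; apply: eq_integral => x /set_mem Bx /=.
  by rewrite ger0_norm// Eu0.
have Eu_ge : (0 <= \int[leb n]_(x in B) (energy_density W u g x)%:E)%E.
  by apply: integral_ge0 => x Bx; rewrite lee_fin Eu0.
have addE (F1 F2 : 'rV[R]_n -> R) : measurable_fun B F1 -> measurable_fun B F2 ->
    (forall x, B x -> 0 <= F1 x) -> (forall x, B x -> 0 <= F2 x) ->
    (\int[leb n]_(x in B) (F1 x + F2 x)%:E =
     \int[leb n]_(x in B) (F1 x)%:E + \int[leb n]_(x in B) (F2 x)%:E)%E.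
  move=> m1 m2 p1 p2; rewrite -ge0_integralD//; exact/measurable_EFinP.
have key : (\int[leb n]_(x in B) (energy_density W retracted retracted_grad x)%:E +
    \int[leb n]_(x in B) (J_integrand (trunc rho) (trunc_grad rho grho) x)%:E <=
    \int[leb n]_(x in B) (energy_density W u g x)%:E +
    \int[leb n]_(x in B) (J_integrand Psi p x)%:E)%E.
  rewrite -!addE//; apply: ge0_integral_le => //; try exact: measurable_funD.
    by move=> x Bx; rewrite addr_ge0 ?Ev0.
  exact: integrand_comparison.
have := le_trans (leeD2r _ H) key.
by rewrite leeD2lE// ge0_fin_numE.
Qed.

End comparison.

Theorem theorem2p2 (R : realType) (n m : nat) (hn : (0 < n)%N) (hm : (0 < m)%N)
  (q : R) (hq : 0 < q)
  (W W0 : 'rV[R]_m -> R) (Wrad : R -> R)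
  (W_ge0 : forall y, ecball 0 q y -> 0 <= W y)
  (W_at0 : W 0 = 0)
  (W_lsc : @lower_semicontinuous (subspace (ecball (0 : 'rV[R]_m) q)) R
             (fun y => (W y)%:E))
  (W_bounded : exists M : R, forall y, ecball 0 q y -> W y <= M)
  (W_split : forall y, ecball 0 q y -> W y = Wrad (enorm y) + W0 y)
  (Wrad_ge0 : forall r : R, 0 <= r <= q -> 0 <= Wrad r)
  (Wrad_mono : forall r s : R, 0 <= r -> r <= s -> s <= q -> Wrad r <= Wrad s)
  (Wrad_lsc : @lower_semicontinuous (subspace `[0, q]) R
                (fun r => (Wrad r)%:E))
  (W0_ge0 : forall y, ecball 0 q y -> 0 <= W0 y)
  (W0_mono : forall (r s : R) (xi : 'rV[R]_m), enorm xi = 1 ->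
     0 <= r -> r <= s -> s <= q -> W0 (r *: xi) <= W0 (s *: xi))
  (Omega : set 'rV[R]_n) (Omega_open : open Omega)
  (u : 'rV[R]_n -> 'rV[R]_m)
  (u_W12 : W12v_loc Omega u)
  (u_bound : Linfty_le Omega u q)
  (u_min : local_minimizer q W Omega u)
  (u_cont : {within Omega, continuous u}) :
  forall (x0 : 'rV[R]_n) (r : R), 0 < r -> ecball x0 r `<=` Omega ->
  forall Psi : 'rV[R]_n -> R, greatest_minimizer q Wrad r Psi ->
  forall x, ecball x0 r x -> enorm (u x) <= Psi (x - x0).
Proof.
move=> x0 r r0 sub Psi gm.
have [[[[mP P2 wP] _] _] cP _] := gm.
have Psi_A : A_ball q r Psi by have [[]] := gm.
pose p i := s2val (cid2 (wP i)).
have wp i : weak_partial (eball 0 r) i Psi (p i) by rewrite /p; case: cid2.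
have p2 i : L2 (eball 0 r) (p i).
  by split; [have [_ []] := wp i|rewrite /p; case: cid2].
have uc x : Omega x -> {for x, continuous u}.
  move=> Ox; have /subspace_continuousP c := u_cont.
  by have := c x Ox; rewrite within_interior// /interior; exact: open_nbhs_nbhs.
(* The L^oo bound holds almost everywhere; continuity on the open set makes it pointwise. *)
have uq x : Omega x -> enorm (u x) <= q.
  move: x; apply: (@ae_le_continuous _ _ Omega (fun x => enorm (u x)) (fun=> q)) => //.
  - move=> x Ox; apply: (@continuous_comp _ _ _ u (@enorm R m)); first exact: uc.
    exact: enorm_continuous.
  - by move=> x _; exact: cst_continuous.
have BO : eball x0 r `<=` Omega by move=> x /eball_sub_ecball; exact: sub.
have clO : closure (eball x0 r) `<=` Omega by move=> x /closure_eball; exact: sub.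
have uW : W12v (eball x0 r) u.
  by apply: u_W12 => //; [exact: eball_open|exact: closure_eball_compact].
have wu j : forall i, exists2 g, weak_partial (eball x0 r) i (vcomp u j) g &
    (sqrL2 (eball x0 r) g < +oo)%E by have [] := uW j.
pose gu j i := s2val (cid2 (wu j i)).
have wgu j i : weak_partial (eball x0 r) i (vcomp u j) (gu j i).
  by rewrite /gu; case: cid2.
have nu j : cbW12 x0 r (vcomp u j) (gu j).
  split.
  - move=> x /BO Ox; apply: (@continuous_comp _ _ _ u (fun y : 'rV[R]_m => y ord0 j)).
      exact: uc.
    exact: coord_continuous.
  - by exists q => x /BO /uq; apply: le_trans; exact: coord_le_enorm.
  - exact: wgu.
  - by move=> i; split; [have [_ []] := wgu j i|rewrite /gu; case: cid2].
pose u0 x := u (x + x0); pose g0 j i x := gu j i (x + x0).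
have nu0 j : cbW12 0 r (vcomp u0 j) (g0 j).
  have := cbW12_shift (- x0) (nu j); rewrite subrr; apply: cbW12_ext => [x|i x];
  by rewrite opprK.
have u0q x : eball 0 r x -> enorm (u0 x) <= q.
  by rewrite /eball/= subr0 => xr; apply/uq/BO; rewrite /eball/= addrK.
pose v0 := retracted Psi u0; pose gv := retracted_grad Psi p (m := m) u0 g0.
have P0 := Psi_ge0 hn hq Wrad_ge0 Wrad_mono r0 gm wp p2.
have v0q x : eball 0 r x -> enorm (v0 x) <= q.
  exact: (retracted_q hn hq Wrad_ge0 Wrad_mono r0 gm wp p2 u0q).
have v02 j : L2 (eball 0 r) (vcomp v0 j).
  exact: (retracted_L2 hn hq Wrad_ge0 Wrad_mono r0 gm wp p2 nu0).
have gv2 j i : L2 (eball 0 r) (gv j i).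
  exact: (retracted_grad_L2 hn hq Wrad_ge0 Wrad_mono r0 gm wp p2 nu0).
have wv j i : weak_partial (eball 0 r) i (vcomp v0 j) (gv j i).
  exact: (retracted_weak hn hq Wrad_ge0 Wrad_mono r0 gm wp p2 nu0).
have B0E : eball (0 + x0) r = eball x0 r by rewrite add0r.
have mB0 := @measurable_eball R n 0 r.
have fB0 := leb_eball_lty (0 : 'rV[R]_n) r.
(* The competitor is the retraction translated back to [x0]; the perturbation is minus the translate
   of [retract_fun], which has zero trace. *)
pose xi x := v0 (x - x0) - u x.
have xiE : (fun x => u x + xi x) = (fun x => v0 (x - x0)).
  by apply/funext => x; rewrite /xi addrC subrK.
have xi0 : W12v_0 (eball x0 r) xi.
  move=> j; pose f x := - retract_fun Psi (fun j => vcomp u0 j) 0 j x.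
  have -> : vcomp xi j = (fun x => f (x - x0)).
    apply/funext => x; rewrite /vcomp /xi !mxE /f /u0 subrK.
    by rewrite addrAC subrr add0r.
  pose gf i x := - retract_grad Psi p (fun j => vcomp u0 j) g0 0 j i x.
  have fL2 : L2 (eball 0 r) f.
    by apply: L2N => //; exact: (retract_fun_L2 hn r0 wp p2 cP nu0 P0).
  have rw i := retract_weak r0 wp p2 cP nu0 P0 j i (lexx 0).
  have gL2 i : L2 (eball 0 r) (gf i) by apply: L2N => //; exact: (rw i).2.
  have wf i : weak_partial (eball 0 r) i f (gf i).
    have := weak_partialZ mB0 (-1) _ _ (rw i).1.
    have E : (fun x => -1 * retract_fun Psi (fun j => vcomp u0 j) 0 j x) = f.
      by apply/funext => x; rewrite mulN1r.
    have E' : (fun x => -1 * retract_grad Psi p (fun j => vcomp u0 j) g0 0 j i x) = gf i.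
      by apply/funext => x; rewrite mulN1r.
    rewrite E E'; apply; apply: L2_L1 => //; last exact: (rw i).2.
    exact: (retract_fun_L2 hn r0 wp p2 cP nu0 P0).
  have apf : wapprox 0 r f gf.
    exact/wapproxN/(retract_wapprox hn r0 Psi_A wp p2 cP nu0 u0q P0).
  rewrite -B0E; apply: (@wapprox_W12_0 _ _ _ _ _ (fun i x => gf i (x - x0))).
  - by apply: wapprox_shift => //; [exact: fL2.1|move=> i; exact: (gL2 i).1].
  - exact: L2_shift.
  - by move=> i; exact: L2_shift.
  - by move=> i; apply: weak_partial_shift => //; exact: L2_L1.
have vq : Linfty_le (eball x0 r) (fun x => u x + xi x) q.
  rewrite xiE; apply: aeW => x Bx; apply: v0q.
  by apply/(@eball_shift R n 0 x0); rewrite B0E.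
have := u_min _ (@eball_open _ _ x0 r) (@eball_bounded _ _ x0 r)
  (lipschitz_boundary_eball r0) clO _ xi0 vq.
rewrite xiE.
have mu0 j : measurable_fun (eball 0 r) (vcomp u0 j) by exact: cbW12_measurable (nu0 j).
have mg0 j i : measurable_fun (eball 0 r) (g0 j i).
  by have [_ _ _ l] := nu0 j; exact: (l i).1.
have mWu := potential_measurable W_lsc mu0 u0q.
have mWv := potential_measurable W_lsc (fun j => (v02 j).1) v0q.
have Eu : energy W (eball x0 r) u =
    (\int[leb n]_(x in eball 0%R r) (energy_density W u0 g0 x)%:E)%E.
  have mWu' : measurable_fun (eball x0 r) (fun x => W (u x)).
    have := measurable_shift (c := x0) mWu; rewrite B0E; congr measurable_fun.
    by apply/funext => x; rewrite /u0 subrK.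
  rewrite (energy_weak wgu mWu') -[RHS](integral_shift x0); last first.
    exact: (energy_density_measurable W_lsc).
  rewrite B0E; apply: eq_integral => x _.
  by rewrite /energy_density /u0 /g0 subrK.
have Ev : energy W (eball x0 r) (fun x => v0 (x - x0)) =
    (\int[leb n]_(x in eball 0%R r) (energy_density W v0 gv x)%:E)%E.
  have mWv' : measurable_fun (eball x0 r) (fun x => W (v0 (x - x0))).
    by have := measurable_shift (c := x0) mWv; rewrite B0E.
  rewrite (@energy_weak _ _ _ _ _ _ _ (fun j i x => gv j i (x - x0)))//; last first.
    move=> j i; rewrite -B0E.
    by apply: (@weak_partial_shift _ _ _ _ _ _ (vcomp v0 j)) => //; exact: L2_L1.
  rewrite -[RHS](integral_shift x0); first by rewrite B0E.
  by apply: (energy_density_measurable W_lsc) => // [j|j i]; [exact: (v02 j).1|exact: (gv2 j i).1].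
rewrite Eu Ev => H.
have main := energy_comparison hn hq W_ge0 W_lsc W_bounded W_split Wrad_ge0 Wrad_mono
  W0_mono r0 gm wp p2 nu0 u0q H.
(* The energy comparison covers the open ball. On the sphere [Psi] equals [q], which bounds
   [|u|]. *)
move=> x; rewrite /ecball/= le_eqVlt => /predU1P[xr|xr].
  rewrite (boundary_value hn r0 Psi_A wp p2 cP xr); apply/uq/sub.
  by rewrite /ecball/= xr.
by have := main (x - x0); rewrite /u0 subrK; apply; rewrite /eball/= subr0.
Qed.
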